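(* Let $\mathcal G$ be a connected noncompact locally finite metric graph and $\mathcal K\subseteq\mathcal G$ a connected subgraph. Let $2<q<6$, let $V\in L^2(\mathcal G)+L^\infty(\mathcal G)$ and $M\in H^1(\mathcal G)+W^{1,\infty}(\mathcal G)$ be real-valued. Suppose that $A^M=\left(i\frac{\mathrm d}{\mathrm dx}+M\right)^2+V$ admits a ground state (an eigenfunction for $\inf\sigma(A^M)$) that does not vanish identically on $\mathcal K$. For $\mu>0$ set $$E_{\mathrm{NLS}}^{(\mathcal K)}:=\inf_{\substack{u\in H^1(\mathcal G)\\ \|u\|_{L^2}^2=1}}\ \frac12\int_{\mathcal G}\left|\left(i\frac{\mathrm d}{\mathrm dx}+M\right)u\right|^2+V|u|^2\,\mathrm dx-\frac{\mu}{q}\int_{\mathcal K}|u|^q\,\mathrm dx .$$ (i) If $\inf\sigma(A^M)<\inf\sigma_{\mathrm{ess}}(A^M)$, then $E_{\mathrm{NLS}}^{(\mathcal K)}$ admits a minimizer (the infimum is attained) for all sufficiently small $\mu>0$. (ii) If $\mathcal K$ is a bounded subgraph of $\mathcal G$, then minimizers exist for all $\mu>0$.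
   Context: A metric graph $\mathcal G=(\mathcal V,\mathcal E)$ is obtained from edges $e\in\mathcal E$, each identified with an interval $I_e=[0,l_e]$ ($0<l_e<\infty$) or $I_e=[0,\infty)$ (if $l_e=\infty$; a ray), by gluing finite endpoints at vertices $\mathsf v\in\mathcal V$ (each of degree at least one). It carries the shortest-path metric and Lebesgue measure. It is locally finite if $\mathcal E$ is countable and every bounded subset of $\mathcal G$ meets at most finitely many edges. $u_e:=u|_e$. $C(\mathcal G)$ is the set of continuous functions; $L^p(\mathcal G)$ is defined edgewise; $H^1(\mathcal G)=\{u\in C(\mathcal G):u_e\in H^1(I_e),\ \sum_e\|u_e\|_{H^1(I_e)}^2<\infty\}$; $W^{1,\infty}(\mathcal G)=\{u\in C(\mathcal G):u_e\in W^{1,\infty}(I_e),\ \sup_e\|u_e\|_{W^{1,\infty}(I_e)}<\infty\}$. $A^M$ is the self-adjoint operator on $L^2(\mathcal G)$ associated with the form $a$ on $H^1(\mathcal G)$, $$a(u,v)=\int_{\mathcal G}\overline{\left(i\tfrac{\mathrm d}{\mathrm dx}+M\right)u}\,\left(i\tfrac{\mathrm d}{\mathrm dx}+M\right)v+V\overline u v\,\mathrm dx .$$ It acts edgewise as $\left(i\frac{\mathrm d}{\mathrm dx}+M\right)^2+V$ on continuous, edgewise $H^2$ functions satisfying the natural vertex conditions of this form (in the paper's notation $\sum_{e\succ\mathsf v}\left(i\frac{\partial}{\partial\nu}+M\right)u_e(\mathsf v)=0$ at every vertex, where $\frac{\partial}{\partial\nu}$ is the derivative pointing from $\mathsf v$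 into the edge $e$ and $e\succ\mathsf v$ means $e$ is adjacent to $\mathsf v$). *)

(* Defs.v *)
From HB Require Import structures.
From mathcomp Require Import all_boot all_order all_algebra.
From mathcomp Require Import complex.
From mathcomp Require Import all_classical all_reals all_analysis.

Set Implicit Arguments.
Unset Strict Implicit.
Unset Printing Implicit Defensive.

Import Order.TTheory GRing.Theory Num.Theory.
Import numFieldNormedType.Exports.

Local Open Scope classical_set_scope.
Local Open Scope ring_scope.
Local Open Scope complex_scope.

(* The edge [e] is a copy of [0, len e], or of [0, +oo[ if [len e = +oo]; its
   endpoint 0 is glued to [origin e] and its endpoint [len e], if finite, to
   [terminus e].  For a ray, [terminus e] is a dummy value that is never used.
   The edge type is pointed, hence nonempty, because measurable types are. *)
Record metricGraph (R : realType) := MetricGraph {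
  vertex : Type ;
  edge : pointedType ;
  len : edge -> \bar R ;
  origin : edge -> vertex ;
  terminus : edge -> vertex ;
  len_gt0 : forall e, (0 < len e)%E ;
  vertex_deg : forall v,
    exists e, origin e = v \/ ((len e < +oo)%E /\ terminus e = v) }.

Arguments len {R} m e.
Arguments origin {R} m e.
Arguments terminus {R} m e.

Section Points.
Context {R : realType}.
Variable G : metricGraph R.

Definition on_interval (a : edge G * R) : bool :=
  (0 <= a.2) && (a.2%:E <= len G a.1)%E.

(* Points of the disjoint union of the edges.  The gluing is not performed by
   a quotient: the shortest-path distance below is a pseudometric on this type,
   vanishing between points that are to be identified, and the topology it
   defines is the preimage of that of the metric graph.  Thus the continuous
   functions on [gpoint] are exactly those on the metric graph, and
   compactness and connectedness have the same meaning on both. *)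
Definition gpoint : Type := {a : edge G * R | on_interval a}.

HB.instance Definition _ := Choice.on gpoint.

Definition edge_of (p : gpoint) : edge G := (sval p).1.
Definition coord (p : gpoint) : R := (sval p).2.

Lemma base_point_subproof : on_interval (@point (edge G), 0).
Proof. by rewrite /on_interval /= lexx /= ltW// len_gt0. Qed.

HB.instance Definition _ := isPointed.Build gpoint
  (exist (fun a => on_interval a) _ base_point_subproof).

Definition at_vertex (p : gpoint) (v : vertex G) : Prop :=
  (coord p = 0 /\ origin G (edge_of p) = v) \/
  ((coord p)%:E = len G (edge_of p) /\ terminus G (edge_of p) = v).

Definition glued (p p' : gpoint) : Prop :=
  exists v, at_vertex p v /\ at_vertex p' v.

(* A path is a finite sequence of hops, each of which either stays on one edge
   or passes at no cost from an edge to another one through a vertex. *)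
Definition hop (p p' : gpoint) : \bar R :=
  if `[< glued p p' >] then 0%E
  else if edge_of p == edge_of p' then (`|coord p - coord p'|)%:E
  else +oo%E.

Fixpoint path_len (p : gpoint) (s : seq gpoint) : \bar R :=
  if s is p' :: s' then (hop p p' + path_len p' s')%E else 0%E.

Definition gdist (p p' : gpoint) : \bar R :=
  ereal_inf [set path_len p s | s in [set s | last p s = p']].

Definition gball (p : gpoint) (r : R) : set gpoint :=
  [set p' | (gdist p p' < r%:E)%E].

Lemma hop_ge0 p p' : (0 <= hop p p')%E.
Proof.
by rewrite /hop; case: ifP => // _; case: ifP => // _.
Qed.

Lemma hopC p p' : hop p p' = hop p' p.
Proof.
rewrite /hop eq_sym distrC.
suff -> : `[< glued p p' >] = `[< glued p' p >] by [].
by apply/asboolP/asboolP => -[v [? ?]]; exists v.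
Qed.

Lemma path_len_ge0 p s : (0 <= path_len p s)%E.
Proof. by elim: s p => //= p' s IH p; rewrite adde_ge0// hop_ge0. Qed.

Lemma path_len_cat p s s' :
  path_len p (s ++ s') = (path_len p s + path_len (last p s) s')%E.
Proof. by elim: s p => [p|p' s IH p] /=; rewrite ?add0e// IH addeA. Qed.

Lemma path_len_rev p s :
  path_len (last p s) (rev (belast p s)) = path_len p s.
Proof.
elim: s p => //= p' s IH p.
rewrite rev_cons -cats1 path_len_cat IH /= adde0 addeC; congr (_ + _)%E.
have -> : last (last p' s) (rev (belast p' s)) = p'.
  by case: s {IH} => //= a s; rewrite rev_cons last_rcons.
by rewrite hopC.
Qed.

Lemma gdist_ge0 p p' : (0 <= gdist p p')%E.
Proof. by apply: le_ereal_inf_tmp => _ [s _ <-]; exact: path_len_ge0. Qed.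

Lemma gdistxx p : gdist p p = 0%E.
Proof.
apply/eqP; rewrite eq_le gdist_ge0 andbT.
by apply: ereal_inf_lbound; exists [::].
Qed.

Lemma gdistC_le p p' : (gdist p p' <= gdist p' p)%E.
Proof.
apply: le_ereal_inf_tmp => _ [s /= sp <-].
apply: ereal_inf_lbound; exists (rev (belast p' s)).
  by case: s sp => [//|a s] /=; rewrite rev_cons last_rcons.
by rewrite -sp path_len_rev.
Qed.

Lemma gball_center p (r : R) : 0 < r -> gball p r p.
Proof. by move=> r0; rewrite /gball /= gdistxx lte_fin. Qed.

Lemma gball_sym p p' (r : R) : gball p r p' -> gball p' r p.
Proof. by apply: le_lt_trans; exact: gdistC_le. Qed.

Lemma gball_triangle p1 p2 p3 (r s : R) :
  gball p1 r p2 -> gball p2 s p3 -> gball p1 (r + s) p3.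
Proof.
move=> /ereal_inf_lt [_ [s1 /= l1 <-] h1] /ereal_inf_lt [_ [s2 /= l2 <-] h2].
rewrite /gball /=; apply: (@le_lt_trans _ _ (path_len p1 (s1 ++ s2))).
  by apply: ereal_inf_lbound; exists (s1 ++ s2) => //=; rewrite last_cat l1.
by rewrite path_len_cat l1 EFinD lteD.
Qed.

HB.instance Definition _ := hasNbhs.Build gpoint
  (nbhs_ (entourage_ gball)).

HB.instance Definition _ := @Nbhs_isPseudoMetric.Build R gpoint
  (entourage_ gball) erefl gball gball_center gball_sym gball_triangle erefl.

Definition gbounded (A : set gpoint) : Prop :=
  exists r : R, forall p p', A p -> A p' -> (gdist p p' <= r%:E)%E.

(* [A] ranges over all bounded sets, in particular over those that contain all
   copies of their vertices, so edges met only at an endpoint are counted. *)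
Definition locally_finite : Prop :=
  countable [set: edge G] /\
  forall A, gbounded A -> finite_set [set edge_of p | p in A].

(* The subgraph with edge set [F]. *)
Definition subgraph (F : set (edge G)) : set gpoint := [set p | F (edge_of p)].

(* A set of points is measurable if its slice on each edge is a Borel set, and
   its measure is the sum of the Lebesgue measures of these slices. *)
Definition slice (e : edge G) (A : set gpoint) : set R :=
  [set x | exists2 p, A p & sval p = (e, x)].

Definition gmeasurable : set (set gpoint) :=
  [set A | forall e, measurable (slice e A)].

Lemma slice0 e : slice e set0 = set0.
Proof. by apply/seteqP; split => // x [p []]. Qed.

Lemma sliceT e : slice e setT = [set x | 0 <= x /\ (x%:E <= len G e)%E].
Proof.
apply/seteqP; split => [x [[a /= h] _ /= ax]|x /= [x0 xl]].
  by move: h; rewrite ax => /andP.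
have h : on_interval (e, x) by rewrite /on_interval /= x0.
by exists (exist (fun a => on_interval a) _ h).
Qed.

Lemma sliceC e A : slice e (~` A) = slice e setT `\` slice e A.
Proof.
apply/seteqP; split => [x [p nAp px]|x [[p _ px] nA]].
  split; first by exists p.
  case=> p' Ap' p'x; apply: nAp; rewrite (_ : p = p')//.
  by apply: val_inj; rewrite /= px.
by exists p => // Ap; apply: nA; exists p.
Qed.

Lemma slice_bigcup e (A : (set gpoint)^nat) :
  slice e (\bigcup_n A n) = \bigcup_n slice e (A n).
Proof.
apply/seteqP; split => [x [p [n _ Anp] px]|x [n _ [p Anp px]]].
  by exists n => //; exists p.
by exists p => //; exists n.
Qed.

Lemma trivIset_slice e (A : (set gpoint)^nat) :
  trivIset setT A -> trivIset setT (fun n => slice e (A n)).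
Proof.
move=> tA; apply/trivIsetP => i j _ _ ij; apply/seteqP; split => // x.
move=> [[p Ap px] [p' Ap' p'x]].
have pp' : p = p' by apply: val_inj; rewrite /= px.
rewrite -pp' in Ap'.
have /trivIsetP/(_ i j I I ij) Aij0 := tA.
by have : (A i `&` A j) p by []; rewrite Aij0.
Qed.

Lemma measurable_sliceT e : measurable (slice e setT).
Proof.
rewrite sliceT.
case El : (len G e) => [l| |].
- rewrite (_ : [set x | _] = `[0, l]%classic)//.
  by apply/seteqP; split => x; rewrite /= in_itv/= lee_fin => /andP.
- rewrite (_ : [set x | _] = `[0, +oo[%classic)//.
  apply/seteqP; split => x; rewrite /= in_itv/= andbT ?leey; first by case.
  by split.
- by have := len_gt0 e; rewrite El.
Qed.

Lemma gmeasurable0 : gmeasurable set0.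
Proof. by move=> e; rewrite slice0. Qed.

Lemma gmeasurableC A : gmeasurable A -> gmeasurable (~` A).
Proof.
move=> mA e; rewrite sliceC; apply: measurableD => //.
exact: measurable_sliceT.
Qed.

Lemma gmeasurable_bigcup (A : (set gpoint)^nat) :
  (forall n, gmeasurable (A n)) -> gmeasurable (\bigcup_n A n).
Proof.
move=> mA e; rewrite slice_bigcup; apply: bigcupT_measurable => n.
exact: mA.
Qed.

HB.instance Definition _ := isMeasurable.Build default_measure_display gpoint
  gmeasurable0 gmeasurableC gmeasurable_bigcup.

Definition gmeasure (A : set gpoint) : \bar R :=
  \esum_(e in [set: edge G]) lebesgue_measure (slice e A).

Lemma gmeasure0 : gmeasure set0 = 0%E.
Proof. by rewrite /gmeasure esum1// => e _; rewrite slice0 measure0. Qed.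

Lemma gmeasure_ge0 A : (0 <= gmeasure A)%E.
Proof. by apply: esum_ge0 => e _. Qed.

Lemma gmeasure_semi_sigma_additive : semi_sigma_additive gmeasure.
Proof.
move=> A mA tA _.
rewrite [X in _ --> X](_ : _ = (\sum_(n <oo) gmeasure (A n))%E).
  apply: is_cvg_nneseries => n _ _; exact: gmeasure_ge0.
rewrite nneseries_esumT; last by move=> n; exact: gmeasure_ge0.
rewrite /gmeasure.
transitivity (\esum_(e in [set: edge G]) \esum_(n in [set: nat])
    lebesgue_measure (slice e (A n))).
  apply: eq_esum => e _; rewrite slice_bigcup measure_bigcup//; last 2 first.
  - by move=> n _; exact: mA.
  - exact: trivIset_slice.
  rewrite -nneseries_esumT//.
  by apply: eq_eseriesl => n; rewrite in_setT.
rewrite (esum_esum (J := fun=> [set: nat]))//.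
rewrite (esum_esum (J := fun=> [set: edge G]))//.
rewrite (reindex_esum ([set: nat] `*`` (fun=> [set: edge G])) _
  (fun k => (k.2, k.1)))//.
split=> //.
- by move=> [? ?] [? ?] _ _ /= [-> ->].
- by move=> [e n] _; exists (n, e).
Qed.

HB.instance Definition _ := isMeasure.Build _ _ _ gmeasure
  gmeasure0 gmeasure_ge0 gmeasure_semi_sigma_additive.

End Points.

Arguments gmeasure {R} G A.

Section FunctionSpaces.
Context {R : realType}.
Variable G : metricGraph R.
Implicit Types (u v w g : gpoint G -> R[i]) (V M : gpoint G -> R).

Local Notation mu := (gmeasure G).

Definition Cint d (T : measurableType d) (nu : {measure set T -> \bar R})
    (D : set T) (f : T -> R[i]) : R[i] :=
  (\int[nu]_(x in D) complex.Re (f x)) +i* (\int[nu]_(x in D) complex.Im (f x)).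

Definition norm_Lp (p : \bar R) u : \bar R :=
  Lnorm mu p (fun x => (Normc.normc (u x))%:E).

Definition Lp (p : \bar R) u : Prop :=
  [/\ measurable_fun setT (fun x => complex.Re (u x)),
      measurable_fun setT (fun x => complex.Im (u x)) &
      (norm_Lp p u < +oo)%E].

Definition open_edge (e : edge G) : set R := [set x | 0 < x /\ (x%:E < len G e)%E].

(* The restriction u_e, extended by 0 outside the interval of [e]. *)
Definition restr u (e : edge G) (x : R) : R[i] :=
  if insub (e, x) : option (gpoint G) is Some p then u p else 0.

(* C^1 functions with compact support in the open edge. *)
Definition test_fun (e : edge G) (phi : R -> R) : Prop :=
  [/\ forall x, derivable phi x 1, continuous (derive1 phi) &
      exists K, [/\ compact K, K `<=` open_edge e &
                    forall x, phi x != 0 -> K x]].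

Definition weak_derivative u g : Prop := forall e,
  [/\ locally_integrable (open_edge e) (fun x => complex.Re (restr g e x)),
      locally_integrable (open_edge e) (fun x => complex.Im (restr g e x)) &
      forall phi, test_fun e phi ->
        Cint lebesgue_measure (open_edge e)
          (fun x => restr u e x * (derive1 phi x)%:C) =
        - Cint lebesgue_measure (open_edge e)
          (fun x => restr g e x * (phi x)%:C)].

(* W^{1,p}(G): since [mu] is the sum of the Lebesgue measures of the edges, the
   L^p bounds on u and u' over the graph are the bounds on the l^p-sum (the
   supremum if p = oo) of the W^{1,p}-norms over the edges. *)
Definition W1 (p : \bar R) u : Prop :=
  [/\ continuous (u : gpoint G -> R[i]^o), Lp p u & exists2 g, weak_derivative u g & Lp p g].

Definition H1 := W1 2%:E.

(* u', well defined almost everywhere if u has a weak derivative. *)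
Definition wderiv u : gpoint G -> R[i] := xget (cst 0) (weak_derivative u).

Definition real_fun V : gpoint G -> R[i] := fun x => (V x)%:C.

Definition sum_space (X Y : (gpoint G -> R[i]) -> Prop) u : Prop :=
  exists v w, [/\ X v, Y w & forall x, u x = v x + w x].

End FunctionSpaces.

Section Operator.
Context {R : realType} (G : metricGraph R).
Variables V M : gpoint G -> R.
Implicit Types (u v w f : gpoint G -> R[i]) (lambda : R).

Local Notation mu := (gmeasure G).

(* (i d/dx + M) u *)
Definition momentum u : gpoint G -> R[i] :=
  fun x => 'i * wderiv u x + (M x)%:C * u x.

Definition form u v : R[i] :=
  Cint mu setT (fun x => (momentum u x)^* * momentum v x
                         + (V x)%:C * (u x)^* * v x).

Definition inner u v : R[i] := Cint mu setT (fun x => (u x)^* * v x).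

(* The graph of the operator associated with the form: u is in the domain of
   A^M and A^M u = w. *)
Definition operator u w : Prop :=
  [/\ H1 u, Lp 2%:E w & forall v, H1 v -> form u v = inner w v].

(* A^M - z is a bijection from its domain onto L^2 with bounded inverse;
   injectivity is part of the last estimate. *)
Definition resolvent_set (z : R[i]) : Prop :=
  (forall f, Lp 2%:E f -> exists u, operator u (fun x => f x + z * u x)) /\
  (exists C : R, forall u f, Lp 2%:E f -> operator u (fun x => f x + z * u x) ->
     (norm_Lp 2%:E u <= C%:E * norm_Lp 2%:E f)%E).

(* Real points suffice, as A^M is self-adjoint. *)
Definition spectrum : set R := [set lambda | ~ resolvent_set lambda%:C].

Definition eigenspace lambda : set (gpoint G -> R[i]) :=
  [set u | operator u (fun x => lambda%:C * u x)].

Definition eigenfunction lambda u : Prop :=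
  eigenspace lambda u /\ exists x, u x != 0.

Definition finite_dim (X : set (gpoint G -> R[i])) : Prop :=
  exists n (b : 'I_n -> gpoint G -> R[i]), forall u, X u ->
    exists c : 'I_n -> R[i], forall x, u x = \sum_(i < n) c i * b i x.

Definition discrete_spectrum : set R :=
  [set lambda | [/\ isolated spectrum lambda,
                    exists u, eigenfunction lambda u &
                    finite_dim (eigenspace lambda)]].

Definition essential_spectrum : set R := spectrum `\` discrete_spectrum.

Definition einf (A : set R) : \bar R := ereal_inf (EFin @` A).

Definition ground_state u : Prop :=
  exists2 lambda, lambda%:E = einf spectrum & eigenfunction lambda u.

End Operator.

Section NLS.
Context {R : realType} (G : metricGraph R).
Variables (V M : gpoint G -> R) (K : set (gpoint G)) (q mu : R).
Implicit Types u : gpoint G -> R[i].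

Local Notation normc := Normc.normc.

Definition NLS_energy u : R :=
  2^-1 * (\int[gmeasure G]_x (normc (momentum M u x) ^+ 2 + V x * normc (u x) ^+ 2))
  - mu / q * \int[gmeasure G]_(x in K) (normc (u x) `^ q).

Definition admissible u : Prop :=
  H1 u /\ \int[gmeasure G]_x (normc (u x) ^+ 2) = 1.

Definition E_NLS : \bar R := einf [set NLS_energy u | u in admissible].

Definition NLS_minimizer u : Prop :=
  admissible u /\ (NLS_energy u)%:E = E_NLS.

End NLS.

(* Main.v *)
(* Let [b] be the form of A^M minus the bottom of the spectrum, so that [b >= 0],
   and let [j] be the infimum of [b / 2 - (mu / q) * |u|_q^q] on the unit sphere of
   L^2; testing with the ground state gives [j < 0].  For two members [u], [v] of a
   minimizing sequence the midpoint has norm less than 1, and since the functional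
   is at least [|.|^2 j] inside the unit ball, the parallelogram identity yields
   [b(u-v) / 8 + |j| |u-v|^2 / 4 <= o(1) + C mu |u-v|^2_(L^2(K))], where [C] is uniform
   because q < 6 makes the sublevel sets bounded in H1, hence in the sup norm.  If
   [K] is bounded the last term is small by equicontinuity along an ultrafilter.
   Otherwise the ground states span a finite-dimensional space, on the complement
   of which [b] is bounded below by a multiple of the L^2 norm, so that for small
   [mu] the last term is absorbed up to finitely many coefficients, which converge
   along an ultrafilter.  Either way the sequence is Cauchy in H1, and its strong
   limit is a minimizer. *)

Require Import Defs.
From HB Require Import structures.
From mathcomp Require Import all_boot all_order all_algebra.
From mathcomp Require Import complex.
From mathcomp Require Import all_classical all_reals all_analysis.
From mathcomp Require Import measurable_realfun ess_sup_inf.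
From mathcomp Require Import ring lra.

Set Implicit Arguments.
Unset Strict Implicit.
Unset Printing Implicit Defensive.

Import Order.TTheory GRing.Theory Num.Theory.
Import numFieldNormedType.Exports.

Local Open Scope classical_set_scope.
Local Open Scope ring_scope.

(** The spectrum is defined by resolvents, so both spectral inputs are drawn from bounded
    solvability of the form equation. A lower bound of the form that is a resolvent point can be
    raised, which gives b >= 0. If ]0, 2z[ contains no spectrum of b, then the powers of (1 - z R_z)
    / 2, where R_z is the resolvent at z, separate the kernel from the rest and give b >= 2z off the
    kernel. All forms are real parts, so that symmetric bilinear algebra over the reals applies;
    multiplication by -i recovers the imaginary parts. The edges may be infinitely many and
    arbitrarily short, so a Sobolev inequality edge by edge has no uniform constant. The sup bound
    is obtained globally, from connectedness: if the modulus falls below half its value at some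
    point, it runs through all values in between. The result is |u|_oo^4 <= C |u|_2^2 |u|_(H1)^2. On
    the unit sphere of L^2 the power term is then of order (q - 2) / 4 < 1 in |u'|_2^2, which is
    where q < 6 enters. Elements of H1 are functions, but their derivatives are determined only up
    to null sets; hence the many statements that hold almost everywhere. *)

Local Notation normc := Normc.normc.

(** * The du Bois-Reymond lemma *)

Section Spline.
Context {R : realType}.
Implicit Types a h t : R.

Definition pos t : R := Num.max t 0.

Lemma pos_cases t : (0 <= t /\ pos t = t) \/ (t <= 0 /\ pos t = 0).
Proof.
rewrite /pos; case: (leP 0 t) => t0; [left|right]; split => //; last exact/ltW.
Qed.

(** The first-order Taylor error of [pos t ^+ 2] is at most [h ^+ 2], also across the kink at 0. *)
Lemma is_derive_pos2 t : is_derive t 1 (fun t => pos t ^+ 2) (2 * pos t).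
Proof.
have lim : h^-1 *: (pos (h *: 1 + t) ^+ 2 - pos t ^+ 2) @[h --> 0^'] --> 2 * pos t.
  apply/cvgrPdist_le => e e0; near=> h.
  have h0 : h != 0 by near: h; exact: nbhs_dnbhs_neq.
  have he : `|h| <= e.
    near: h; apply: dnbhs0_le => //.
  rewrite scaler1 (le_trans _ he)//.
  have hpos : 0 < `|h| by rewrite normr_gt0.
  rewrite -(ler_pM2l hpos) -normrM (_ : h * _ = 2 * h * pos t - (pos (h + t) ^+ 2 - pos t ^+ 2)).
    rewrite -expr2 real_normK ?num_real// ler_norml.
    by case: (pos_cases t) => -[? ->]; case: (pos_cases (h + t)) => -[? ->];
      apply/andP; split; nra.
  rewrite mulrBr [X in _ - X](_ : _ = pos (h + t) ^+ 2 - pos t ^+ 2); last exact: mulVKf.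
  by ring.
apply: DeriveDef; first by apply/cvg_ex; eexists; exact: lim.
exact: cvg_lim lim.
Unshelve. all: by end_near. Qed.

Lemma continuous_pos : continuous pos.
Proof.
move=> t; apply: (@continuous_max _ _ (id : R -> R^o) (cst 0)) => //.
exact: cvg_cst.
Qed.

(** A quadratic C^1 spline climbing from 0 at [a] to 1 at [a + 2 * h]: a mollified Heaviside
    function, explicit as a second difference of [pos t ^+ 2]. *)
Definition step a h t : R :=
  (pos (t - a) ^+ 2 - 2 * pos (t - (a + h)) ^+ 2 + pos (t - (a + 2 * h)) ^+ 2)
  / (2 * h ^+ 2).

(** The tent of mass 1 on [[a, a + 2 * h]], with peak 1/h at [a + h]. *)
Definition dstep a h t : R :=
  (pos (t - a) - 2 * pos (t - (a + h)) + pos (t - (a + 2 * h))) / h ^+ 2.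

Lemma is_derive_step a h t : 0 < h -> is_derive t 1 (step a h) (dstep a h t).
Proof.
move=> h0.
have D c : is_derive t 1 (fun t => pos (t - c) ^+ 2) (2 * pos (t - c)).
  have := @is_derive1_comp R (fun t => pos t ^+ 2) (fun t => t - c) t _ _
    (is_derive_pos2 (t - c)) (is_derive_shift _ _ _).
  by rewrite mulr1.
rewrite (_ : step a h = (2 * h ^+ 2)^-1 \*: ((fun t => pos (t - a) ^+ 2)
  - 2 \*: (fun t => pos (t - (a + h)) ^+ 2) + (fun t => pos (t - (a + 2 * h)) ^+ 2))).
  apply: is_derive_eq; rewrite /dstep /GRing.scale/=.
  by field; rewrite gt_eqF.
by apply/funext => x; rewrite /step mulrC.
Qed.

Lemma continuous_dstep a h : continuous (dstep a h).
Proof.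
have C c : continuous (fun t => pos (t - c)).
  move=> t; apply: (@continuous_comp _ _ _ (fun t => t - c) pos); last exact: continuous_pos.
  by apply: cvgB; [exact: cvg_id|exact: cvg_cst].
move=> t; apply: cvgMl; apply: cvgD; last exact: C.
apply: cvgB; first exact: C.
apply: cvgMr; exact: C.
Qed.

Lemma dstep_ge0 a h t : 0 < h -> 0 <= dstep a h t.
Proof.
move=> h0; rewrite divr_ge0 ?sqr_ge0//.
by case: (pos_cases (t - a)) => -[? ->]; case: (pos_cases (t - (a + h))) => -[? ->];
  case: (pos_cases (t - (a + 2 * h))) => -[? ->]; lra.
Qed.

Lemma dstep_out a h t : 0 < h -> t <= a \/ a + 2 * h <= t -> dstep a h t = 0.
Proof.
move=> h0 ta; rewrite /dstep (_ : _ - _ + _ = 0) ?mul0r//.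
by case: (pos_cases (t - a)) => -[? ->]; case: (pos_cases (t - (a + h))) => -[? ->];
  case: (pos_cases (t - (a + 2 * h))) => -[? ->]; case: ta; lra.
Qed.

Lemma step_lt a h t : 0 < h -> t <= a -> step a h t = 0.
Proof.
move=> h0 ta; rewrite /step (_ : _ - _ + _ = 0) ?mul0r//.
by case: (pos_cases (t - a)) => -[? ->]; case: (pos_cases (t - (a + h))) => -[? ->];
  case: (pos_cases (t - (a + 2 * h))) => -[? ->]; nra.
Qed.

Lemma step_gt a h t : 0 < h -> a + 2 * h <= t -> step a h t = 1.
Proof.
move=> h0 ta; rewrite /step (_ : _ - _ + _ = 2 * h ^+ 2).
  by rewrite divff// lt0r_neq0// mulr_gt0// exprn_gt0.
by case: (pos_cases (t - a)) => -[? ->]; case: (pos_cases (t - (a + h))) => -[? ->];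
  case: (pos_cases (t - (a + 2 * h))) => -[? ->]; nra.
Qed.

Lemma step_ge0_le1 a h t : 0 < h -> 0 <= step a h t <= 1.
Proof.
move=> h0; have h2 : 0 < 2 * h ^+ 2 by rewrite mulr_gt0// exprn_gt0.
rewrite /step ler_pdivlMr// ler_pdivrMr// mul0r mul1r.
by case: (pos_cases (t - a)) => -[? ->]; case: (pos_cases (t - (a + h))) => -[? ->];
  case: (pos_cases (t - (a + 2 * h))) => -[? ->]; apply/andP; split; nra.
Qed.

End Spline.

Section RealIntegral.
Context d (T : measurableType d) (R : realType).
Variable mu : {measure set T -> \bar R}.
Implicit Types (D : set T) (f g : T -> R).

Lemma le_integrable_EFin D f g : measurable D -> measurable_fun D f ->
  (forall x, D x -> `|f x| <= g x) -> mu.-integrable D (EFin \o g) ->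
  mu.-integrable D (EFin \o f).
Proof.
move=> mD mf fg ig; apply: le_integrable ig => //.
  exact/measurable_EFinP.
by move=> x Dx /=; rewrite lee_fin (le_trans (fg _ Dx))// ler_norm.
Qed.

Lemma Rintegral_support D E f : measurable D -> measurable E -> D `<=` E ->
  (forall x, E x -> ~ D x -> f x = 0) ->
  \int[mu]_(x in E) f x = \int[mu]_(x in D) f x.
Proof.
move=> mD mE DE f0; rewrite Rintegral_mkcond [RHS]Rintegral_mkcond.
apply: eq_Rintegral => x _; rewrite !patchE.
case: (boolP (x \in E)) => Ex; case: (boolP (x \in D)) => Dx //.
- by apply: f0; [exact/set_mem|move/mem_set; rewrite (negbTE Dx)].
- by move: Ex; rewrite mem_set//; exact/DE/set_mem.
Qed.

End RealIntegral.

Section DuBoisReymond.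
Context {R : realType}.
Local Notation lam := (@lebesgue_measure R).
Implicit Types (f g phi : R -> R) (a b c : R).

Lemma continuous_segment_integrable f a b :
  (forall x, a <= x <= b -> {for x, continuous f}) ->
  lam.-integrable `[a, b]%classic (EFin \o f).
Proof.
move=> cf; apply: continuous_compact_integrable; first exact: segment_compact.
apply: continuous_in_subspaceT => x /set_mem; rewrite /= in_itv/= => xab.
exact: cf.
Qed.

Lemma int_dstep a (h : R) : 0 < h ->
  \int[lam]_(x in `[a, (a + 2 * h)]) dstep a h x = 1.
Proof.
move=> h0; rewrite /Rintegral (@continuous_FTC2 _ _ (step a h)).
- by rewrite step_gt// step_lt//= subr0.
- by rewrite ltrDl mulr_gt0.
- exact/continuous_subspaceT/continuous_dstep.
- have c : continuous (step a h).
    move=> x; apply/differentiable_continuous/derivable1_diffP.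
    by have [] := is_derive_step a x h0.
  split => [x _| |]; first by have [] := is_derive_step a x h0.
  + exact/cvg_at_right_filter/c.
  + exact/cvg_at_left_filter/c.
- move=> x _; rewrite derive1E; exact: (@derive_val _ _ _ _ _ _ _ (is_derive_step a x h0)).
Qed.

(** [dstep a h] is a probability density on the segment, so the integral is a mean of values of
    [f]. *)
Lemma int_dstep_approx f a (h e : R) : 0 < h ->
  (forall x, a <= x <= a + 2 * h -> {for x, continuous f}) ->
  (forall x, a <= x <= a + 2 * h -> `|f x - f a| <= e) ->
  `|\int[lam]_(x in `[a, (a + 2 * h)]) (f x * dstep a h x) - f a| <= e.
Proof.
move=> h0 cf fe.
have cd x : {for x, continuous (dstep a h)} by exact: continuous_dstep.
have id : lam.-integrable `[a, a + 2 * h] (EFin \o dstep a h).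
  exact: continuous_segment_integrable.
have ifd : lam.-integrable `[a, a + 2 * h] (EFin \o (fun x => f x * dstep a h x)).
  apply: continuous_segment_integrable => x xab.
  by apply: cvgM; [exact: cf|exact: cd].
have ifd' : lam.-integrable `[a, a + 2 * h] (EFin \o (fun x => (f x - f a) * dstep a h x)).
  apply: continuous_segment_integrable => x xab.
  by apply: cvgM; [apply: cvgB; [exact: cf|exact: cvg_cst]|exact: cd].
have -> : \int[lam]_(x in `[a, (a + 2 * h)]) (f x * dstep a h x) - f a =
    \int[lam]_(x in `[a, (a + 2 * h)]) ((f x - f a) * dstep a h x).
  under [RHS]eq_Rintegral do rewrite mulrBl.
  rewrite RintegralB//; last first.
    by apply: continuous_segment_integrable => x xab; apply: cvgM; [exact: cvg_cst|exact: cd].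
  by rewrite RintegralZl// int_dstep// mulr1.
rewrite (le_trans (le_normr_Rintegral _ _))//.
have -> : e = \int[lam]_(x in `[a, (a + 2 * h)]) (e * dstep a h x).
  by rewrite RintegralZl// int_dstep// mulr1.
apply: le_Rintegral => //.
- apply: continuous_segment_integrable => x xab; apply: cvg_norm.
  by apply: cvgM; [apply: cvgB; [exact: cf|exact: cvg_cst]|exact: cd].
- apply: continuous_segment_integrable => x xab.
  by apply: cvgM; [exact: cvg_cst|exact: cd].
- move=> x; rewrite /= in_itv/= => xab.
  by rewrite normrM (ger0_norm (dstep_ge0 _ _ h0)) ler_wpM2r ?dstep_ge0// fe.
Qed.

(** Convertible to [test_fun e] when [O] is [open_edge e]. *)
Definition C1_test (O : set R) phi := [/\ forall x, derivable phi x 1,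
  continuous (derive1 phi) &
  exists K, [/\ compact K, K `<=` O & forall x, phi x != 0 -> K x]].

(** The test functions [step a h - step b h] tend to the indicator of ]a, b] as h tends to 0, and
    their derivatives to the difference of the point masses at [a] and [b]; both sides of the weak
    identity converge accordingly. *)
Lemma weak_FTC (O : set R) f g a b :
  (forall x, O x -> {for x, continuous f}) -> locally_integrable O g ->
  (forall phi, C1_test O phi ->
    \int[lam]_(x in O) (f x * derive1 phi x) =
    - \int[lam]_(x in O) (g x * phi x)) ->
  a < b -> `[a, b] `<=` O ->
  \int[lam]_(x in `[a, b]) g x = f b - f a.
Proof.
move=> cf [mg oO ig] fg ab abO.
have mO : measurable O by exact: open_measurable.
(* [step b h] levels off only at [b + 2 * h], so a margin to the right of [b] inside [O] is needed;
   [h n] is scaled to stay within it. *)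
have [c bc acO] : exists2 c, b < c & `[a, c] `<=` O.
  have Ob : O b by apply: abO; rewrite /= in_itv/= lexx ltW.
  have /nbhs_ballP[d /= d0 dO] : nbhs b O by exact: open_nbhs_nbhs.
  exists (b + d / 2); first by rewrite ltrDl divr_gt0.
  move=> x; rewrite /= in_itv/= => /andP[ax xb].
  case: (leP x b) => xb'; first by apply: abO; rewrite /= in_itv/= ax.
  by apply: dO; rewrite /ball/= distrC ger0_norm ?subr_ge0 1?ltW//; lra.
have igc : lam.-integrable `[a, c]%classic (EFin \o g).
  apply/integrableP; split.
    by apply/measurable_EFinP; exact: measurable_funS mg.
  by apply: ig => //; exact: segment_compact.
pose h n : R := (c - b) / 2 / n.+1%:R.
have h_gt0 n : 0 < h n by rewrite !divr_gt0// subr_gt0.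
have h_le n : b + 2 * h n <= c.
  suff : h n <= (c - b) / 2 by lra.
  by rewrite ler_pdivrMr// ler_peMr// ?ler1n//; lra.
have h_cvg : h n @[n --> \oo] --> (0 : R).
  rewrite -[0 in X in _ --> X](mulr0 ((c - b) / 2)).
  by apply: cvgM; [exact: cvg_cst|exact: cvg_harmonic].
pose phi n : R -> R := fun x => step a (h n) x - step b (h n) x.
have dphi n (x : R) : is_derive x (1 : R) (phi n) (dstep a (h n) x - dstep b (h n) x).
  exact: (is_deriveB (is_derive_step a x (h_gt0 n)) (is_derive_step b x (h_gt0 n))).
have dphiE n : derive1 (phi n) = (fun x => dstep a (h n) x - dstep b (h n) x).
  by apply/funext => x; rewrite derive1E derive_val.
have phi_out n x : ~ `[a, c]%classic x -> phi n x = 0.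
  rewrite /= in_itv/= => /negP; rewrite negb_and -!ltNge => xac.
  rewrite /phi.
  have := h_le n; have := h_gt0 n; case/orP: xac => xac *.
    by rewrite !step_lt ?subrr//; lra.
  by rewrite !step_gt ?subrr//; lra.
have tphi n : C1_test O (phi n).
  split => [x||]; first by have [] := dphi n x.
    by rewrite dphiE => x; apply: cvgB; exact: continuous_dstep.
  exists `[a, c]%classic; split => //; first exact: segment_compact.
  by move=> x; apply: contra_neqP => /phi_out ->.
have J_cvg p : a <= p <= b ->
    \int[lam]_(x in O) (f x * dstep p (h n) x) @[n --> \oo] --> f p.
  move=> /andP[ap pb].
  have sub n : `[p, p + 2 * h n] `<=` `[a, c].
    by move=> x; rewrite /= !in_itv/= => /andP[? ?]; apply/andP; have := h_le n; lra.
  have Jn n : \int[lam]_(x in O) (f x * dstep p (h n) x) =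
      \int[lam]_(x in `[p, (p + 2 * h n)]) (f x * dstep p (h n) x).
    apply: Rintegral_support => //; first by move=> x /sub /acO.
    move=> x _; rewrite /= in_itv/= => /negP; rewrite negb_and -!ltNge => xp.
    rewrite dstep_out ?mulr0//.
    by case/orP: xp => /ltW xp; [left|right].
  under eq_fun do rewrite Jn.
  have Op : O p by apply: abO; rewrite /= in_itv/= ap pb.
  apply/cvgrPdist_le => e e0.
  have /cvgrPdist_le /(_ _ e0) := cf _ Op.
  move=> /nbhs_ballP[d /= d0 dP].
  have : \forall n \near \oo, h n < d / 2.
    by move/cvgr_lt : h_cvg => /(_ (d / 2)); apply; rewrite divr_gt0.
  apply: filterS => n hd; rewrite distrC; apply: int_dstep_approx => //.
    move=> x xp; apply: cf; apply: acO; apply: (sub n).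
    by rewrite /= in_itv.
  move=> x /andP[px xp]; rewrite distrC; apply: dP.
  by rewrite /ball/= distrC ger0_norm ?subr_ge0//; lra.
have lhs : \int[lam]_(x in O) (f x * derive1 (phi n) x) @[n --> \oo] --> f a - f b.
  have -> : (fun n => \int[lam]_(x in O) (f x * derive1 (phi n) x)) =
    (fun n => \int[lam]_(x in O) (f x * dstep a (h n) x) -
       \int[lam]_(x in O) (f x * dstep b (h n) x)).
    apply/funext => n; rewrite dphiE.
    have S p : a <= p <= b -> \int[lam]_(x in O) (f x * dstep p (h n) x) =
        \int[lam]_(x in `[a, c]) (f x * dstep p (h n) x).
      move=> /andP[ap pb]; apply: Rintegral_support => // x _.
      rewrite /= in_itv/= => /negP; rewrite negb_and -!ltNge => xp.
      rewrite dstep_out ?mulr0//; have := h_le n; have := h_gt0 n.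
      by case/orP: xp => xp; [left|right]; lra.
    have I p : lam.-integrable `[a, c] (EFin \o (fun x => f x * dstep p (h n) x)).
      apply: continuous_segment_integrable => x xac.
      by apply: cvgM; [apply/cf/acO; rewrite /= in_itv|exact: continuous_dstep].
    rewrite !S ?lexx ?(ltW ab)// -RintegralB//.
    rewrite (@Rintegral_support _ _ _ lam `[a, c]%classic)//.
      by apply: eq_Rintegral => x _; rewrite mulrBr.
    move=> x _ /=; rewrite in_itv/= => /negP; rewrite negb_and -!ltNge => xp.
    have := h_le n; have := h_gt0 n => *.
    rewrite !dstep_out ?subrr ?mulr0//.
      by case/orP: xp => xp; [left|right]; lra.
    by case/orP: xp => xp; [left|right]; lra.
  by apply: cvgB; apply: J_cvg; rewrite lexx ltW.
have rhs : (- \int[lam]_(x in O) (g x * phi n x)) @[n --> \oo] -->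
    - \int[lam]_(x in `[a, b]) g x.
  apply: cvgN.
  have -> : (fun n => \int[lam]_(x in O) (g x * phi n x)) =
      (fun n => \int[lam]_(x in `[a, c]) (g x * phi n x)).
    apply/funext => n; apply: Rintegral_support => // x _ xac.
    by rewrite phi_out ?mulr0.
  (* Each spline vanishes at its left end, so the pointwise limit is 0 at [a] and 1 at [b]: the
     indicator of the half-open interval. *)
  have -> : \int[lam]_(x in `[a, b]) g x =
      \int[lam]_(x in `[a, c]) (g x * \1_(`]a, b]%classic) x).
    rewrite -Rintegral_itv_obnd_cbnd; last first.
      apply: integrableS igc => // x; rewrite /= !in_itv/= => /andP[? ?].
      by apply/andP; lra.
    rewrite [RHS](@Rintegral_support _ _ _ lam `]a, b]%classic)//.
    - by apply: eq_Rintegral => x xab; rewrite indicE xab mulr1.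
    - by move=> x; rewrite /= !in_itv/= => /andP[? ?]; apply/andP; lra.
    - by move=> x _ xab; rewrite indicE memNset// mulr0.
  have ind_le1 x : `|\1_(`]a, b]%classic) x : R| <= 1.
    by rewrite indicE; case: (_ \in _); rewrite ?normr1 ?normr0.
  apply: fine_cvg; rewrite fineK; last first.
    apply: integrable_fin_num => //; apply: le_integrable_EFin (integrable_norm igc) => //.
      apply: measurable_funM; first exact: measurable_funS mg.
      exact: measurable_indic.
    by move=> x _; rewrite normrM ler_piMr.
  have [] // := @dominated_convergence _ _ _ lam `[a, c]%classic _
    (fun n x => (g x * phi n x)%:E) (fun x => (g x * \1_(`]a, b]%classic) x)%:E)
    (fun x => `|g x|%:E).
  - move=> n; apply/measurable_EFinP; apply: measurable_funM.
      exact: measurable_funS mg.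
    apply: measurable_funTS; apply: continuous_measurable_fun => x.
    by apply/differentiable_continuous/derivable1_diffP; have [] := dphi n x.
  - apply/measurable_EFinP; apply: measurable_funM; first exact: measurable_funS mg.
    exact: measurable_indic.
  - apply: aeW => x; rewrite /= in_itv/= => /andP[ax xc].
    apply: cvg_EFin; first by apply: nearW.
    apply: cvgM; first exact: cvg_cst.
    apply: cvg_near_cst; rewrite /phi indicE.
    have H r : 0 < r -> \forall n \near \oo, h n < r / 2.
      by move=> r0; move/cvgr_lt : h_cvg => /(_ (r / 2)); apply; rewrite divr_gt0.
    case: (leP x a) => xa.
      rewrite memNset; last by rewrite /= in_itv/= ltNge xa.
      by apply: nearW => n; rewrite !step_lt ?subrr//; lra.
    case: (leP x b) => xb.
      rewrite mem_set; last by rewrite /= in_itv/= xa.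
      have := H (x - a); rewrite subr_gt0 => /(_ xa); apply: filterS => n hn.
      by rewrite step_gt ?step_lt ?subr0//; lra.
    rewrite memNset; last by rewrite /= in_itv/= xa leNgt xb.
    have := H (x - b); rewrite subr_gt0 => /(_ xb); apply: filterS => n hn.
    by rewrite !step_gt ?subrr//; lra.
  - exact: integrable_norm igc.
  - apply: aeW => x n _; rewrite /= lee_fin normrM ler_piMr//.
    have /andP[? ?] := step_ge0_le1 a x (h_gt0 n).
    have /andP[? ?] := step_ge0_le1 b x (h_gt0 n).
    by rewrite /phi ler_norml; apply/andP; split; lra.
apply/eqP; rewrite -eqr_opp opprB; apply/eqP.
have E : (fun n => \int[lam]_(x in O) (f x * derive1 (phi n) x)) =
    (fun n => - \int[lam]_(x in O) (g x * phi n x)).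
  by apply/funext => n; exact: fg.
by rewrite E in lhs; exact: (cvg_unique _ rhs lhs).
Qed.

End DuBoisReymond.

(** * Symmetric forms and square-integrable functions *)

Section SymmetricForms.
Context {R : realType} {X : lmodType R}.
Implicit Types (D : set X) (b : X -> X -> R) (u v w : X) (c : R).

Definition lin_subspace D := D 0 /\ forall c u v, D u -> D v -> D (c *: u + v).

(** Restricted to [D] because the instances are integrals, which are additive only on integrable
    functions. *)
Definition sym_form D b :=
  (forall u v, D u -> D v -> b u v = b v u) /\
  (forall c u v w, D u -> D v -> D w -> b (c *: u + v) w = c * b u w + b v w).

Lemma lin_subspaceZ D c u : lin_subspace D -> D u -> D (c *: u).
Proof. by move=> [D0 DP] Du; rewrite -[_ *: _]addr0; exact: DP. Qed.

Lemma lin_subspaceD D u v : lin_subspace D -> D u -> D v -> D (u + v).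
Proof. by move=> [D0 DP] Du Dv; rewrite -[u]scale1r; exact: DP. Qed.

Lemma lin_subspaceB D u v : lin_subspace D -> D u -> D v -> D (u - v).
Proof. by move=> [D0 DP] Du Dv; rewrite addrC -scaleN1r; exact: DP. Qed.

Section form.
Variables (D : set X) (b : X -> X -> R).
Hypotheses (sD : lin_subspace D) (sb : sym_form D b).

Lemma sf_sym u v : D u -> D v -> b u v = b v u.
Proof. by move=> Du Dv; rewrite sb.1. Qed.

Lemma sf_linl c u v w : D u -> D v -> D w ->
  b (c *: u + v) w = c * b u w + b v w.
Proof. exact: sb.2. Qed.

Lemma sf_linr c u v w : D u -> D v -> D w ->
  b w (c *: u + v) = c * b w u + b w v.
Proof.
by move=> Du Dv Dw; rewrite sf_sym ?sf_linl 1?[b w u]sf_sym 1?[b w v]sf_sym//;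
  exact: sD.2.
Qed.

Lemma sf_0l w : D w -> b 0 w = 0.
Proof.
move=> Dw; have := sf_linl 1 sD.1 sD.1 Dw.
by rewrite scaler0 addr0 mul1r => /eqP; rewrite -subr_eq0 opprD addNKr oppr_eq0 => /eqP.
Qed.

Lemma sf_Zl c u w : D u -> D w -> b (c *: u) w = c * b u w.
Proof.
by move=> Du Dw; have := sf_linl c Du sD.1 Dw; rewrite addr0 sf_0l// addr0.
Qed.

Lemma sf_Zr c u w : D u -> D w -> b w (c *: u) = c * b w u.
Proof.
by move=> Du Dw; rewrite sf_sym ?sf_Zl 1?sf_sym//; exact: lin_subspaceZ.
Qed.

Lemma sf_Dl u v w : D u -> D v -> D w -> b (u + v) w = b u w + b v w.
Proof. by move=> Du Dv Dw; have := sf_linl 1 Du Dv Dw; rewrite scale1r mul1r. Qed.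

Lemma sf_Dr u v w : D u -> D v -> D w -> b w (u + v) = b w u + b w v.
Proof. by move=> Du Dv Dw; have := sf_linr 1 Du Dv Dw; rewrite scale1r mul1r. Qed.

Lemma sf_Nl u w : D u -> D w -> b (- u) w = - b u w.
Proof. by move=> Du Dw; rewrite -scaleN1r sf_Zl// mulN1r. Qed.

Lemma sf_Bl u v w : D u -> D v -> D w -> b (u - v) w = b u w - b v w.
Proof.
by move=> Du Dv Dw; rewrite sf_Dl ?sf_Nl// -scaleN1r; exact: lin_subspaceZ.
Qed.

Lemma sf_Br u v w : D u -> D v -> D w -> b w (u - v) = b w u - b w v.
Proof.
move=> Du Dv Dw; rewrite sf_sym ?sf_Bl//; last exact: lin_subspaceB.
by rewrite ![b w _]sf_sym.
Qed.

Lemma sf_sqrD u v : D u -> D v -> b (u + v) (u + v) = b u u + 2 * b u v + b v v.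
Proof.
move=> Du Dv; have Duv := lin_subspaceD sD Du Dv.
by rewrite sf_Dl// !sf_Dr// [b v u]sf_sym//; ring.
Qed.

Lemma sf_sqrB u v : D u -> D v -> b (u - v) (u - v) = b u u - 2 * b u v + b v v.
Proof.
move=> Du Dv; have Duv := lin_subspaceB sD Du Dv.
by rewrite sf_Bl// !sf_Br// [b v u]sf_sym//; ring.
Qed.

Hypothesis b_ge0 : forall u, D u -> 0 <= b u u.

Lemma sf_CS u v : D u -> D v -> b u v ^+ 2 <= b u u * b v v.
Proof.
move=> Du Dv.
have H t : 0 <= t ^+ 2 * b u u + 2 * t * b u v + b v v.
  have Dtu := lin_subspaceZ t sD Du.
  have := b_ge0 (lin_subspaceD sD Dtu Dv).
  by rewrite sf_sqrD// !sf_Zl// sf_Zr//; congr (_ <= _); ring.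
have := b_ge0 Du; rewrite le_eqVlt => /predU1P[uu0|uu0].
  rewrite -uu0 mul0r.
  case: (eqVneq (b u v) 0) => [->|uv0]; first by rewrite expr0n.
  (* At this [t] the right-hand side of [H] would be -1. *)
  have := H (- (b v v + 1) / (2 * b u v)); rewrite -uu0 mulr0 add0r.
  rewrite (_ : 2 * _ * _ = - (b v v + 1)); first by lra.
  by field.
have := H (- b u v / b u u).
rewrite -(pmulr_rge0 _ uu0) => {}H; rewrite -subr_ge0; apply: le_trans H _.
by rewrite le_eqVlt; apply/orP; left; apply/eqP; field; rewrite gt_eqF.
Qed.

Lemma sf_sqrD_le u v : D u -> D v ->
  b (u + v) (u + v) <= 2 * b u u + 2 * b v v.
Proof.
move=> Du Dv; have := b_ge0 (lin_subspaceB sD Du Dv).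
by rewrite sf_sqrB// sf_sqrD//; lra.
Qed.

End form.

End SymmetricForms.

(** * Square-integrable real functions: products, Fatou's lemma and completeness *)

Section SquareIntegrable.
Context d (T : measurableType d) (R : realType).
Variable mu : {measure set T -> \bar R}.
Implicit Types (f g : T -> R).

Lemma integrableD_EFin D f g : measurable D -> mu.-integrable D (EFin \o f) ->
  mu.-integrable D (EFin \o g) -> mu.-integrable D (EFin \o (fun x => f x + g x)).
Proof. by move=> mD fi gi; exact: (integrableD mD fi gi). Qed.

Lemma integrableZ_EFin D c f : measurable D -> mu.-integrable D (EFin \o f) ->
  mu.-integrable D (EFin \o (fun x => c * f x)).
Proof. by move=> mD fi; exact: (integrableZl mD c fi). Qed.

Definition sqint f := measurable_fun setT f /\
  mu.-integrable setT (EFin \o (fun x => f x ^+ 2)).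

Lemma sqint_mul f g : sqint f -> sqint g ->
  mu.-integrable setT (EFin \o (fun x => f x * g x)).
Proof.
move=> [mf if2] [mg ig2].
apply: (@le_integrable_EFin _ _ _ _ setT _ (fun x => f x ^+ 2 + g x ^+ 2)) => //.
- exact: measurable_funM.
- by move=> x _; rewrite ler_norml; apply/andP; split; nra.
- exact: integrableD_EFin.
Qed.

Lemma sqint_lin c f g : sqint f -> sqint g -> sqint (fun x => c * f x + g x).
Proof.
move=> [mf if2] [mg ig2]; split.
  by apply: measurable_funD => //; apply: measurable_funM => //; exact: measurable_cst.
apply: (@le_integrable_EFin _ _ _ _ setT _
  (fun x => (2 * c ^+ 2) * f x ^+ 2 + 2 * g x ^+ 2)) => //.
- apply: measurable_funX; apply: measurable_funD => //.
  by apply: measurable_funM => //; exact: measurable_cst.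
- by move=> x _; rewrite ger0_norm ?sqr_ge0//; have := sqr_ge0 (c * f x - g x); nra.
- by apply: integrableD_EFin => //; exact: integrableZ_EFin.
Qed.

Lemma sqint_cst0 : sqint (cst 0).
Proof.
split; first exact: measurable_cst.
by rewrite (_ : _ \o _ = cst 0%E) ?integrable0//; apply/funext => x /=; rewrite expr0n.
Qed.

Lemma sqintZ c f : sqint f -> sqint (fun x => c * f x).
Proof.
move=> sf; rewrite (_ : (fun _ => _) = fun x => c * f x + cst 0 x).
  by apply: sqint_lin => //; exact: sqint_cst0.
by apply/funext => x; rewrite addr0.
Qed.

Lemma sqintB f g : sqint f -> sqint g -> sqint (fun x => f x - g x).
Proof.
move=> sf sg; rewrite (_ : (fun _ => _) = fun x => - 1 * g x + f x).
  exact: sqint_lin.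
by apply/funext => x; rewrite mulN1r addrC.
Qed.

Lemma sqintM_bounded f g (C : R) : sqint f -> measurable_fun setT g ->
  {ae mu, forall x, `|g x| <= C} -> sqint (fun x => g x * f x).
Proof.
move=> [mf if2] mg gC; split; first exact: measurable_funM.
have mgf : measurable_fun setT (EFin \o (fun x => (g x * f x) ^+ 2)).
  by apply/measurable_EFinP/measurable_funX/measurable_funM.
apply/integrableP; split => //.
have /integrableP[_] : mu.-integrable setT (EFin \o (fun x => C ^+ 2 * f x ^+ 2)).
  exact: integrableZ_EFin.
apply: le_lt_trans; apply: ae_ge0_le_integral => //.
- exact: measurableT_comp.
- apply: measurableT_comp => //; apply/measurable_EFinP; apply: measurable_funM => //.
  exact: measurable_funX.
- apply: filterS gC => x gC _ /=; rewrite lee_fin (ger0_norm (sqr_ge0 _)).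
  rewrite (ger0_norm (mulr_ge0 (sqr_ge0 _) (sqr_ge0 _))).
  rewrite exprMn ler_wpM2r ?sqr_ge0//.
  rewrite -(real_normK (num_real (g x))) lerXn2r ?nnegrE//.
  by rewrite (le_trans _ gC).
Qed.

Lemma limn_einf_le_near (a : (\bar R)^nat) (c : \bar R) :
  (\forall n \near \oo, (a n <= c)%E) -> (limn_einf a <= c)%E.
Proof.
move=> ac; rewrite limn_einf_lim; apply: lime_le; first exact: is_cvg_einfs.
apply: filterS ac => n; apply: le_trans.
by apply: ereal_inf_lbound; exists n => //=.
Qed.

Lemma limn_einf_ge0 (a : (\bar R)^nat) :
  (forall n, (0 <= a n)%E) -> (0 <= limn_einf a)%E.
Proof.
move=> a0; rewrite limn_einf_lim; apply: lime_ge; first exact: is_cvg_einfs.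
by apply: nearW => n; apply: le_ereal_inf_tmp => _ [m _ <-].
Qed.

Lemma Rintegral_sqr_EFin f : sqint f ->
  (\int[mu]_x (f x ^+ 2))%:E = (\int[mu]_x (f x ^+ 2)%:E)%E.
Proof.
by move=> [mf if2]; rewrite /Rintegral fineK//; exact: integrable_fin_num.
Qed.

Lemma sqint_le f (C : R) : measurable_fun setT f ->
  (\int[mu]_x (f x ^+ 2)%:E <= C%:E)%E -> sqint f /\ \int[mu]_x (f x ^+ 2) <= C.
Proof.
move=> mf fC.
have sf : sqint f.
  split => //; apply/integrableP; split.
    by apply/measurable_EFinP; exact: measurable_funX.
  under eq_integral do rewrite /= ger0_norm ?sqr_ge0//.
  by rewrite (le_lt_trans fC)// ltry.
by split => //; rewrite -lee_fin Rintegral_sqr_EFin.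
Qed.

(** Fatou's lemma for squares. With [h] a member of the sequence, it turns an L^2 Cauchy estimate
    into the same estimate for the distance to the pointwise limit. *)
Lemma sqint_Fatou (f : nat -> T -> R) g h (C : R) :
  (forall n, sqint (f n)) -> sqint h -> measurable_fun setT g ->
  {ae mu, forall x, f n x @[n --> \oo] --> g x} ->
  (\forall n \near \oo, \int[mu]_x ((h x - f n x) ^+ 2) <= C) ->
  sqint (fun x => h x - g x) /\ \int[mu]_x ((h x - g x) ^+ 2) <= C.
Proof.
move=> sf sh mg fg fC.
have mhf n : measurable_fun setT (fun x => ((h x - f n x) ^+ 2)%:E).
  apply/measurable_EFinP; apply: measurable_funX; apply: measurable_funB.
    by case: sh.
  by case: (sf n).
apply: sqint_le; first by apply: measurable_funB => //; case: sh.
apply: (@le_trans _ _ (\int[mu]_x limn_einf (fun n => ((h x - f n x) ^+ 2)%:E))%E).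
  apply: ae_ge0_le_integral => //.
  - by move=> x _; rewrite lee_fin sqr_ge0.
  - apply/measurable_EFinP; apply: measurable_funX; apply: measurable_funB => //.
    by case: sh.
  - move=> x _; apply: limn_einf_ge0 => n.
    by rewrite lee_fin sqr_ge0.
  - rewrite /limn_einf; apply: measurableT_comp => //.
    by apply: measurable_fun_limn_esup => n; exact: measurableT_comp.
  - apply: filterS fg => x fgx _.
    have : ((h x - f n x) ^+ 2)%:E @[n --> \oo] --> ((h x - g x) ^+ 2)%:E.
      apply: cvg_EFin; first exact: nearW.
      have c : h x - f n x @[n --> \oo] --> h x - g x.
        by apply: cvgB => //; exact: cvg_cst.
      exact: (cvgM c c).
    by move/cvg_limn_einf_sup => -[-> _].
apply: (le_trans (fatou mu measurableT mhf _)).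
  by move=> n x _; rewrite lee_fin sqr_ge0.
apply: limn_einf_le_near; apply: filterS fC => n.
by rewrite -Rintegral_sqr_EFin ?lee_fin//; exact: sqintB.
Qed.

Lemma geometric_cvg (f : nat -> R) (C : R) : 0 <= C ->
  (forall n, `|f n.+1 - f n| <= C * 2^-1 ^+ n) -> cvgn f.
Proof.
move=> C0 fC.
have : cvgn (series (telescope f)).
  apply: normed_cvg; apply: (@series_le_cvg _ _ (geometric C 2^-1)) => [n|n|n|].
  - exact: normr_ge0.
  - exact: le_trans (normr_ge0 _) (fC n).
  - exact: fC.
  - by apply: is_cvg_geometric_series; rewrite ger0_norm// invf_lt1// ltr1n.
rewrite telescopeK => cv.
rewrite (_ : f = (fun n => (f n - f 0%N) + f 0%N)); last first.
  by apply/funext => n; rewrite subrK.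
by apply: is_cvgD => //; exact: is_cvg_cst.
Qed.

(** The rate [8^-1] leaves room for the weight [4 ^+ n]: the weighted squares of the increments
    still have summable integrals, so almost everywhere they are bounded, and the increments decay
    like [2^-1 ^+ n]. *)
Lemma sqint_complete (f : nat -> T -> R) : (forall n, sqint (f n)) ->
  (forall n m, (n <= m)%N -> \int[mu]_x ((f n x - f m x) ^+ 2) <= 8^-1 ^+ n.+1) ->
  exists g, [/\ sqint g, forall n, \int[mu]_x ((f n x - g x) ^+ 2) <= 8^-1 ^+ n.+1 &
    {ae mu, forall x, f n x @[n --> \oo] --> g x}].
Proof.
move=> sf fC.
pose s n x := 4 ^+ n * (f n.+1 x - f n x) ^+ 2.
have s_ge0 n x : (0 <= (s n x)%:E)%E by rewrite lee_fin mulr_ge0 ?sqr_ge0// exprn_ge0.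
have ms n : measurable_fun setT (fun x => (s n x)%:E).
  apply/measurable_EFinP; apply: measurable_funM; first exact: measurable_cst.
  by apply: measurable_funX; case: (sqintB (sf n.+1) (sf n)).
have ssum : (\int[mu]_x (\sum_(n <oo) (s n x)%:E) < +oo)%E.
  rewrite integral_nneseries//.
  apply: (@le_lt_trans _ _ (\sum_(n <oo) (1 / (2 ^ n.+1)%:R)%:E)%E); last first.
    by apply: le_lt_trans (epsilon_trick0 _ ler01) _; rewrite ltry.
  apply: lee_nneseries => [n _ _|n _]; first by apply: integral_ge0.
  rewrite /s; under eq_integral do rewrite EFinM.
  have sfn := sqintB (sf n) (sf n.+1).
  rewrite integralZl//; last by case: (sqintB (sf n.+1) (sf n)).
  rewrite -Rintegral_sqr_EFin; last exact: sqintB.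
  rewrite -EFinM lee_fin.
  under eq_Rintegral do rewrite -sqrrN opprB.
  rewrite (@le_trans _ _ (4 ^+ n * 8^-1 ^+ n.+1))//.
    by rewrite ler_wpM2l ?exprn_ge0//; apply: fC.
  rewrite natrX div1r -exprVn !exprS mulrCA -exprMn.
  rewrite (_ : 4 * 8^-1 = 2^-1); last by field.
  by rewrite ler_wpM2r ?exprn_ge0// lef_pV2 ?posrE// ler_nat.
have ae_s : {ae mu, forall x, (\sum_(n <oo) (s n x)%:E < +oo)%E}.
  have : mu.-integrable setT (fun x => \sum_(n <oo) (s n x)%:E)%E.
    apply/integrableP; split.
      exact: ge0_emeasurable_sum.
    by under eq_integral do rewrite gee0_abs ?nneseries_ge0//.
  move=> /(integrable_ae measurableT); apply: filterS => x /(_ I).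
  by rewrite fin_numElt => /andP[].
have ae_cvg : {ae mu, forall x, cvgn (f ^~ x)}.
  apply: filterS ae_s => x sx.
  have [C C0 sC] : exists2 C : R, 0 <= C & forall n, s n x <= C.
    exists (fine (\sum_(n <oo) (s n x)%:E)); first by rewrite fine_ge0// nneseries_ge0.
    move=> n; rewrite -lee_fin fineK ?ge0_fin_numE ?nneseries_ge0//.
    apply: le_trans (nneseries_lim_ge n.+1 _) => //.
    by rewrite big_nat_recr//= leeDr// sume_ge0.
  have C1 : 0 <= C + 1 by rewrite addr_ge0.
  apply: (geometric_cvg C1) => n; rewrite exprVn ler_pdivlMr ?exprn_gt0//.
  rewrite -(@ler_pXn2r _ 2) ?nnegrE ?mulr_ge0 ?addr_ge0// ?exprn_ge0//.
  rewrite exprMn real_normK ?num_real// -exprM mulnC exprM -natrX mulrC.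
  by rewrite (le_trans (sC n))//; nra.
(* The upper limit is measurable on the whole space, including the null set where the sequence
   diverges. *)
pose g x := fine (limn_esup (fun n => (f n x)%:E)).
have mg : measurable_fun setT g.
  apply: measurableT_comp; first exact: fine_measurable.
  apply: measurable_fun_limn_esup => n; apply/measurable_EFinP.
  by case: (sf n).
have fg : {ae mu, forall x, f n x @[n --> \oo] --> g x}.
  apply: filterS ae_cvg => x /cvg_ex[l fl].
  have : (f n x)%:E @[n --> \oo] --> l%:E by apply: cvg_EFin => //; exact: nearW.
  by move/cvg_limn_einf_sup => -[_ +]; rewrite /g => ->.
have H n : sqint (fun x => f n x - g x) /\ \int[mu]_x ((f n x - g x) ^+ 2) <= 8^-1 ^+ n.+1.
  apply: sqint_Fatou fg _ => //.
  by exists n => // m /= nm; exact: fC.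
exists g; split => // [|n]; last exact: (H n).2.
have -> : g = (fun x => f 0%N x - (f 0%N x - g x)) by apply/funext => x; rewrite subKr.
by apply: sqintB => //; exact: (H 0%N).1.
Qed.

End SquareIntegrable.

(** * Points and measure of the graph *)

Section ComplexNorm.
Context {R : realType}.
Implicit Types z w : R[i].

Lemma normcE2 z : normc z ^+ 2 = complex.Re z ^+ 2 + complex.Im z ^+ 2.
Proof. by case: z => a b /=; rewrite sqr_sqrtr// addr_ge0 ?sqr_ge0. Qed.

Lemma normc_ge0 z : 0 <= normc z.
Proof. by case: z => a b; exact: sqrtr_ge0. Qed.

Lemma normcCE z : `|z| = (normc z)%:C%C.
Proof. by case: z. Qed.

Lemma Re_le_normc z : `|complex.Re z| <= normc z.
Proof.
rewrite -(@ler_pXn2r _ 2) ?nnegrE ?normc_ge0// real_normK ?num_real// normcE2.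
by rewrite lerDl sqr_ge0.
Qed.

Lemma Im_le_normc z : `|complex.Im z| <= normc z.
Proof.
rewrite -(@ler_pXn2r _ 2) ?nnegrE ?normc_ge0// real_normK ?num_real// normcE2.
by rewrite lerDr sqr_ge0.
Qed.

Lemma normc_le_ReIm z : normc z <= `|complex.Re z| + `|complex.Im z|.
Proof.
rewrite -(@ler_pXn2r _ 2) ?nnegrE ?normc_ge0 ?addr_ge0// normcE2.
rewrite -[X in X + _]real_normK ?num_real// -[X in _ + X]real_normK ?num_real//.
by rewrite sqrrD -addrA lerD2l lerDr mulrn_wge0// mulr_ge0.
Qed.

Lemma normc_distC z w : normc (z - w) = normc (w - z).
Proof. by rewrite -normcN opprB. Qed.

Lemma ler_normc_dist z w : `|normc z - normc w| <= normc (z - w).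
Proof.
have H a b : normc a - normc b <= normc (a - b).
  by rewrite lerBlDr (le_trans _ (le_normcD _ _))// subrK.
by rewrite ler_norml H andbT lerNl opprB normc_distC H.
Qed.

End ComplexNorm.

Section GraphPoints.
Context {R : realType} {G : metricGraph R}.
Local Notation lam := (@lebesgue_measure R).
Local Notation mu := (gmeasure G).
Implicit Types (e : edge G) (x y : R) (p : gpoint G).

Lemma origin_on_interval e : on_interval (e, 0 : R).
Proof. by rewrite /on_interval /= lexx /= ltW// len_gt0. Qed.

(** Total on the line, to pull functions on the graph back to functions on R. Outside the interval
    of [e] its value is the endpoint 0 of [e], whereas [restr] extends functions by the number 0. *)
Definition pt e x : gpoint G :=
  insubd (exist (fun a => on_interval a) _ (origin_on_interval e)) (e, x).

Lemma val_pt e x : on_interval (e, x) -> sval (pt e x) = (e, x).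
Proof. by move=> h; rewrite /pt -[sval]/val val_insubd h. Qed.

Lemma pt_out e x : ~~ on_interval (e, x) -> sval (pt e x) = (e, 0).
Proof. by move=> h; rewrite /pt -[sval]/val val_insubd (negbTE h). Qed.

Lemma edge_of_pt e x : edge_of (pt e x) = e.
Proof.
rewrite /edge_of; case: (boolP (on_interval (e, x))) => h.
  by rewrite val_pt.
by rewrite pt_out.
Qed.

Lemma ptK p : pt (edge_of p) (Defs.coord p) = p.
Proof.
apply: val_inj; rewrite /=; case: p => -[e x] /= h.
by rewrite val_pt.
Qed.

Lemma restrE (u : gpoint G -> R[i]) e x : on_interval (e, x) -> restr u e x = u (pt e x).
Proof.
move=> h; rewrite /restr; case: insubP => [p _ px|]; last by rewrite h.
by congr u; apply: val_inj; rewrite px /= val_pt.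
Qed.

Lemma open_edge_on e x : open_edge e x -> on_interval (e, x).
Proof. by move=> [x0 xl]; rewrite /on_interval /= !ltW. Qed.

Lemma open_edge_open e : open (open_edge e).
Proof.
rewrite /open_edge; case El : (len G e) => [l| |].
- rewrite (_ : [set x | _] = `]0, l[%classic); first exact: interval_open.
  by apply/seteqP; split => x; rewrite /= in_itv/= lte_fin => /andP.
- rewrite (_ : [set x | _] = `]0, +oo[%classic); first exact: interval_open.
  by apply/seteqP; split => x; rewrite /= in_itv/= andbT ?ltry => // -[].
- by have := len_gt0 e; rewrite El.
Qed.

Lemma near_open_edge e x : open_edge e x -> \forall y \near x, open_edge e y.
Proof. by move=> ex; apply: open_nbhs_nbhs; split => //; exact: open_edge_open. Qed.

Lemma open_edge_itv e x y : open_edge e x -> open_edge e y -> `[x, y] `<=` open_edge e.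
Proof.
move=> [x0 xl] [y0 yl] z; rewrite /= in_itv/= => /andP[xz zy]; split.
  exact: lt_le_trans xz.
by apply: le_lt_trans yl; rewrite lee_fin.
Qed.

(** Estimates that come from weak derivatives hold on open edges; by continuity this lemma carries
    them to the endpoints. *)
Lemma open_edge_dense e x (d : R) : on_interval (e, x) -> 0 < d ->
  exists2 y, open_edge e y & `|x - y| < d.
Proof.
rewrite /on_interval/= => /andP[x0 xl] d0.
(* [l] stands in for the length of the edge, which may be infinite or larger than [d]: points in the
   left half of [0, l] are moved to the right, all others to the left. *)
have [l [l0 ll ld]] : exists l : R, [/\ 0 < l, (l%:E <= len G e)%E & l < d].
  have := len_gt0 e; case: (len G e) => [l| |]// l0.
    exists (Num.min l (d / 2)); split.
    - by rewrite lt_min -lte_fin l0 divr_gt0.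
    - by rewrite lee_fin ge_min lexx.
    - by rewrite gt_min; apply/orP; right; lra.
  by exists (d / 2); split; rewrite ?divr_gt0 ?leey//; lra.
have [xlt|xge] := ltP x (l / 2).
  exists (x + l / 2); first split; [lra| |].
    by apply: lt_le_trans ll; rewrite lte_fin; lra.
  by rewrite opprD addNKr normrN ger0_norm; lra.
exists (x - l / 4); first split; [lra| |].
  by apply: lt_le_trans xl; rewrite lte_fin; lra.
by rewrite opprB addrC subrK ger0_norm; lra.
Qed.

Lemma gball_pt e x y (d : R) : on_interval (e, x) -> on_interval (e, y) ->
  `|x - y| < d -> ball (pt e x) d (pt e y).
Proof.
move=> ex ey xyd; rewrite /ball/= /gball/= (@le_lt_trans _ _ `|x - y|%:E)%E//.
have : (gdist (pt e x) (pt e y) <= path_len (pt e x) [:: pt e y])%E.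
  by apply: ereal_inf_lbound; exists [:: pt e y].
move/le_trans; apply; rewrite /= adde0 /hop; case: ifP => _; first by rewrite lee_fin.
by rewrite !edge_of_pt eqxx /Defs.coord !val_pt.
Qed.

Lemma gcontinuousP (u : gpoint G -> R[i]) : continuous (u : gpoint G -> R[i]^o) <->
  (forall p (e : R), 0 < e -> \forall p' \near p, normc (u p - u p') < e).
Proof.
split=> cu p.
  move=> e e0; have /cvgrPdist_lt /(_ (e%:C)%C) := cu p.
  rewrite ltcR => /(_ e0); apply: filterS => p'.
  by rewrite normcCE ltcR.
(* A positive complex number has imaginary part 0, so the radius is a real one. *)
apply/(@cvgrPdist_lt _ R[i]^o _ (nbhs p) (nbhs_filter p) u (u p)) => -[e e']; rewrite ltcE => /andP[/= /eqP -> e0].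
have := cu p e e0; apply: (@filterS _ _ (nbhs_filter p)) => p' h.
by rewrite normcCE ltcE /= eqxx.
Qed.

Lemma continuous_pt (u : gpoint G -> R[i]) e x (eps : R) :
  continuous (u : gpoint G -> R[i]^o) -> on_interval (e, x) -> 0 < eps ->
  exists2 d : R, 0 < d & forall y, on_interval (e, y) -> `|x - y| < d ->
    normc (u (pt e x) - u (pt e y)) < eps.
Proof.
move=> /gcontinuousP cu ex eps0.
have /nbhs_ballP[d /= d0 dP] := cu (pt e x) eps eps0.
by exists d => // y ey xyd; apply: dP; exact: gball_pt.
Qed.

Lemma continuous_Re_pt (u : gpoint G -> R[i]) e x :
  continuous (u : gpoint G -> R[i]^o) -> open_edge e x ->
  {for x, continuous (fun y => complex.Re (u (pt e y)))} /\
  {for x, continuous (fun y => complex.Im (u (pt e y)))}.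
Proof.
move=> cu ex; split; apply/cvgrPdist_lt => eps eps0;
have [d d0 dP] := continuous_pt cu (open_edge_on ex) eps0.
  have := near_open_edge ex.
  have : \forall y \near x, `|x - y| < d by apply/nbhs_ballP; exists d.
  apply: filterS2 => y xyd ey; apply: le_lt_trans (dP _ (open_edge_on ey) xyd).
  by rewrite -raddfB; exact: Re_le_normc.
have := near_open_edge ex.
have : \forall y \near x, `|x - y| < d by apply/nbhs_ballP; exists d.
apply: filterS2 => y xyd ey; apply: le_lt_trans (dP _ (open_edge_on ey) xyd).
by rewrite -raddfB; exact: Im_le_normc.
Qed.

End GraphPoints.

Section GraphMeasure.
Context {R : realType} {G : metricGraph R}.
Local Notation lam := (@lebesgue_measure R).
Local Notation mu := (gmeasure G).
Implicit Types (e : edge G) (x y : R) (p : gpoint G).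

Lemma sliceP e (A : set (gpoint G)) x : slice e A x <-> on_interval (e, x) /\ A (pt e x).
Proof.
split=> [[p Ap px]|[ex Ax]]; last by exists (pt e x) => //; exact: val_pt.
have ex : on_interval (e, x) by rewrite -px; case: p {Ap px}.
by split => //; rewrite (_ : pt e x = p)//; apply: val_inj; rewrite /= val_pt.
Qed.

(** [pt e] is constant outside the interval, so a preimage is a slice together with all or nothing
    of the complement. *)
Lemma measurable_pt e : measurable_fun setT (pt e : R -> gpoint G).
Proof.
move=> _ B mB; rewrite setTI.
have -> : pt e @^-1` B = slice e B `|` (~` slice e setT `&` [set x | B (pt e 0)]).
  apply/seteqP; split => x /=.
    case: (boolP (on_interval (e, x))) => ex Bx; first by left; apply/sliceP.
    right; split; first by move=> /sliceP[h _]; rewrite h in ex.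
    rewrite (_ : pt e 0 = pt e x)//; apply: val_inj.
    by rewrite /= (pt_out ex) val_pt// origin_on_interval.
  move=> [/sliceP[]//|[nx Bx]].
  rewrite (_ : pt e x = pt e 0)//; apply: val_inj.
  rewrite /= pt_out ?val_pt ?origin_on_interval//.
  by apply/negP => ex; apply: nx; apply/sliceP.
apply: measurableU; first exact: mB.
apply: measurableI; first by apply: measurableC; exact: measurable_sliceT.
case: (pselect (B (pt e 0))) => h.
  by rewrite (_ : [set x | _] = setT)//; apply/seteqP; split.
by rewrite (_ : [set x | _] = set0)//; apply/seteqP; split.
Qed.

(** Endpoints are left out because [pt e] collapses everything outside the interval onto the
    endpoint 0; for sets of interior points, preimages under [pt e] are exactly slices. *)
Definition oedge e : set (gpoint G) :=
  [set p | edge_of p = e /\ open_edge e (Defs.coord p)].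

Lemma oedge_pt e x : open_edge e x -> oedge e (pt e x).
Proof.
by move=> ex; split; rewrite ?edge_of_pt// /Defs.coord val_pt//; exact: open_edge_on.
Qed.

Lemma slice_oedge e e' : slice e' (oedge e) = [set x | e' = e /\ open_edge e x].
Proof.
apply/seteqP; split => x /=.
  by move=> /sliceP[ex [h b]]; move: h b; rewrite edge_of_pt /Defs.coord val_pt.
by move=> [-> ex]; apply/sliceP; split; [exact: open_edge_on|exact: oedge_pt].
Qed.

Lemma measurable_open_edge e : measurable (open_edge e : set R).
Proof. by apply: open_measurable; exact: open_edge_open. Qed.

Lemma measurable_oedge e : measurable (oedge e).
Proof.
move=> e'; rewrite slice_oedge; case: (pselect (e' = e)) => [->|ne].
  rewrite (_ : [set x | _] = open_edge e); first exact: measurable_open_edge.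
  by apply/seteqP; split => x //= -[].
by rewrite (_ : [set x | _] = set0)//; apply/seteqP; split => x //= -[].
Qed.

Lemma preimage_pt_oedge e (A : set (gpoint G)) : A `<=` oedge e ->
  pt e @^-1` A = slice e A.
Proof.
move=> Ae; apply/seteqP; split => x /=; last by move=> /sliceP[].
move=> Ax; apply/sliceP; split => //.
case: (boolP (on_interval (e, x))) => // h.
by have [_] := Ae _ Ax; rewrite /Defs.coord pt_out//= => -[/=]; rewrite ltxx.
Qed.

Lemma preimage_oedge e : pt e @^-1` (oedge e) = open_edge e.
Proof.
by rewrite preimage_pt_oedge// slice_oedge; apply/seteqP; split => x //= -[].
Qed.

Lemma gmeasure_oedge e (A : set (gpoint G)) : A `<=` oedge e ->
  mu A = lam (slice e A).
Proof.
move=> Ae; rewrite /gmeasure/=.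
rewrite (@esum_mkcond _ _ setT) -(@esum_set1 _ _ e (fun e => lam (slice e A)))//.
rewrite [RHS]esum_mkcond; apply: eq_esum => e' _; rewrite in_setT.
case: ifPn => // /negP e'e.
rewrite (_ : slice e' A = set0) ?measure0//; apply/seteqP; split => // x.
move=> /sliceP[_ /Ae [+ _]]; rewrite edge_of_pt => ?; subst e'.
by exfalso; apply: e'e; rewrite inE.
Qed.

(** On [oedge e] the measure of the graph is the image of Lebesgue measure under [pt e], so the
    integral is computed by change of variables. *)
Lemma ge0_integral_oedge (f : gpoint G -> \bar R) e : measurable_fun setT f ->
  (forall p, 0 <= f p)%E ->
  (\int[mu]_(p in oedge e) f p = \int[lam]_(x in open_edge e) f (pt e x))%E.
Proof.
move=> mf f0.
rewrite -preimage_oedge -[RHS](@ge0_integral_pushforward _ _ (measurableTypeR R) _ _ (pt e)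
  (measurable_pt e) lam (oedge e) f (measurable_oedge e)).
- apply: eq_measure_integral; first exact: measurable_pt.
  by move=> ? A mA Ae; rewrite [LHS](gmeasure_oedge Ae) /= /pushforward preimage_pt_oedge.
- exact: measurable_funTS.
- by move=> p _; exact: f0.
Qed.

Lemma ge0_integral_oedge_le (f : gpoint G -> \bar R) e (K : set R) :
  measurable_fun setT f -> (forall p, 0 <= f p)%E ->
  measurable K -> K `<=` open_edge e ->
  (\int[lam]_(x in K) f (pt e x) <= \int[mu]_p f p)%E.
Proof.
move=> mf f0 mK Ke.
apply: (@le_trans _ _ (\int[lam]_(x in open_edge e) f (pt e x))%E).
  apply: ge0_subset_integral => //; first exact: measurable_open_edge.
  apply: measurable_funTS; apply: measurableT_comp => //; exact: measurable_pt.
rewrite -ge0_integral_oedge//; apply: ge0_subset_integral => //.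
exact: measurable_oedge.
Qed.

(* The endpoints of the edges carry no mass, so null sets may be checked on the
   open edges. *)
Lemma ae_graph (P : set (gpoint G)) :
  (forall e, lam.-negligible [set x | open_edge e x /\ ~ P (pt e x)]) ->
  {ae mu, forall p, P p}.
Proof.
move=> /choice[N hN].
pose B : set (gpoint G) := [set p | N (edge_of p) (Defs.coord p) \/
  ~ open_edge (edge_of p) (Defs.coord p)].
have sB e : slice e B = (slice e setT `&` N e) `|` (slice e setT `\` open_edge e).
  apply/seteqP; split => x.
    by move=> /sliceP[ex]; rewrite /B/= edge_of_pt /Defs.coord val_pt// => -[?|?];
      [left|right]; split => //; apply/sliceP.
  by move=> [[/sliceP[ex _] Nx]|[/sliceP[ex _] nx]]; apply/sliceP; split => //;
     rewrite /B/= edge_of_pt /Defs.coord val_pt//; [left|right].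
have mB2 e : measurable (slice e setT `\` open_edge e : set R).
  apply: measurableD; [exact: measurable_sliceT|exact: measurable_open_edge].
have mB1 e : measurable (slice e setT `&` N e).
  by apply: measurableI; [exact: measurable_sliceT|case: (hN e)].
exists B; split.
- by move=> e; rewrite sB; exact: measurableU.
- rewrite /gmeasure/= esum1// => e _; rewrite sB.
  have [mN N0 _] := hN e.
  (* For a ray, [fine] of the length is 0 and the set shrinks to the only endpoint. *)
  have mE : measurable [set 0; fine (len G e)] by exact: measurableU.
  have mA : measurable (slice e setT `&` N e `|` slice e setT `\` open_edge e).
    exact: measurableU.
  have mNE : measurable (N e `|` [set 0; fine (len G e)]) by exact: measurableU.
  have E0 : lam [set 0; fine (len G e)] = 0%E.
    rewrite measureU0; [exact: lebesgue_measure_set1|exact: measurable_set1|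
      exact: measurable_set1|exact: lebesgue_measure_set1].
  have NE0 : lam (N e `|` [set 0; fine (len G e)]) = 0%E.
    by rewrite measureU0; [exact: N0|exact: mN|exact: mE|exact: E0].
  have sub : slice e setT `&` N e `|` slice e setT `\` open_edge e `<=`
      N e `|` [set 0; fine (len G e)].
    move=> x [[_ Nx]|[/sliceP[/andP[/= x0 xl] _] nx]]; [by left|right].
    case: (ltrgt0P x) => [xgt|xlt|->]; [right|by rewrite leNgt xlt in x0|by left].
    rewrite /=; move: xl; rewrite le_eqVlt => /predU1P[<-//|xl].
    by exfalso; apply: nx.
  have := @subset_measure0 _ _ _ lam _ _ mA mNE sub NE0.
  by [].
- move=> p /= nP; case: (pselect (open_edge (edge_of p) (Defs.coord p))) => h; [left|by right].
  have [_ _] := hN (edge_of p); apply; split => //.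
  by rewrite ptK.
Qed.

End GraphMeasure.

(** * Weak derivatives *)

Section WeakDerivativeLine.
Context {R : realType}.
Local Notation lam := (@lebesgue_measure R).
Implicit Types (f g h phi : R -> R) (O : set R).

Lemma eq_locally_integrable O f g : {in O, f =1 g} ->
  locally_integrable O f -> locally_integrable O g.
Proof.
move=> fg [mf oO fK]; split => //; first by move: mf; exact: eq_measurable_fun.
move=> K KO cK; have := fK K KO cK; congr (_ < _)%E.
by apply: eq_integral => x /set_mem Kx; rewrite fg// inE; exact: KO.
Qed.

Lemma locally_integrableZ O c f : locally_integrable O f ->
  locally_integrable O (fun x => c * f x).
Proof.
move=> [mf oO fK]; split => //.
  by apply: measurable_funM => //; exact: measurable_cst.
move=> K KO cK; have mK := compact_measurable cK.
have /integrableP[_] // : lam.-integrable K (EFin \o (fun x => c * f x)).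
apply: integrableZ_EFin => //; apply/integrableP; split; last exact: fK.
by apply/measurable_EFinP; exact: measurable_funS (open_measurable oO) KO mf.
Qed.

Lemma continuous_on_measurable O f : open O ->
  (forall x, O x -> {for x, continuous f}) -> measurable_fun O f.
Proof.
move=> oO cf; apply: open_continuous_measurable_fun => //.
by move=> x /set_mem; exact: cf.
Qed.

Lemma continuous_locally_integrable O f : open O ->
  (forall x, O x -> {for x, continuous f}) -> locally_integrable O f.
Proof.
move=> oO cf; split => //; first exact: continuous_on_measurable.
move=> K KO cK.
have /integrableP[_]// : lam.-integrable K (EFin \o f).
apply: continuous_compact_integrable => //.
by apply: continuous_in_subspaceT => x /set_mem Kx; exact/cf/KO.
Qed.

Lemma compact_support_bounded (K : set R) (psi : R -> R) : continuous psi -> compact K ->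
  (forall x, ~ K x -> psi x = 0) -> exists2 M, 0 <= M & forall x, `|psi x| <= M.
Proof.
move=> cpsi cK psi0.
have : compact (psi @` K).
  by apply: continuous_compact => //; exact: continuous_subspaceT.
move/compact_bounded => -[M [_ /(_ (`|M| + 1))]] H.
exists (`|M| + 1); first by rewrite addr_ge0.
move=> x; case: (pselect (K x)) => Kx; last by rewrite psi0// normr0 addr_ge0.
apply: H; last by exists x.
by rewrite (le_lt_trans (ler_norm _))// ltrDl.
Qed.

Lemma locally_integrable_mul O f (K : set R) (psi : R -> R) :
  locally_integrable O f -> continuous psi -> compact K -> K `<=` O ->
  (forall x, ~ K x -> psi x = 0) ->
  lam.-integrable O (EFin \o (fun x => f x * psi x)).
Proof.
move=> [mf oO fK] cpsi cK KO psi0.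
have mO : measurable O by exact: open_measurable.
have mK : measurable K by exact: compact_measurable.
have mpsi : measurable_fun setT psi by exact: continuous_measurable_fun.
have [M M0 psiM] := compact_support_bounded cpsi cK psi0.
apply: (@integrable_mkcond _ (measurableTypeR R) _ lam O _ mO).2.
have IK : lam.-integrable K (EFin \o (fun x => f x * psi x)).
  apply: (@le_integrable_EFin _ (measurableTypeR R) _ lam K _ (fun x => M * `|f x|)) => //.
  - by apply: measurable_funM; [exact: measurable_funS mf|exact: measurable_funTS].
  - by move=> x Kx; rewrite normrM mulrC ler_wpM2r.
  - apply: integrableZ_EFin => //; apply/integrableP; split.
      apply/measurable_EFinP; apply: measurableT_comp => //.
      exact: measurable_funS mf.
    by under eq_integral do rewrite /= normr_id; exact: fK.
have := (@integrable_mkcond _ (measurableTypeR R) _ lam K _ mK).1 IK.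
congr (lam.-integrable _ _); apply/funext => x; rewrite !patchE.
case: (boolP (x \in K)) => Kx; first by rewrite mem_set//; exact/KO/set_mem.
case: ifPn => // _; rewrite /= psi0 ?mulr0// => /mem_set; exact/negP.
Qed.

(** [K] is closed, so off [K] the function vanishes on a whole neighbourhood, and its derivative
    vanishes too. *)
Lemma C1_test_derive0 O phi : C1_test O phi -> exists K, [/\ compact K, K `<=` O,
  forall x, ~ K x -> phi x = 0 & forall x, ~ K x -> derive1 phi x = 0].
Proof.
move=> [dphi cphi [K [cK KO phiK]]]; exists K.
have phi0 x : ~ K x -> phi x = 0 by move=> nK; apply: contra_notP nK => /eqP; exact: phiK.
split => // x nKx.
have : \forall y \near x, ~ K y.
  have cl : closed K by apply: compact_closed => //; exact: Rhausdorff.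
  by apply: open_nbhs_nbhs; split => //; exact: closed_openC.
move=> nK; rewrite derive1E.
rewrite (@near_eq_derive _ _ _ phi (cst 0)); first by rewrite derive_cst.
by apply: filterS nK => y; exact: phi0.
Qed.

Definition weak_deriv1 O f g := locally_integrable O g /\
  forall phi, C1_test O phi ->
    \int[lam]_(x in O) (f x * derive1 phi x) = - \int[lam]_(x in O) (g x * phi x).

Lemma C1_test_integrable O f phi : locally_integrable O f -> C1_test O phi ->
  lam.-integrable O (EFin \o (fun x => f x * phi x)) /\
  lam.-integrable O (EFin \o (fun x => f x * derive1 phi x)).
Proof.
move=> lf tphi; have [dphi cphi _] := tphi.
have [K [cK KO phi0 dphi0]] := C1_test_derive0 tphi.
split; apply: locally_integrable_mul lf _ cK KO _ => //.
by move=> x; apply/differentiable_continuous/derivable1_diffP.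
Qed.

Lemma weak_deriv1_lin O c f g f' g' :
  locally_integrable O f -> locally_integrable O f' ->
  weak_deriv1 O f g -> weak_deriv1 O f' g' ->
  weak_deriv1 O (fun x => c * f x + f' x) (fun x => c * g x + g' x).
Proof.
move=> lf lf' [lg fg] [lg' fg']; split.
  by apply: locally_integrableD => //; exact: locally_integrableZ.
have mO : measurable O by apply: open_measurable; case: lf.
move=> phi tphi.
have [_ I1] := C1_test_integrable lf tphi.
have [_ I2] := C1_test_integrable lf' tphi.
have [I3 _] := C1_test_integrable lg tphi.
have [I4 _] := C1_test_integrable lg' tphi.
have E a b h1 h2 (k : R -> R) : lam.-integrable O (EFin \o (fun x => h1 x * k x)) ->
    lam.-integrable O (EFin \o (fun x => h2 x * k x)) ->
    \int[lam]_(x in O) ((a * h1 x + b * h2 x) * k x) =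
    a * \int[lam]_(x in O) (h1 x * k x) + b * \int[lam]_(x in O) (h2 x * k x).
  move=> H1 H2; rewrite -!RintegralZl// -RintegralD//.
  - by apply: eq_Rintegral => x _; rewrite mulrDl !mulrA.
  - exact: integrableZ_EFin.
  - exact: integrableZ_EFin.
transitivity (\int[lam]_(x in O) ((c * f x + 1 * f' x) * derive1 phi x)).
  by apply: eq_Rintegral => x _; rewrite mul1r.
rewrite E//; transitivity (- \int[lam]_(x in O) ((c * g x + 1 * g' x) * phi x)).
  by rewrite E// fg// fg'// !mul1r opprD mulrN.
by congr (- _); apply: eq_Rintegral => x _; rewrite mul1r.
Qed.

Lemma ae_zero_of_integrals (h : R -> R) a b : a < b ->
  lam.-integrable `[a, b]%classic (EFin \o h) ->
  (forall x, a < x <= b -> \int[lam]_(t in `[a, x]) h t = 0) ->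
  {ae lam, forall x, a < x < b -> h x = 0}.
Proof.
move=> ab ih h0; pose k := h \_ `[a, b].
have ik : lam.-integrable setT (EFin \o k).
  rewrite /k -restrict_EFin.
  exact: (@integrable_mkcond _ (measurableTypeR R) _ lam _ _ (measurable_itv _)).1 ih.
have lk : locally_integrable setT k.
  by apply: open_integrable_locally => //; exact: openT.
have := @FTC1 R k (BLeft a) _ lk.
move=> /(_ (fun y => integrableS measurableT _ _ ik)) => H.
have {}H := H (fun y => measurable_itv _) (fun y => @subsetT _ _).
apply: (@filterS _ _ (ae_filter_ringOfSetsType lam) _ _ _ H) => x {}H /andP[ax xb].
have [dF F'] := H ax.
have <- : k x = h x by rewrite /k patchE mem_set//= in_itv/= !ltW.
rewrite -F' derive1E (@near_eq_derive _ _ _ _ (cst 0)) ?derive_cst//.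
have : \forall y \near x, y \in `]a, b[ by apply: near_in_itvoo; rewrite in_itv/= ax.
apply: filterS => y; rewrite in_itv/= => /andP[ay yb].
rewrite -(h0 y) ?ay ?ltW//; apply: eq_Rintegral => t.
rewrite inE/= in_itv/= => /andP[a_t ty].
by rewrite /k patchE mem_set//= in_itv/= a_t (le_trans ty)// ltW.
Qed.

Lemma weak_deriv1_FTC O f g x y : (forall x, O x -> {for x, continuous f}) ->
  weak_deriv1 O f g -> x < y -> `[x, y] `<=` O ->
  \int[lam]_(t in `[x, y]) g t = f y - f x.
Proof. by move=> cf [lg fg]; exact: weak_FTC. Qed.

Lemma segment_integrable O g x y : locally_integrable O g -> `[x, y] `<=` O ->
  lam.-integrable `[x, y]%classic (EFin \o g).
Proof.
move=> [mg oO ig] xyO; apply/integrableP; split.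
  by apply/measurable_EFinP; exact: measurable_funS (open_measurable oO) xyO mg.
by apply: ig => //; exact: segment_compact.
Qed.

(** By [weak_deriv1_FTC] both candidates have the same integral over every segment in [O], hence
    agree almost everywhere on it; countably many segments with rational ends exhaust [O]. *)
Lemma weak_deriv1_unique O f g g' : (forall x, O x -> {for x, continuous f}) ->
  weak_deriv1 O f g -> weak_deriv1 O f g' ->
  lam.-negligible [set x | O x /\ g x <> g' x].
Proof.
move=> cf wg wg'; have oO : open O by case: wg => -[].
have H (pq : rat * rat) : lam.-negligible
    [set x | [/\ `[ratr pq.1, ratr pq.2]%classic `<=` O,
      ratr pq.1 < x < ratr pq.2 & g x <> g' x]].
  set a := ratr pq.1; set b := ratr pq.2.
  case: (pselect (`[a, b]%classic `<=` O /\ a < b)) => [[abO ab]|nab]; last first.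
    apply: (negligibleS _ (negligible_set0 _)) => x [abO /andP[ax xb] _].
    by apply: nab; split => //; exact: lt_trans xb.
  have ig := segment_integrable wg.1 abO.
  have ig' := segment_integrable wg'.1 abO.
  have := @ae_zero_of_integrals (fun x => g x - g' x) a b ab.
  case.
  - rewrite (_ : _ \o _ = EFin \o (fun x => g x + -1 * g' x)).
      by apply: integrableD_EFin => //; exact: integrableZ_EFin.
    by apply/funext => x /=; rewrite mulN1r.
  - move=> x /andP[ax xb].
    have sub : `[a, x] `<=` `[a, b] by exact: subset_itvl.
    have axO : `[a, x] `<=` O by exact: subset_trans abO.
    rewrite RintegralB//; first by rewrite !(weak_deriv1_FTC cf _ ax axO) ?subrr.
    + exact: segment_integrable wg.1 axO.
    + exact: segment_integrable wg'.1 axO.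
  - move=> N [mN N0 sub]; exists N; split => // x [_ xab gg']; apply: sub => /= /(_ xab).
    by move/eqP; rewrite subr_eq0 => /eqP.
pose F n := if unpickle n is Some pq then [set x | [/\ `[ratr pq.1, ratr pq.2]%classic `<=` O,
      ratr pq.1 < x < ratr pq.2 & g x <> g' x]] else set0.
apply: (@negligibleS _ (measurableTypeR R) _ lam (\bigcup_n F n)); last first.
  apply: negligible_bigcup => n; rewrite /F; case: unpickle => [pq|]; first exact: H.
  exact: negligible_set0.
move=> x [Ox gx].
have /nbhs_ballP[d /= d0 dO] : nbhs x O by exact: open_nbhs_nbhs.
have /rat_in_itvoo[p] : x - d < x by rewrite ltrBlDr ltrDl.
rewrite in_itv/= => /andP[dp px].
have /rat_in_itvoo[q] : x < x + d by rewrite ltrDl.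
rewrite in_itv/= => /andP[xq qd].
have [k kpq] : exists k, unpickle k = Some (p, q) by exists (pickle (p, q)); exact: pickleK.
exists k => //; rewrite /F kpq; split => //=; last by rewrite px.
move=> y; rewrite /= in_itv/= => /andP[py yq]; apply: dO.
by rewrite /ball/= ltr_norml; apply/andP; split; lra.
Qed.

End WeakDerivativeLine.

Section AeIntegral.
Context d (T : measurableType d) (R : realType).
Variable mu : {measure set T -> \bar R}.

Lemma ae_eq_Rintegral (f g : T -> R) : measurable_fun setT f -> measurable_fun setT g ->
  {ae mu, forall x, f x = g x} -> \int[mu]_x f x = \int[mu]_x g x.
Proof.
move=> mf mg fg; congr fine; apply: ae_eq_integral => //; try exact/measurable_EFinP.
by apply: filterS fg => x -> _.
Qed.

End AeIntegral.

(** * The space L^2 of the graph as a real inner product space *)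

Section FunctionSpaces.
Context {R : realType} {G : metricGraph R}.
Local Notation lam := (@lebesgue_measure R).
Local Notation mu := (gmeasure G).
Local Notation X := (gpoint G -> Rcomplex R).
Local Notation Re := complex.Re.
Local Notation Im := complex.Im.
Implicit Types (u v w g : X) (e : edge G) (x y : R) (p : gpoint G).

(** Functions take values in [Rcomplex R], the complex numbers as a real vector space, so that the
    lemmas on real forms apply; [Lp2P] identifies [sq] with [Lp 2%:E]. *)
Definition sq u : Prop := sqint mu (fun p => Re (u p)) /\
  sqint mu (fun p => Im (u p)).

(* The real part of [inner u v].  Working over the reals loses nothing, since
   the imaginary part is recovered by replacing [v] with [- i v]. *)
Definition ip u v : R := \int[mu]_p (Re (u p) * Re (v p) + Im (u p) * Im (v p)).

Lemma Re_scale (c : R) (z w : R[i]) : Re (c *: (z : Rcomplex R) + w : Rcomplex R) = c * Re z + Re w.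
Proof. by move: z w => [a b] [a' b']. Qed.

Lemma Im_scale (c : R) (z w : R[i]) : Im (c *: (z : Rcomplex R) + w : Rcomplex R) = c * Im z + Im w.
Proof. by move: z w => [a b] [a' b']. Qed.

Lemma Re_lin (c z w : R[i]) : Re (c * z + w) = Re c * Re z + (- Im c * Im z + Re w).
Proof. by case: c z w => ? ? [? ?] [? ?] /=; ring. Qed.

Lemma Im_lin (c z w : R[i]) : Im (c * z + w) = Re c * Im z + (Im c * Re z + Im w).
Proof. by case: c z w => ? ? [? ?] [? ?] /=; ring. Qed.

Lemma sq_subspace : lin_subspace sq.
Proof.
split; first exact: (conj (sqint_cst0 mu) (sqint_cst0 mu)).
move=> c u v [ru iu] [rv iv]; split.
  by under eq_fun do rewrite Re_scale; exact: sqint_lin.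
by under eq_fun do rewrite Im_scale; exact: sqint_lin.
Qed.

Lemma sqM (c : R[i]) u v : sq u -> sq v -> sq (fun p => c * u p + v p : R[i]).
Proof.
move=> [ru iu] [rv iv]; split.
  under eq_fun do rewrite Re_lin; apply: sqint_lin => //; exact: sqint_lin.
by under eq_fun do rewrite Im_lin; apply: sqint_lin => //; exact: sqint_lin.
Qed.

Lemma ip_integrable u v : sq u -> sq v -> mu.-integrable setT
  (EFin \o (fun p => Re (u p) * Re (v p) + Im (u p) * Im (v p))).
Proof.
by move=> [ru iu] [rv iv]; apply: integrableD_EFin => //; exact: sqint_mul.
Qed.

Lemma ip_form : sym_form sq ip.
Proof.
split=> [u v su sv|c u v w su sv sw].
  by apply: eq_Rintegral => p _; ring.
rewrite /ip -RintegralZl//; last exact: ip_integrable.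
rewrite -RintegralD//; last 2 first.
- by apply: integrableZ_EFin => //; exact: ip_integrable.
- exact: ip_integrable.
by apply: eq_Rintegral => p _; rewrite Re_scale Im_scale; ring.
Qed.

Lemma ip_ge0 u : 0 <= ip u u.
Proof. by apply: Rintegral_ge0 => p _; rewrite -!expr2 addr_ge0 ?sqr_ge0. Qed.

Lemma ip_normc u : ip u u = \int[mu]_p (normc (u p) ^+ 2).
Proof. by apply: eq_Rintegral => p _; rewrite normcE2 !expr2. Qed.

Lemma sq_normc_integrable u : sq u ->
  mu.-integrable setT (EFin \o (fun p => normc (u p) ^+ 2)).
Proof.
move=> su; have := ip_integrable su su; congr (mu.-integrable _ _).
by apply/funext => p /=; rewrite normcE2 !expr2.
Qed.

Lemma ip_EFin u : sq u -> (ip u u)%:E = (\int[mu]_p (normc (u p) ^+ 2)%:E)%E.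
Proof.
move=> su; rewrite ip_normc /Rintegral fineK//.
exact/integrable_fin_num/sq_normc_integrable.
Qed.

Lemma norm_Lp2E u : norm_Lp 2%:E u = sqrte (\int[mu]_p (normc (u p) ^+ 2)%:E)%E.
Proof.
rewrite /norm_Lp unlock /= -poweR12_sqrt.
  congr (_ `^ _)%E; apply: eq_integral => p _.
  by rewrite (ger0_norm (normc_ge0 _)) powR_mulrn// normc_ge0.
by apply: integral_ge0 => p _; rewrite lee_fin sqr_ge0.
Qed.

Lemma norm_Lp2_sq u : sq u -> norm_Lp 2%:E u = (Num.sqrt (ip u u))%:E.
Proof. by move=> su; rewrite norm_Lp2E -ip_EFin. Qed.

Lemma Lp2P u : Lp 2%:E u <-> sq u.
Proof.
split=> [[mr mi]|su]; last first.
  by split; [case: su => -[]|case: su => _ []|rewrite (norm_Lp2_sq su) ltry].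
rewrite norm_Lp2E => fin.
have {}fin : (\int[mu]_p (normc (u p) ^+ 2)%:E < +oo)%E.
  by move: fin; case: (\int[mu]_p _)%E => [r||] //= _; rewrite ?ltry ?ltNyr.
have H (f : gpoint G -> R) : measurable_fun setT f -> (forall p, `|f p| <= normc (u p)) -> sqint mu f.
  move=> mf fu; split => //; apply/integrableP; split.
    exact/measurable_EFinP/measurable_funX.
  apply: le_lt_trans fin; apply: ge0_le_integral => //.
  - by do 2 apply: measurableT_comp => //; exact: measurable_funX.
  - apply/measurable_EFinP; under eq_fun do rewrite normcE2.
    by apply: measurable_funD; exact: measurable_funX.
  - move=> p _; rewrite /= lee_fin normrX lerXn2r ?nnegrE ?normc_ge0//.
by split; apply: H => // p; [exact: Re_le_normc|exact: Im_le_normc].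
Qed.

(** Meant for derivatives: [wderiv] is linear only almost everywhere, and this turns such identities
    into identities of forms. *)
Lemma sq_ae_ip u u' v v' : sq u -> sq u' -> sq v -> sq v' ->
  {ae mu, forall p, u p = u' p} -> {ae mu, forall p, v p = v' p} ->
  ip u v = ip u' v'.
Proof.
move=> su su' sv sv' uu' vv'.
have H w w' : sq w -> sq w' -> measurable_fun setT (fun p =>
    Re (w p) * Re (w' p) + Im (w p) * Im (w' p)).
  by move=> [[? _] [? _]] [[? _] [? _]]; apply: measurable_funD; apply: measurable_funM.
apply: ae_eq_Rintegral; [exact: H|exact: H|].
by apply: filterS2 uu' vv' => p -> ->.
Qed.

End FunctionSpaces.

(** * Weak derivatives and H1 on the graph *)

Section Sobolev.
Context {R : realType} {G : metricGraph R}.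
Local Notation lam := (@lebesgue_measure R).
Local Notation mu := (gmeasure G).
Local Notation X := (gpoint G -> Rcomplex R).
Local Notation Re := complex.Re.
Local Notation Im := complex.Im.
Implicit Types (u v w g : gpoint G -> R[i]) (e : edge G) (x y : R) (p : gpoint G).

Lemma Re_mulr (z : R[i]) (r : R) : Re (z * (r%:C)%C) = Re z * r.
Proof. by case: z => a b /=; rewrite mulr0 subr0. Qed.

Lemma Im_mulr (z : R[i]) (r : R) : Im (z * (r%:C)%C) = Im z * r.
Proof. by case: z => a b /=; rewrite mulr0 add0r. Qed.

(** Test functions are real, so the complex identity splits into its components. *)
Lemma weak_derivativeP u g : weak_derivative u g <-> forall e,
  weak_deriv1 (open_edge e) (fun x => Re (u (pt e x))) (fun x => Re (g (pt e x))) /\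
  weak_deriv1 (open_edge e) (fun x => Im (u (pt e x))) (fun x => Im (g (pt e x))).
Proof.
have rE (h : gpoint G -> R[i]) e : {in open_edge e, forall x, restr h e x = h (pt e x)}.
  by move=> x /set_mem ex; rewrite restrE//; exact: open_edge_on.
have CE e (phi : R -> R) : Cint lam (open_edge e) (fun x => restr u e x * (derive1 phi x)%:C%C) =
    ((\int[lam]_(x in open_edge e) (Re (u (pt e x)) * derive1 phi x))
    +i* (\int[lam]_(x in open_edge e) (Im (u (pt e x)) * derive1 phi x)))%C.
  by congr (_ +i* _)%C; apply: eq_Rintegral => x ex; rewrite rE// (Re_mulr, Im_mulr).
have CE' e (phi : R -> R) : Cint lam (open_edge e) (fun x => restr g e x * (phi x)%:C%C) =
    ((\int[lam]_(x in open_edge e) (Re (g (pt e x)) * phi x))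
    +i* (\int[lam]_(x in open_edge e) (Im (g (pt e x)) * phi x)))%C.
  by congr (_ +i* _)%C; apply: eq_Rintegral => x ex; rewrite rE// (Re_mulr, Im_mulr).
split=> H e.
  have [lr li wd] := H e.
  split; split.
  - by apply: eq_locally_integrable lr => x ex; rewrite /= rE.
  - by move=> phi /wd; rewrite CE CE' => -[].
  - by apply: eq_locally_integrable li => x ex; rewrite /= rE.
  - by move=> phi /wd; rewrite CE CE' => -[].
have [[lr wr] [li wi]] := H e; split.
- by apply: eq_locally_integrable lr => x ex; rewrite /= rE.
- by apply: eq_locally_integrable li => x ex; rewrite /= rE.
- by move=> phi tphi; rewrite CE CE' wr// wi.
Qed.

Lemma measurable_graph (f : gpoint G -> R) :
  (forall e, measurable_fun (open_edge e) (fun x => f (pt e x))) ->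
  measurable_fun setT f.
Proof.
move=> mf _ B mB; rewrite setTI.
suff : gmeasurable (f @^-1` B) by [].
move=> e.
have -> : slice e (f @^-1` B) =
    (open_edge e `&` (fun x => f (pt e x)) @^-1` B) `|`
    ([set 0; fine (len G e)] `&` slice e (f @^-1` B)).
  apply/seteqP; split => x.
    move=> h; have /sliceP[ex Bx] := h.
    case: (pselect (open_edge e x)) => oe; [by left|right; split => //].
    move: ex => /andP[/= x0 xl].
    case: (ltrgt0P x) => [xgt|xlt|->]; [right|by rewrite leNgt xlt in x0|by left].
    rewrite /=; move: xl; rewrite le_eqVlt => /predU1P[<-//|xl].
    by exfalso; apply: oe.
  move=> [[oe Bx]|[]//]; apply/sliceP; split => //; exact: open_edge_on.
apply: measurableU.
  by apply: (mf e) => //; exact: measurable_open_edge.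
apply: (@countable_measurable _ (measurableTypeR R)); first by move=> x; exact: measurable_set1.
apply: finite_set_countable; apply: (@sub_finite_set _ _ [set 0; fine (len G e)]).
  exact: subIsetl.
by rewrite finite_setU; split; exact: finite_set1.
Qed.

Lemma continuous_comp_pt u e x : continuous (u : gpoint G -> R[i]^o) -> open_edge e x ->
  {for x, continuous (fun y => Re (u (pt e y)))}.
Proof. by move=> cu ex; have [] := continuous_Re_pt cu ex. Qed.

Lemma continuous_comp_pt_Im u e x : continuous (u : gpoint G -> R[i]^o) -> open_edge e x ->
  {for x, continuous (fun y => Im (u (pt e y)))}.
Proof. by move=> cu ex; have [] := continuous_Re_pt cu ex. Qed.

Lemma weak_derivative_unique u g g' : continuous (u : gpoint G -> R[i]^o) ->
  weak_derivative u g -> weak_derivative u g' -> {ae mu, forall p, g p = g' p}.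
Proof.
move=> cu /weak_derivativeP wg /weak_derivativeP wg'; apply: ae_graph => e.
have [wr wi] := wg e; have [wr' wi'] := wg' e.
have nr := weak_deriv1_unique (fun x ex => continuous_comp_pt cu ex) wr wr'.
have ni := weak_deriv1_unique (fun x ex => continuous_comp_pt_Im cu ex) wi wi'.
apply: negligibleS (negligibleU nr ni) => x [ex gx].
case: (pselect (Re (g (pt e x)) = Re (g' (pt e x)))) => h; [right|by left].
split => // h'; apply: gx; move: h h'.
by case: (g _) (g' _) => [a b] [a' b'] /= -> ->.
Qed.

Lemma weak_derivative_measurable u g : weak_derivative u g ->
  measurable_fun setT (fun p => Re (g p)) /\ measurable_fun setT (fun p => Im (g p)).
Proof.
by move=> /weak_derivativeP wg; split; apply: measurable_graph => e;
  have [[[? _ _] _] [[? _ _] _]] := wg e.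
Qed.

Lemma weak_derivative_lin (c : R[i]) u v g h :
  continuous (u : gpoint G -> R[i]^o) -> continuous (v : gpoint G -> R[i]^o) ->
  weak_derivative u g -> weak_derivative v h ->
  weak_derivative (fun p => c * u p + v p) (fun p => c * g p + h p).
Proof.
move=> cu cv /weak_derivativeP wg /weak_derivativeP wh; apply/weak_derivativeP => e.
have [gr gi] := wg e; have [hr hi] := wh e.
have oe : open (open_edge e) by exact: open_edge_open.
have lr w : continuous (w : gpoint G -> R[i]^o) ->
    locally_integrable (open_edge e) (fun x => Re (w (pt e x))).
  move=> cw; apply: continuous_locally_integrable => //.
  by move=> x; exact: continuous_comp_pt.
have li w : continuous (w : gpoint G -> R[i]^o) ->
    locally_integrable (open_edge e) (fun x => Im (w (pt e x))).
  move=> cw; apply: continuous_locally_integrable => //.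
  by move=> x; exact: continuous_comp_pt_Im.
have lin1 (a : R) (f f' : R -> R) : locally_integrable (open_edge e) f ->
    locally_integrable (open_edge e) f' ->
    locally_integrable (open_edge e) (fun x => a * f x + f' x).
  by move=> lf lf'; apply: locally_integrableD => //; exact: locally_integrableZ.
split.
  under eq_fun do rewrite Re_lin; under [X in weak_deriv1 _ _ X]eq_fun do rewrite Re_lin.
  apply: weak_deriv1_lin; [exact: lr|by apply: lin1; [exact: li|exact: lr]|exact: gr|].
  by apply: weak_deriv1_lin; [exact: li|exact: lr|exact: gi|exact: hr].
under eq_fun do rewrite Im_lin; under [X in weak_deriv1 _ _ X]eq_fun do rewrite Im_lin.
apply: weak_deriv1_lin; [exact: li|by apply: lin1; [exact: lr|exact: li]|exact: gi|].
by apply: weak_deriv1_lin; [exact: lr|exact: li|exact: gr|exact: hi].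
Qed.

(** [wderiv u] is picked by choice among all weak derivatives and need not be the square-integrable
    one from the definition; almost everywhere uniqueness makes it square integrable as well. *)
Lemma H1E u : H1 u <-> [/\ continuous (u : gpoint G -> R[i]^o), sq u,
  weak_derivative u (wderiv u) & sq (wderiv u)].
Proof.
split=> [[cu lu [g wg lg]]|[cu su wu swu]]; last first.
  by split; [|exact/Lp2P|exists (wderiv u) => //; exact/Lp2P].
have wd : weak_derivative u (wderiv u) by apply: (@xgetPex _ (cst 0)); exists g.
split => //; first exact/Lp2P.
have [[mr ir] [mi ii]] : sq g by exact/Lp2P.
have [mr' mi'] := weak_derivative_measurable wd.
have ae := weak_derivative_unique cu wd wg.
have H (f f' : gpoint G -> R) : measurable_fun setT f' -> sqint mu f ->
    {ae mu, forall p, f' p = f p} -> sqint mu f'.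
  move=> mf' [mf iff] ff'; split => //.
  have mf2 : measurable_fun setT (EFin \o (fun p => f' p ^+ 2)).
    exact/measurable_EFinP/measurable_funX.
  have mf2' : measurable_fun setT (EFin \o (fun p => f p ^+ 2)).
    exact/measurable_EFinP/measurable_funX.
  have /integrableP[_ fin] := iff; apply/integrableP; split => //.
  apply: le_lt_trans fin; rewrite le_eqVlt; apply/orP; left; apply/eqP.
  apply: ae_eq_integral => //; [exact: measurableT_comp|exact: measurableT_comp|].
  by apply: filterS ff' => p h _ /=; rewrite h.
split; [apply: (H (fun p => Re (g p))) => //|apply: (H (fun p => Im (g p))) => //].
  by apply: filterS ae => p ->.
by apply: filterS ae => p ->.
Qed.

Lemma gcontinuous_lin (c : R[i]) u v : continuous (u : gpoint G -> R[i]^o) ->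
  continuous (v : gpoint G -> R[i]^o) ->
  continuous ((fun p => c * u p + v p) : gpoint G -> R[i]^o).
Proof.
move=> /gcontinuousP cu /gcontinuousP cv; apply/gcontinuousP => p eps eps0.
have c0 : 0 < normc c + 1 by rewrite ltr_wpDl ?normc_ge0.
have := cu p (eps / 2 / (normc c + 1)); rewrite !divr_gt0// => /(_ isT) hu.
have := cv p (eps / 2); rewrite divr_gt0// => /(_ isT) hv.
apply: (@filterS2 _ _ (nbhs_filter p) _ _ _ _ hu hv) => p' up vp.
have -> : c * u p + v p - (c * u p' + v p') = c * (u p - u p') + (v p - v p') by ring.
rewrite (le_lt_trans (le_normcD _ _))// [ltRHS]splitr ler_ltD// Normc.normcM.
rewrite (@le_trans _ _ ((normc c + 1) * normc (u p - u p')))//.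
  by rewrite ler_wpM2r ?normc_ge0// lerDl.
by rewrite mulrC -ler_pdivlMr// ltW.
Qed.

Lemma H1_lin (c : R[i]) u v : H1 u -> H1 v ->
  H1 (fun p => c * u p + v p) /\
  {ae mu, forall p, wderiv (fun p => c * u p + v p) p = c * wderiv u p + wderiv v p}.
Proof.
move=> /H1E[cu su wu swu] /H1E[cv sv wv swv].
have cw : continuous ((fun p => c * u p + v p) : gpoint G -> R[i]^o).
  exact: gcontinuous_lin.
have ww := @weak_derivative_lin c _ _ _ _ cu cv wu wv.
have hw : H1 (fun p => c * u p + v p).
  split => //; first by apply/Lp2P; exact: sqM.
  by exists (fun p => c * wderiv u p + wderiv v p) => //; apply/Lp2P; exact: sqM.
split => //.
have /H1E[_ _ wd _] := hw.
exact: weak_derivative_unique wd ww.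
Qed.

End Sobolev.

(** * Sup bound on H1 *)

Section Clipping.
Context {R : realType}.
Local Notation lam := (@lebesgue_measure R).
Implicit Types (f d : R -> R) (x y c : R).

Lemma lebesgue_integrableS (A B : set R) (f : R -> R) : measurable A -> measurable B ->
  B `<=` A -> lam.-integrable A (EFin \o f) -> lam.-integrable B (EFin \o f).
Proof. by move=> mA mB; exact: (@integrableS _ (measurableTypeR R) _ lam _ _ _ mA mB). Qed.

(** The points of the segment with [f <= c] form a compact set, which has a last element. *)
Lemma last_below f x y c : x <= y ->
  (forall z, x <= z <= y -> {for z, continuous f}) -> f x <= c ->
  exists t, [/\ x <= t <= y, f t <= c & forall s, t < s <= y -> c < f s].
Proof.
move=> xy cf fx; pose A := `[x, y]%classic `&` [set z | f z <= c].
have cA : compact A.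
  apply: (subclosed_compact _ (@segment_compact _ x y)) => [z clz|z []//].
  have xyz : `[x, y]%classic z.
    have : closure `[x, y]%classic z by apply: closureS clz => ? [].
    have /closure_id <- // : closed `[x, y]%classic by exact: itv_closed.
  split => //=; rewrite leNgt; apply/negP => cfz.
  have : \forall w \near z, c < f w.
    have xyz' : x <= z <= y by move: xyz; rewrite /= in_itv.
    by have /cvgr_gt := cf z xyz'; apply.
  move=> /clz[w [[_ /= fw] cfw]]; by move: cfw; rewrite ltNge fw.
have A0 : A !=set0 by exists x; split => //=; rewrite in_itv/= lexx.
have cid : {within A, continuous (id : R -> R)} by apply: continuous_subspaceT => ?; exact: cvg_id.
have [t /set_mem[txy ft] tmax] := compact_EVT_max A0 cA cid.
exists t; split; [by move: txy; rewrite /= in_itv|exact: ft|].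
move=> s /andP[ts sy]; rewrite ltNge; apply/negP => fs.
have : s \in A.
  rewrite inE; split => //=; rewrite in_itv/= sy andbT.
  by move: txy; rewrite /= in_itv/= => /andP[xt _]; rewrite (le_trans xt)// ltW.
by move/tmax; rewrite leNgt ts.
Qed.

Lemma first_below f x y c : x <= y ->
  (forall z, x <= z <= y -> {for z, continuous f}) -> f y <= c ->
  exists t, [/\ x <= t <= y, f t <= c & forall s, x <= s < t -> c < f s].
Proof.
move=> xy cf fy.
have [||t [/andP[xt ty] ft H]] := @last_below (fun z => f (x + y - z)) x y c xy.
- move=> z /andP[xz zy]; apply: (@continuous_comp _ _ _ (fun z => x + y - z) f).
    by apply: cvgB; [exact: cvg_cst|exact: cvg_id].
  by apply: cf; apply/andP; lra.
- by rewrite addrAC subrr add0r.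
exists (x + y - t); split => //; first by apply/andP; lra.
move=> s /andP[xs st]; have := H (x + y - s).
by rewrite subKr; apply; apply/andP; lra.
Qed.

(** [Num.max f c] moves only while [f] exceeds [c]. After the last point with [f <= c], or from [x]
    on if there is none, a rise takes place inside the superlevel set; for a fall, the first such
    point plays this part. *)
Lemma clip_osc f d c x y : x < y ->
  (forall z, x <= z <= y -> {for z, continuous f}) ->
  lam.-integrable `[x, y]%classic (EFin \o d) -> (forall z, 0 <= d z) ->
  (forall s t, x <= s -> s < t -> t <= y -> `|f t - f s| <= \int[lam]_(z in `[s, t]) d z) ->
  measurable [set z | c < f z] ->
  `|Num.max (f y) c - Num.max (f x) c| <=
  \int[lam]_(z in `[x, y]) (d z * \1_[set z | c < f z] z).
Proof.
move=> xy cf id d0 fd mS; set I := \int[lam]_(z in _) _.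
have iS : lam.-integrable `[x, y]%classic
    (EFin \o (fun z => d z * \1_[set z | c < f z] z)).
  apply: (@le_integrable_EFin _ (measurableTypeR R) _ lam _ _ d) => //.
    apply: measurable_funM; first by case/integrableP : id => /measurable_EFinP.
    exact: measurable_indic.
  move=> z _; rewrite normrM (ger0_norm (d0 z)) ler_piMr//.
  by rewrite indicE; case: (_ \in _); rewrite ?normr1 ?normr0.
have sub (A : set R) : measurable A -> A `<=` `[x, y] -> (forall z, A z -> c < f z) ->
    \int[lam]_(z in A) d z <= I.
  move=> mA Axy fA.
  have -> : \int[lam]_(z in A) d z = \int[lam]_(z in A) (d z * \1_[set z | c < f z] z).
    by apply: eq_Rintegral => z /set_mem Az; rewrite indicE mem_set ?mulr1//; exact: fA.
  rewrite /I /Rintegral; apply: fine_le.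
  - by apply: integrable_fin_num => //; exact: integrableS iS.
  - exact: integrable_fin_num.
  - apply: ge0_subset_integral => //; first by case/integrableP : iS.
    by move=> z _; rewrite lee_fin mulr_ge0.
have I0 : 0 <= I by apply: Rintegral_ge0 => z _; rewrite mulr_ge0.
have up : Num.max (f y) c - Num.max (f x) c <= I.
  have [fyc|cfy] := leP (f y) c.
    by rewrite (le_trans _ I0)// subr_le0 le_max lexx orbT.
  suff [t [ty tI]] : exists t, f t <= Num.max (f x) c /\ f y - f t <= I.
    by rewrite (le_trans _ tI)// lerD2l lerN2.
  case: (pselect (exists2 z, x <= z <= y & f z <= c)) => [[z /andP[xz zy] fz]|nz].
    have [|t [/andP[zt ty] ft H]] := last_below zy _ fz.
      by move=> w /andP[zw wy]; apply: cf; rewrite (le_trans xz).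
    exists t; split; first by rewrite (le_trans ft)// le_max lexx orbT.
    have ty' : t < y by rewrite lt_neqAle ty andbT; apply: contraTneq cfy => <-; rewrite -leNgt.
    have xt := le_trans xz zt.
    apply: (le_trans (ler_norm _)); apply: (le_trans (fd _ _ xt ty' (lexx _))).
    have subty : `]t, y] `<=` `[x, y].
      by move=> w; rewrite /= !in_itv/= => /andP[tw ->]; rewrite (le_trans xt)// ltW.
    rewrite -Rintegral_itv_obnd_cbnd; last exact: (lebesgue_integrableS _ _ subty id).
    by apply: sub => // w; rewrite /= in_itv/=; exact: H.
  exists x; split; first by rewrite le_max lexx.
  apply: (le_trans (ler_norm _)); apply: (le_trans (fd _ _ (lexx _) xy (lexx _))).
  apply: sub => // w; rewrite /= in_itv/= => xwy; rewrite ltNge; apply/negP => fw.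
  by apply: nz; exists w.
have down : Num.max (f x) c - Num.max (f y) c <= I.
  have [fxc|cfx] := leP (f x) c.
    by rewrite (le_trans _ I0)// subr_le0 le_max lexx orbT.
  suff [t [ty tI]] : exists t, f t <= Num.max (f y) c /\ f x - f t <= I.
    by rewrite (le_trans _ tI)// lerD2l lerN2.
  case: (pselect (exists2 z, x <= z <= y & f z <= c)) => [[z /andP[xz zy] fz]|nz].
    have [|t [/andP[xt tz] ft H]] := first_below xz _ fz.
      by move=> w /andP[xw wz]; apply: cf; rewrite xw (le_trans wz).
    exists t; split; first by rewrite (le_trans ft)// le_max lexx orbT.
    have xt' : x < t by rewrite lt_neqAle xt andbT; apply: contraTneq cfx => ->; rewrite -leNgt.
    have ty := le_trans tz zy.
    apply: (le_trans (ler_norm _)); rewrite distrC; apply: (le_trans (fd _ _ (lexx _) xt' ty)).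
    have subxt : `[x, t[ `<=` `[x, y].
      by move=> w; rewrite /= !in_itv/= => /andP[-> wt]; rewrite (le_trans _ ty)// ltW.
    rewrite -Rintegral_itv_bndo_bndc; last exact: (lebesgue_integrableS _ _ subxt id).
    by apply: sub => // w; rewrite /= in_itv/=; exact: H.
  exists y; split; first by rewrite le_max lexx.
  apply: (le_trans (ler_norm _)); rewrite distrC; apply: (le_trans (fd _ _ (lexx _) xy (lexx _))).
  apply: sub => // w; rewrite /= in_itv/= => xwy; rewrite ltNge; apply/negP => fw.
  by apply: nz; exists w.
by rewrite ler_norml up andbT lerNl opprB.
Qed.

End Clipping.

Section SupBound.
Context {R : realType} {G : metricGraph R}.
Local Notation lam := (@lebesgue_measure R).
Local Notation mu := (gmeasure G).
Local Notation Re := complex.Re.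
Local Notation Im := complex.Im.
Implicit Types (u v w g : gpoint G -> R[i]) (e : edge G) (x y : R) (p : gpoint G).

(** A bound for the modulus of u' that fits the use of the fundamental theorem on each component. *)
Definition dens u p : R := `|Re (wderiv u p)| + `|Im (wderiv u p)|.

Lemma dens_ge0 u p : 0 <= dens u p.
Proof. by rewrite addr_ge0. Qed.

Lemma sqint_norm (f : gpoint G -> R) : sqint mu f -> sqint mu (fun p => `|f p|).
Proof.
move=> [mf if2]; split; first exact: measurableT_comp.
by under eq_fun do rewrite real_normK ?num_real//.
Qed.

Lemma dens_sqint u : H1 u -> sqint mu (dens u) /\
  \int[mu]_p (dens u p ^+ 2) <= 2 * ip (wderiv u) (wderiv u).
Proof.
move=> /H1E[_ _ _ swu]; have [sr si] := swu.
have sd : sqint mu (dens u).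
  rewrite /dens; under eq_fun do rewrite -[X in X + _]mul1r.
  by apply: sqint_lin; exact: sqint_norm.
split => //; rewrite -RintegralZl//; last exact: ip_integrable.
apply: le_Rintegral => //; first by case: sd.
  by apply: integrableZ_EFin => //; exact: ip_integrable.
move=> p _; rewrite /dens -!expr2 -[in leRHS]real_normK ?num_real//.
rewrite -[X in _ <= _ * (_ + X)]real_normK ?num_real//.
by have := sqr_ge0 (`|Re (wderiv u p)| - `|Im (wderiv u p)|); nra.
Qed.

Lemma dens_segment_integrable u e x y : H1 u -> open_edge e x -> open_edge e y ->
  lam.-integrable `[x, y]%classic (EFin \o (fun z => dens u (pt e z))).
Proof.
move=> /H1E[_ _ /weak_derivativeP wd _] ex ey.
have xy := open_edge_itv ex ey; have [[lr _] [li _]] := wd e.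
have ir := segment_integrable lr xy; have ii := segment_integrable li xy.
by apply: integrableD_EFin => //; [exact: integrable_norm ir|exact: integrable_norm ii].
Qed.

Lemma H1_osc u e x y : H1 u -> open_edge e x -> open_edge e y -> x < y ->
  normc (u (pt e y) - u (pt e x)) <= \int[lam]_(z in `[x, y]) dens u (pt e z).
Proof.
move=> hu ex ey xy; have /H1E[cu _ /weak_derivativeP wd _] := hu.
have xyO := open_edge_itv ex ey; have [wr wi] := wd e.
have ir := segment_integrable wr.1 xyO; have ii := segment_integrable wi.1 xyO.
apply: (le_trans (normc_le_ReIm _)); rewrite !raddfB.
have fr := weak_deriv1_FTC (fun x ex => continuous_comp_pt cu ex) wr xy xyO.
have fi := weak_deriv1_FTC (fun x ex => continuous_comp_pt_Im cu ex) wi xy xyO.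
rewrite /= in fr fi; rewrite -fr -fi /dens RintegralD//.
- by apply: lerD; exact: le_normr_Rintegral.
- exact: integrable_norm ir.
- exact: integrable_norm ii.
Qed.

Lemma segment_le_oedge (f : gpoint G -> R) e x y : measurable_fun setT f ->
  (forall p, 0 <= f p) -> (\int[mu]_p (f p)%:E < +oo)%E ->
  open_edge e x -> open_edge e y ->
  lam.-integrable `[x, y]%classic (EFin \o (fun z => f (pt e z))) /\
  ((\int[lam]_(z in `[x, y]) f (pt e z))%:E <= \int[mu]_(p in oedge e) (f p)%:E)%E.
Proof.
move=> mf f0 fin ex ey; have xyO := open_edge_itv ex ey.
have mfE : measurable_fun setT (EFin \o f) by exact/measurable_EFinP.
have mfpt : measurable_fun setT (fun z => (f (pt e z))%:E).
  by apply: (measurableT_comp mfE); exact: measurable_pt.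
have le : (\int[lam]_(z in `[x, y]) (f (pt e z))%:E <= \int[mu]_(p in oedge e) (f p)%:E)%E.
  rewrite (@ge0_integral_oedge _ _ (EFin \o f))//.
  apply: ge0_subset_integral => //; first exact: measurable_open_edge.
    exact: measurable_funTS.
  by move=> z _; rewrite lee_fin.
have lt : (\int[lam]_(z in `[x, y]) (f (pt e z))%:E < +oo)%E.
  apply: (le_lt_trans le); apply: le_lt_trans fin.
  apply: ge0_subset_integral => //; first exact: measurable_oedge.
  by move=> p _; rewrite lee_fin.
have i : lam.-integrable `[x, y]%classic (EFin \o (fun z => f (pt e z))).
  apply/integrableP; split; first exact: measurable_funTS.
  by under eq_integral do rewrite /= ger0_norm//.
split => //; rewrite -[leLHS]/((fine (\int[lam]_(z in `[x, y]) (f (pt e z))%:E))%:E) fineK//.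
exact: integrable_fin_num.
Qed.

Lemma sqint_seg_bound (f : gpoint G -> R) e x y : sqint mu f -> open_edge e x -> open_edge e y ->
  lam.-integrable `[x, y]%classic (EFin \o (fun z => f (pt e z) ^+ 2)) /\
  \int[lam]_(z in `[x, y]) (f (pt e z) ^+ 2) <= \int[mu]_p (f p ^+ 2).
Proof.
move=> sf ex ey; have [mf if2] := sf.
have mf2 : measurable_fun setT (fun p => f p ^+ 2) by exact: measurable_funX.
have fin : (\int[mu]_p (f p ^+ 2)%:E < +oo)%E.
  by rewrite -Rintegral_sqr_EFin// ltry.
have [i le] := segment_le_oedge mf2 (fun p => sqr_ge0 _) fin ex ey.
split => //; rewrite -lee_fin; apply: (le_trans le).
rewrite Rintegral_sqr_EFin//; apply: ge0_subset_integral => //.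
- exact: measurable_oedge.
- exact/measurable_EFinP.
- by move=> p _; rewrite lee_fin sqr_ge0.
Qed.

(** Young's inequality [d <= s + s^-1 * d ^+ 2], integrated over the segment. The parameter [s]
    stays free; optimizing it would give the Hoelder bound of exponent 1/2. *)
Lemma H1_hoelder u e x y (s : R) : H1 u -> open_edge e x -> open_edge e y -> 0 < s ->
  normc (u (pt e y) - u (pt e x)) <=
  s * `|y - x| + s^-1 * (2 * ip (wderiv u) (wderiv u)).
Proof.
move=> hu.
have H x' y' : open_edge e x' -> open_edge e y' -> 0 < s -> x' < y' ->
  normc (u (pt e y') - u (pt e x')) <=
    s * `|y' - x'| + s^-1 * (2 * ip (wderiv u) (wderiv u)).
  move=> ex ey s0 xy; apply: (le_trans (H1_osc hu ex ey xy)).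
  have [sd dle] := dens_sqint hu.
  have id := dens_segment_integrable hu ex ey.
  have [i2 b'] := sqint_seg_bound sd ex ey; have b := le_trans b' dle.
  have ic : lam.-integrable `[x', y']%classic (EFin \o (fun z => s)).
    by apply: continuous_segment_integrable => z _; exact: cvg_cst.
  apply: (@le_trans _ _ (\int[lam]_(z in `[x', y']) (s + s^-1 * dens u (pt e z) ^+ 2))).
    apply: le_Rintegral => //.
      by apply: integrableD_EFin => //; exact: integrableZ_EFin.
    move=> z _; have := dens_ge0 u (pt e z); set D := dens _ _ => D0.
    rewrite -(ler_pM2l s0) (_ : s * (s + _) = s * s + D ^+ 2); first by nra.
    by field; rewrite gt_eqF.
  rewrite RintegralD//; last exact: integrableZ_EFin.
  rewrite RintegralZl// Rintegral_cst//=.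
  rewrite lebesgue_measure_itv/= lte_fin xy -EFinD/= gtr0_norm ?subr_gt0//.
  by rewrite lerD2l ler_wpM2l// invr_ge0 ltW.
move=> ex ey s0; case: (ltgtP x y) => [xy|yx|->]; first exact: H.
  by rewrite normc_distC distrC; exact: H.
by rewrite subrr Normc.normc0 addr_ge0 ?mulr_ge0 ?invr_ge0 ?ip_ge0// ltW.
Qed.

End SupBound.

Section SupBound2.
Context {R : realType} {G : metricGraph R}.
Local Notation lam := (@lebesgue_measure R).
Local Notation mu := (gmeasure G).
Implicit Types (u v w g : gpoint G -> R[i]) (e : edge G) (x y c : R) (p : gpoint G).

Lemma ler_dist_max (a b c : R) : `|Num.max a c - Num.max b c| <= `|a - b|.
Proof.
have H a' b' : Num.max a' c - Num.max b' c <= `|a' - b'|.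
  have [h|h] := leP a' c; have [h'|h'] := leP b' c.
  - by rewrite subrr.
  - by rewrite (le_trans _ (normr_ge0 _))// subr_le0 ltW.
  - by rewrite (le_trans _ (ler_norm _))// lerD2l lerN2.
  - exact: ler_norm.
by rewrite ler_norml H andbT lerNl opprB distrC H.
Qed.

Lemma measurable_normc u : sq u -> measurable_fun setT (fun p => normc (u p)).
Proof.
move=> [[mr _] [mi _]].
have -> : (fun p => normc (u p)) =
    (fun p => Num.sqrt (complex.Re (u p) ^+ 2 + complex.Im (u p) ^+ 2)).
  by apply/funext => p; rewrite -normcE2 sqrtr_sqr ger0_norm// normc_ge0.
apply: (@measurableT_comp _ _ _ _ _ _ (@Num.sqrt R)).
  by apply: continuous_measurable_fun; exact: sqrt_continuous.
by apply: measurable_funD; exact: measurable_funX.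
Qed.

Definition above u c : set (gpoint G) := [set p | c < normc (u p)].

Lemma measurable_above u c : sq u -> measurable (above u c).
Proof.
move=> su; rewrite -[above u c]setTI.
have -> : [set: gpoint G] `&` above u c = [set: gpoint G] `&` (fun p => normc (u p)) @^-1` `]c, +oo[.
  by congr (_ `&` _); apply/seteqP; split => p; rewrite /= in_itv/= andbT.
exact: measurable_normc.
Qed.

(** A bound for the derivative of the modulus of [u] clipped from below at [c]. *)
Definition cdens u c p : R := dens u p * \1_(above u c) p.

Lemma cdens_ge0 u c p : 0 <= cdens u c p.
Proof. by rewrite mulr_ge0// dens_ge0. Qed.

Lemma measurable_cdens u c : H1 u -> measurable_fun setT (cdens u c).
Proof.
move=> hu; have [[md _] _] := dens_sqint hu; have /H1E[_ su _ _] := hu.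
apply: measurable_funM => //; apply: measurable_indic; exact: measurable_above.
Qed.

Lemma continuous_normc_pt u e x : continuous (u : gpoint G -> R[i]^o) -> open_edge e x ->
  {for x, continuous (fun y => normc (u (pt e y)))}.
Proof.
move=> cu ex; apply/cvgrPdist_lt => eps eps0.
have [d d0 dP] := continuous_pt cu (open_edge_on ex) eps0.
have := near_open_edge ex.
have : \forall y \near x, `|x - y| < d by apply/nbhs_ballP; exists d.
apply: filterS2 => y xyd ey; apply: le_lt_trans (dP _ (open_edge_on ey) xyd).
exact: ler_normc_dist.
Qed.

(** At interior points this is [clip_osc]; all other points of the edge, vertices included, are
    limits of interior ones. *)
Lemma edge_clip_osc u c (L : R) p p' : H1 u -> edge_of p = edge_of p' ->
  (\int[mu]_q (cdens u c q)%:E < +oo)%E ->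
  (\int[mu]_(q in oedge (edge_of p)) (cdens u c q)%:E <= L%:E)%E ->
  `|Num.max (normc (u p)) c - Num.max (normc (u p')) c| <= L.
Proof.
move=> hu epp' fin leL; have /H1E[cu su _ _] := hu.
set e := edge_of p in epp' leL.
have L0 : 0 <= L.
  by rewrite -lee_fin (le_trans _ leL)// integral_ge0// => q _; rewrite lee_fin cdens_ge0.
have H x y : open_edge e x -> open_edge e y -> x < y ->
    `|Num.max (normc (u (pt e y))) c - Num.max (normc (u (pt e x))) c| <= L.
  move=> ex ey xy; have xyO := open_edge_itv ex ey.
  have [i le] := segment_le_oedge (measurable_cdens c hu) (cdens_ge0 u c) fin ex ey.
  rewrite -lee_fin; apply: le_trans leL; apply: le_trans le; rewrite lee_fin.
  have := @clip_osc _ (fun z => normc (u (pt e z))) (fun z => dens u (pt e z)) c x y xy.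
  case/(_ _ _ _ _ _)/Wrap => //.
  - by move=> z xzy; apply: continuous_normc_pt => //; apply: xyO; rewrite /= in_itv.
  - exact: dens_segment_integrable.
  - by move=> z; exact: dens_ge0.
  - move=> s t xs st ty.
    have es : open_edge e s by apply: xyO; rewrite /= in_itv/= xs (le_trans (ltW st)).
    have et : open_edge e t by apply: xyO; rewrite /= in_itv/= ty (le_trans xs)// ltW.
    by apply: le_trans (H1_osc hu es et st); exact: ler_normc_dist.
  - rewrite -[X in measurable X]setTI.
    have mm := measurable_above c su.
    exact: (measurable_pt e measurableT mm).
have H' x y : open_edge e x -> open_edge e y ->
    `|Num.max (normc (u (pt e y))) c - Num.max (normc (u (pt e x))) c| <= L.
  move=> ex ey; case: (ltgtP x y) => [xy|yx|->]; first exact: H.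
    by rewrite distrC; exact: H.
  by rewrite subrr normr0.
apply/ler_addgt0Pr => eps eps0.
have near q : edge_of q = e -> exists2 x, open_edge e x & normc (u q - u (pt e x)) < eps / 2.
  move=> qe; have qpt : q = pt e (Defs.coord q) by rewrite -qe ptK.
  have eq : on_interval (e, Defs.coord q).
    by rewrite -qe; case: q {qe qpt} => -[a b] h.
  have e2 : 0 < eps / 2 by rewrite divr_gt0.
  have [d d0 dP] := continuous_pt cu eq e2.
  have [y ey xyd] := open_edge_dense eq d0.
  by exists y => //; rewrite qpt; apply: dP => //; exact: open_edge_on.
have [x ex xp] := near p erefl; have [y ey yp] := near p' (esym epp').
have a1 := le_lt_trans (ler_dist_max (normc (u p)) (normc (u (pt e x))) c)
  (le_lt_trans (ler_normc_dist _ _) xp).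
have a2 := le_lt_trans (ler_dist_max (normc (u p')) (normc (u (pt e y))) c)
  (le_lt_trans (ler_normc_dist _ _) yp).
have a3 := H' y x ey ex.
move: a1 a2 a3; rewrite !ltr_norml !ler_norml => /andP[? ?] /andP[? ?] /andP[? ?].
by apply/andP; split; lra.
Qed.

End SupBound2.

Section SupBound3.
Context {R : realType} {G : metricGraph R}.
Local Notation lam := (@lebesgue_measure R).
Local Notation mu := (gmeasure G).
Implicit Types (u v w g : gpoint G -> R[i]) (e : edge G) (x y c : R) (p : gpoint G).

Lemma continuous_normc u : continuous (u : gpoint G -> R[i]^o) ->
  continuous (fun p => normc (u p)).
Proof.
move=> /gcontinuousP cu p; apply/(@cvgrPdist_lt _ R _ (nbhs p) (nbhs_filter p)) => eps eps0.
have := cu p eps eps0; apply: (@filterS _ _ (nbhs_filter p)) => p' h.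
exact: le_lt_trans (ler_normc_dist _ _) h.
Qed.

(* The image of the graph under the clipped modulus is an interval, covered by
   the images of the edges, whose lengths are controlled by [cdens]. *)
Lemma range_bound u c p0 p1 : connected [set: gpoint G] -> countable [set: edge G] ->
  H1 u -> normc (u p1) < c -> c < normc (u p0) ->
  ((normc (u p0) - c)%:E <= \int[mu]_q (cdens u c q)%:E)%E.
Proof.
move=> conn /countable_injP[f finj] hu p1c cp0; have /H1E[cu su _ _] := hu.
have [fin|] := ltP (\int[mu]_q (cdens u c q)%:E)%E +oo%E; last first.
  by rewrite leye_eq => /eqP ->; rewrite leey.
have rng z : c < z <= normc (u p0) -> exists p, normc (u p) = z.
  move=> /andP[cz zp].
  have cimg : connected ((fun p => normc (u p)) @` [set: gpoint G]).
    apply: connected_continuous_connected => //.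
    by apply: continuous_subspaceT; exact: continuous_normc.
  have [|||p _ <-] := (connected_intervalP _).1 cimg (normc (u p1)) (normc (u p0)) _ _ z.
  - by exists p1.
  - by exists p0.
  - by rewrite zp andbT ltW// (lt_trans p1c).
  - by exists p.
(* The edges are numbered by an injection into the naturals; a number without an edge gives the
   empty set. *)
pose E k : set (gpoint G) := [set p | f (edge_of p) = k /\ open_edge (edge_of p) (Defs.coord p)].
have EE e : E (f e) = oedge e.
  apply/seteqP; split => p [pe op].
    have pe' : edge_of p = e by apply: finj; rewrite ?inE.
    by split => //; rewrite -pe'.
  by split; rewrite pe.
have mE k : measurable (E k).
  case: (pselect (exists e, f e = k)) => [[e1 he1]|nk].
    by rewrite -he1 EE; exact: measurable_oedge.
  rewrite (_ : E k = set0); first exact: measurable0.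
  by apply/seteqP; split => // p [h _]; apply: nk; exists (edge_of p).
have tE : trivIset setT E.
  apply/trivIsetP => i j _ _ ij; apply/seteqP; split => // p [[h _] [h' _]].
  by move: ij; rewrite -h h' eqxx.
have mcd : measurable_fun setT (EFin \o cdens u c) by apply/measurable_EFinP; exact: measurable_cdens.
have cd0 p : (0 <= (cdens u c p)%:E)%E by rewrite lee_fin cdens_ge0.
pose L k := (\int[mu]_(q in E k) (cdens u c q)%:E)%E.
have L0 k : (0 <= L k)%E by exact: integral_ge0.
have Lfin k : (L k < +oo)%E.
  by apply: le_lt_trans fin; apply: ge0_subset_integral.
have Lsum : (\sum_(k <oo) L k <= \int[mu]_q (cdens u c q)%:E)%E.
  rewrite -ge0_integral_bigcup//; last exact: measurable_funTS.
  by apply: ge0_subset_integral => //; exact: bigcup_measurable.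
pose h p := Num.max (normc (u p)) c.
pose A k : set R := [set h p | p in [set p | f (edge_of p) = k]].
(* A segment starting at the lowest clipped value on the edge, of a length that bounds the
   oscillation there; for a number without an edge it is a single point. *)
pose I k : set R := `[inf (A k), inf (A k) + fine (L k)]%classic.
have cov : `]c, normc (u p0)]%classic `<=` \bigcup_k I k.
  move=> z; rewrite /= in_itv/= => zc; have [p pz] := rng z zc.
  exists (f (edge_of p)) => //; rewrite /I /= in_itv/=.
  have hp : h p = z by rewrite /h pz max_l//; case/andP: zc => /ltW.
  have Ap : A (f (edge_of p)) z by exists p.
  have lbA : lbound (A (f (edge_of p))) c by move=> _ [q _ <-]; rewrite /h le_max lexx orbT.
  apply/andP; split; first by apply: ge_inf => //; exists c.
  rewrite -lerBlDr; apply: lb_le_inf; first by exists z.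
  move=> _ [q qe <-]; rewrite -hp lerBlDr.
  have epq : edge_of p = edge_of q by apply: finj; rewrite ?inE//; rewrite qe.
  have := @edge_clip_osc _ _ u c (fine (L (f (edge_of p)))) p q hu epq fin.
  rewrite fineK ?ge0_fin_numE// /L EE => /(_ (lexx _)).
  by move=> /(le_trans (ler_norm _)); rewrite lerBlDl.
have : (lam `]c, normc (u p0)]%classic <= \sum_(k <oo) lam (I k))%E.
  apply: (@measure_sigma_subadditive _ _ _ lam _ _ _ _ cov) => [k|]; exact: measurable_itv.
rewrite lebesgue_measure_itv/= lte_fin cp0 -EFinD => /le_trans; apply.
apply: le_trans Lsum; apply: lee_nneseries => [//|k _].
rewrite /I lebesgue_measure_itv/= lte_fin; case: ifPn => // _.
by rewrite -EFinD addrAC subrr add0r fineK// ge0_fin_numE.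
Qed.

(** Young's inequality on the set where the modulus exceeds [c]. There 1 is at most |u|^2 / c^2, so
    the constant term is paid for by the L^2 norm, as in Chebyshev's inequality. *)
Lemma cdens_bound u c (s : R) : H1 u -> 0 < c -> 0 < s ->
  (\int[mu]_q (cdens u c q)%:E <=
   (s / (2 * c ^+ 2) * ip u u + s^-1 * ip (wderiv u) (wderiv u))%:E)%E.
Proof.
move=> hu c0 s0; have /H1E[_ su _ swu] := hu.
have [sd dle] := dens_sqint hu.
have iN := sq_normc_integrable su.
pose b q := s / (2 * c ^+ 2) * normc (u q) ^+ 2 + (2 * s)^-1 * dens u q ^+ 2.
have c20 : 0 < 2 * c ^+ 2 by rewrite mulr_gt0// exprn_gt0.
have ib : mu.-integrable setT (EFin \o b).
  by apply: integrableD_EFin => //; apply: integrableZ_EFin => //; case: sd.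
have bE : \int[mu]_q b q <= s / (2 * c ^+ 2) * ip u u + s^-1 * ip (wderiv u) (wderiv u).
  rewrite RintegralD//; last 2 first.
  - exact: integrableZ_EFin.
  - by apply: integrableZ_EFin => //; case: sd.
  rewrite RintegralZl// RintegralZl//; last by case: sd.
  rewrite -ip_normc lerD2l.
  rewrite (@le_trans _ _ ((2 * s)^-1 * (2 * ip (wderiv u) (wderiv u))))//.
    by rewrite ler_wpM2l// invr_ge0 mulr_ge0// ltW.
  by rewrite invfM mulrCA !mulrA mulfV// mul1r.
apply: (@le_trans _ _ (\int[mu]_q b q)%:E); last by rewrite lee_fin.
rewrite -[leRHS]/((fine (\int[mu]_q (b q)%:E))%:E) fineK; last exact: integrable_fin_num.
apply: ge0_le_integral => //.
- by move=> q _; rewrite lee_fin cdens_ge0.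
- by apply/measurable_EFinP; exact: measurable_cdens.
- by case/integrableP : ib.
move=> q _; rewrite lee_fin /cdens /b.
have d0 := dens_ge0 u q; set d := dens u q in d0 *.
have n0 := normc_ge0 (u q); set n := normc (u q) in n0 *.
have [qS|qS] := pselect (above u c q); last first.
  rewrite indicE memNset// mulr0 addr_ge0// mulr_ge0 ?sqr_ge0//.
    by rewrite divr_ge0// ltW.
  by rewrite invr_ge0 mulr_ge0// ltW.
rewrite indicE mem_set// mulr1.
apply: (@le_trans _ _ (s / 2 + (2 * s)^-1 * d ^+ 2)).
  have s2 : 0 < 2 * s by rewrite mulr_gt0.
  rewrite -(ler_pM2l s2) [leRHS](_ : _ = s * s + d ^+ 2).
    rewrite -subr_ge0 (_ : _ - _ = (s - d) ^+ 2) ?sqr_ge0//.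
    by ring.
  by field; rewrite gt_eqF.
rewrite lerD2r (_ : s / (2 * c ^+ 2) * n ^+ 2 = s / 2 * (n ^+ 2 / c ^+ 2)); last first.
  by field; rewrite gt_eqF.
rewrite ler_pMr ?divr_gt0// ler_pdivlMr ?exprn_gt0// mul1r.
by rewrite lerXn2r ?nnegrE ?(ltW c0)//; exact: ltW.
Qed.

(** A Gagliardo-Nirenberg inequality on the whole graph. Clip at half the value at [p]: if the
    modulus falls below this level somewhere, [range_bound] and [cdens_bound] apply; otherwise it
    exceeds the level on a fixed segment, and the L^2 norm alone controls it. *)
Lemma H1_sup : connected [set: gpoint G] -> countable [set: edge G] ->
  exists2 C : R, 0 < C & forall u p, H1 u ->
    normc (u p) ^+ 4 <= C * (ip u u * (ip u u + ip (wderiv u) (wderiv u))).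
Proof.
move=> conn cnt; pose e0 : edge G := point.
have [y ey _] := open_edge_dense (origin_on_interval e0) ltr01.
have y0 : 0 < y by case: ey.
have ey2 : open_edge e0 (y / 2).
  split; first by rewrite divr_gt0.
  by case: ey => _; apply: le_lt_trans; rewrite lee_fin; lra.
(* 32 comes from the first case, where m^4 <= 32 N D; the other summand from the segment [y/2, y],
   where m^2 <= 8 N / y. *)
exists (32 + 4 * (4 / y) ^+ 2 ).
  by rewrite ltr_wpDr// mulr_ge0// sqr_ge0.
move=> u p hu; have /H1E[cu su wu swu] := hu.
have N0 := ip_ge0 u; have D0 := ip_ge0 (wderiv u).
set N := ip u u in N0 *; set D := ip (wderiv u) _ in D0 *.
have := normc_ge0 (u p); rewrite le_eqVlt => /predU1P[<-|m0].
  by rewrite expr0n/= mulr_ge0 ?(mulr_ge0 N0 (addr_ge0 N0 D0))// addr_ge0// mulr_ge0// sqr_ge0.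
set m := normc (u p) in m0 *.
have c0 : 0 < m / 2 by rewrite divr_gt0.
case: (pselect (exists q, normc (u q) < m / 2)) => [[q qc]|nq].
  have H s : 0 < s -> m / 2 <= s / (2 * (m / 2) ^+ 2) * N + s^-1 * D.
    move=> s0; have cm : m / 2 < m by rewrite ltr_pdivrMr// ltr_pMr// ltr1n.
    have := le_trans (range_bound conn cnt hu qc cm) (cdens_bound hu c0 s0).
    by rewrite lee_fin; apply: le_trans; rewrite -/m; lra.
  suff : m ^+ 4 <= 32 * (N * D).
    have := mulr_ge0 N0 N0; have := mulr_ge0 N0 D0; have := sqr_ge0 (4 / y).
    set K := (4 / y) ^+ 2 => K0 ND NN.
    have := mulr_ge0 K0 ND; have := mulr_ge0 K0 NN; nra.
  move: N0; rewrite le_eqVlt => /predU1P[NE|N0].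
    (* For [N = 0] this [s] makes the right-hand side of [H] at most m/4, a contradiction. *)
    have := H (4 * (D + 1) / m); rewrite divr_gt0 ?mulr_gt0// ?ltr_wpDl// => /(_ isT).
    rewrite -NE mulr0 add0r.
    have -> : (4 * (D + 1) / m)^-1 * D = m / 4 * (D / (D + 1)).
      by field; rewrite !gt_eqF// ltr_wpDl.
    have : D / (D + 1) <= 1 by rewrite ler_pdivrMr ?ltr_wpDl// mul1r lerDl.
    by move=> h1 h2; exfalso; nra.
  (* This [s] makes the first term m/4, half of the left-hand side. *)
  have := H (m ^+ 3 / (8 * N)); rewrite divr_gt0 ?exprn_gt0 ?mulr_gt0// => /(_ isT).
  have -> : m ^+ 3 / (8 * N) / (2 * (m / 2) ^+ 2) * N + (m ^+ 3 / (8 * N))^-1 * D =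
    m / 4 + 8 * (N * D) / m ^+ 3 by field; rewrite !gt_eqF.
  move=> h; have : m / 4 <= 8 * (N * D) / m ^+ 3 by lra.
  rewrite ler_pdivlMr ?exprn_gt0// => h'.
  by rewrite (_ : m ^+ 4 = 4 * (m / 4 * m ^+ 3)); [lra|field].
have le0 q : m / 2 <= normc (u q) by rewrite leNgt; apply/negP => h; apply: nq; exists q.
have mN : measurable_fun setT (fun q => normc (u q) ^+ 2).
  by apply: measurable_funX; exact: measurable_normc.
have finN : (\int[mu]_q (normc (u q) ^+ 2)%:E < +oo)%E by rewrite -ip_EFin// ltry.
have [i le1] := segment_le_oedge mN (fun q => sqr_ge0 _) finN ey2 ey.
have : (m / 2) ^+ 2 * (y / 2) <= N.
  rewrite -lee_fin ip_EFin//.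
  apply: (@le_trans _ _ (\int[mu]_(p0 in oedge e0) (normc (u p0) ^+ 2)%:E)%E); last first.
    apply: ge0_subset_integral => //; first exact: measurable_oedge.
      exact/measurable_EFinP.
    by move=> q _; rewrite lee_fin sqr_ge0.
  apply: le_trans le1; rewrite lee_fin.
  have -> : (m / 2) ^+ 2 * (y / 2) = \int[lam]_(z in `[y / 2, y]) ((m / 2) ^+ 2).
    rewrite Rintegral_cst//= lebesgue_measure_itv/= lte_fin ifT.
      by rewrite -EFinD /=; lra.
    by rewrite ltr_pdivrMr// ltr_pMr// ltr1n.
  apply: le_Rintegral => //.
    by apply: continuous_segment_integrable => z _; exact: cvg_cst.
  by move=> z _; rewrite lerXn2r ?nnegrE ?normc_ge0// ltW.
move=> h; have {}h : m ^+ 2 <= 8 * N / y.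
  by rewrite ler_pdivlMr//; move: h; rewrite expr_div_n; lra.
have : (m ^+ 2) ^+ 2 <= (8 * N / y) ^+ 2.
  by rewrite lerXn2r ?nnegrE ?sqr_ge0// (le_trans (sqr_ge0 m)).
rewrite -exprM => /le_trans; apply.
rewrite (_ : (8 * N / y) ^+ 2 = 4 * (4 / y) ^+ 2 * (N * N)); last by field; rewrite gt_eqF.
have := mulr_ge0 N0 N0; have := mulr_ge0 N0 D0; have := sqr_ge0 (4 / y).
set K := (4 / y) ^+ 2 => K0 ND NN.
by have := mulr_ge0 K0 ND; have := mulr_ge0 K0 NN; nra.
Qed.

End SupBound3.

(** * Completeness of H1 *)

Section WeakLimit.
Context {R : realType}.
Local Notation lam := (@lebesgue_measure R).

Lemma compact_integrable_norm (O K : set R) (h : R -> R) : locally_integrable O h ->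
  compact K -> K `<=` O -> lam.-integrable K (EFin \o (fun x => `|h x|)).
Proof.
move=> [mh oO hK] cK KO; apply/integrableP; split.
  apply/measurable_EFinP; apply: measurableT_comp => //.
  exact: (measurable_funS (open_measurable oO) KO mh).
by under eq_integral do rewrite /= normr_id; exact: hK.
Qed.

Lemma int_mul_bound (O K : set R) (h psi : R -> R) (M : R) : locally_integrable O h ->
  continuous psi -> compact K -> K `<=` O -> (forall x, ~ K x -> psi x = 0) ->
  (forall x, `|psi x| <= M) ->
  `|\int[lam]_(x in O) (h x * psi x)| <= M * \int[lam]_(x in K) `|h x|.
Proof.
move=> lh cpsi cK KO psi0 psiM; have [mh oO hK] := lh.
have mO := open_measurable oO; have mK := compact_measurable cK.
have iO := locally_integrable_mul lh cpsi cK KO psi0.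
rewrite (@Rintegral_support _ _ _ lam K)//; last by move=> x _ nK; rewrite psi0 ?mulr0.
have iK : lam.-integrable K (EFin \o (fun x => h x * psi x)).
  exact: (lebesgue_integrableS mO mK KO iO).
have iN := compact_integrable_norm lh cK KO.
rewrite (le_trans (le_normr_Rintegral _ _))// -RintegralZl//.
apply: le_Rintegral => //; first exact: integrable_norm iK.
  exact: integrableZ_EFin.
by move=> x _; rewrite normrM mulrC ler_wpM2r.
Qed.

(** Tested against a function with fixed compact support, the weak identity is continuous under L^1
    convergence on that support of the functions and of their derivatives. *)
Lemma weak_deriv1_limit (O : set R) (f g : R -> R) (F : nat -> R -> R) (D : nat -> R -> R) :
  locally_integrable O f -> locally_integrable O g ->
  (forall k, locally_integrable O (F k)) -> (forall k, weak_deriv1 O (F k) (D k)) ->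
  (forall K, compact K -> K `<=` O -> forall eps : R, 0 < eps -> exists k,
    \int[lam]_(x in K) `|F k x - f x| <= eps /\ \int[lam]_(x in K) `|D k x - g x| <= eps) ->
  weak_deriv1 O f g.
Proof.
move=> lf lg lF wF conv; split => // phi tphi; have [dphi cphi' _] := tphi.
have [K [cK KO phi0 dphi0]] := C1_test_derive0 tphi.
have cphi : continuous phi by move=> x; apply/differentiable_continuous/derivable1_diffP.
have [M M0 phiM] := compact_support_bounded cphi cK phi0.
have [M' M'0 phiM'] := compact_support_bounded cphi' cK dphi0.
have mO : measurable O by apply: open_measurable; case: lf.
apply/eqP; rewrite -subr_eq0 opprK -normr_le0; apply/ler_addgt0Pr => eps eps0.
rewrite add0r.
have e2 : 0 < eps / (M + M' + 1) by rewrite divr_gt0// ltr_wpDl// addr_ge0.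
have [k [Fk Dk]] := conv K cK KO _ e2.
have lD : locally_integrable O (D k) by case: (wF k).
have lFf := locally_integrableB (lF k) lf.
have lDg := locally_integrableB lD lg.
have b1 := int_mul_bound lFf cphi' cK KO dphi0 phiM'.
have b2 := int_mul_bound lDg cphi cK KO phi0 phiM.
have E (h1 h2 psi : R -> R) : lam.-integrable O (EFin \o (fun x => h1 x * psi x)) ->
    lam.-integrable O (EFin \o (fun x => h2 x * psi x)) ->
    \int[lam]_(x in O) ((h1 \- h2) x * psi x) =
    \int[lam]_(x in O) (h1 x * psi x) - \int[lam]_(x in O) (h2 x * psi x).
  by move=> i1 i2; rewrite -RintegralB//; apply: eq_Rintegral => x _; rewrite /= mulrBl.
have [_ I1] := C1_test_integrable (lF k) tphi.
have [_ I2] := C1_test_integrable lf tphi.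
have [I3 _] := C1_test_integrable lD tphi.
have [I4 _] := C1_test_integrable lg tphi.
rewrite E// in b1; rewrite E// in b2.
have wk := (wF k).2 phi tphi.
have -> : \int[lam]_(x in O) (f x * phi^`()%classic x) + \int[lam]_(x in O) (g x * phi x) =
  - (\int[lam]_(x in O) (F k x * phi^`()%classic x) - \int[lam]_(x in O) (f x * phi^`()%classic x))
  - (\int[lam]_(x in O) (D k x * phi x) - \int[lam]_(x in O) (g x * phi x)).
  by rewrite wk; ring.
rewrite (le_trans (ler_normB _ _))// normrN.
apply: (@le_trans _ _ ((M' + M) * (eps / (M + M' + 1)))).
  rewrite mulrDl; apply: lerD.
    by apply: (le_trans b1); rewrite ler_wpM2l.
  by apply: (le_trans b2); rewrite ler_wpM2l.
rewrite mulrA ler_pdivrMr ?ltr_wpDl ?addr_ge0// mulrC ler_wpM2l ?(ltW eps0)//; lra.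
Qed.

End WeakLimit.

Section H1Space.
Context {R : realType} {G : metricGraph R}.
Local Notation lam := (@lebesgue_measure R).
Local Notation mu := (gmeasure G).
Local Notation X := (gpoint G -> Rcomplex R).
Local Notation Re := complex.Re.
Local Notation Im := complex.Im.
Implicit Types (u v w g : X) (e : edge G) (x y : R) (p : gpoint G).

(** Young's inequality again: [s] trades the measure of [K] against the L^2 norm, so that L^2
    convergence gives L^1 convergence on compact sets. *)
Lemma sqint_compact_bound (h : gpoint G -> R) e (K : set R) (s : R) : sqint mu h ->
  compact K -> K `<=` open_edge e -> 0 < s ->
  lam.-integrable K (EFin \o (fun x => h (pt e x))) /\
  \int[lam]_(x in K) `|h (pt e x)| <= s * fine (lam K) + s^-1 * \int[mu]_p (h p ^+ 2).
Proof.
move=> [mh ih2] cK Ke s0; have mK := compact_measurable cK.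
have finK : (lam K < +oo)%E by exact: compact_finite_measure.
have mh2 : measurable_fun setT (fun p => (h p ^+ 2)%:E).
  by apply/measurable_EFinP; exact: measurable_funX.
have le2 := ge0_integral_oedge_le mh2 (fun p => sqr_ge0 (h p)) mK Ke.
have mhpt : measurable_fun setT (fun x => h (pt e x)).
  by apply: (measurableT_comp mh); exact: measurable_pt.
have i2 : lam.-integrable K (EFin \o (fun x => h (pt e x) ^+ 2)).
  apply/integrableP; split.
    by apply/measurable_EFinP; apply: measurable_funTS; exact: measurable_funX.
  under eq_integral do rewrite /= ger0_norm ?sqr_ge0//.
  by apply: (le_lt_trans le2); rewrite -Rintegral_sqr_EFin ?ltry//; split.
have ic : lam.-integrable K (EFin \o (fun=> s)).
  apply/integrableP; split; first exact/measurable_EFinP.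
  by rewrite integral_cst//= lte_mul_pinfty.
have ib : lam.-integrable K (EFin \o (fun x => s + s^-1 * h (pt e x) ^+ 2)).
  by apply: integrableD_EFin => //; exact: integrableZ_EFin.
have hb x : `|h (pt e x)| <= s + s^-1 * h (pt e x) ^+ 2.
  rewrite -(ler_pM2l s0) [leRHS](_ : _ = s * s + `|h (pt e x)| ^+ 2); first by nra.
  by rewrite real_normK ?num_real//; field; rewrite gt_eqF.
have i1 : lam.-integrable K (EFin \o (fun x => h (pt e x))).
  apply: (@le_integrable_EFin _ (measurableTypeR R) _ lam _ _
    (fun x => s + s^-1 * h (pt e x) ^+ 2)) => //.
  exact: measurable_funTS.
split => //.
apply: (@le_trans _ _ (\int[lam]_(x in K) (s + s^-1 * h (pt e x) ^+ 2))).
  by apply: le_Rintegral => //; exact: integrable_norm i1.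
rewrite RintegralD//; last exact: integrableZ_EFin.
rewrite RintegralZl// Rintegral_cst// lerD2l ler_wpM2l ?invr_ge0 ?(ltW s0)//.
rewrite -lee_fin Rintegral_sqr_EFin//; apply: le_trans le2.
by rewrite -[leLHS]/((fine (\int[lam]_(x in K) (h (pt e x) ^+ 2)%:E))%:E) fineK//;
  exact: integrable_fin_num.
Qed.

Lemma sqint_locally_integrable (h : gpoint G -> R) e : sqint mu h ->
  locally_integrable (open_edge e) (fun x => h (pt e x)).
Proof.
move=> sh; split.
- by apply: measurable_funTS; apply: (measurableT_comp sh.1); exact: measurable_pt.
- exact: open_edge_open.
- move=> K Ke cK; have [/integrableP[] //] := sqint_compact_bound sh cK Ke ltr01.
Qed.

Lemma weak_derivative_limit (u g : X) (U D : nat -> X) :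
  continuous (u : gpoint G -> R[i]^o) -> sq u -> sq g ->
  (forall k, continuous (U k : gpoint G -> R[i]^o)) ->
  (forall k, sq (U k)) -> (forall k, sq (D k)) -> (forall k, weak_derivative (U k) (D k)) ->
  ip (U k - u) (U k - u) @[k --> \oo] --> 0 ->
  ip (D k - g) (D k - g) @[k --> \oo] --> 0 ->
  weak_derivative u g.
Proof.
move=> cu su sg cU sU sD wU Uu Dg; apply/weak_derivativeP => e.
(* [pr] stands for the real and for the imaginary part. *)
have lim (pr : R[i] -> R) (prB : forall z w : R[i], pr (z - w) = pr z - pr w)
    (prn : forall z : R[i], `|pr z| <= normc z) (K : set R) :
    (forall h : X, sq h -> sqint mu (fun p => pr (h p))) ->
    compact K -> K `<=` open_edge e -> forall eps : R, 0 < eps -> exists k,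
    \int[lam]_(x in K) `|pr (U k (pt e x)) - pr (u (pt e x))| <= eps /\
    \int[lam]_(x in K) `|pr (D k (pt e x)) - pr (g (pt e x))| <= eps.
  move=> spr cK Ke eps eps0; set l := fine (lam K).
  have l0 : 0 <= l by rewrite fine_ge0.
  pose s := eps / (2 * (l + 1)).
  have s0 : 0 < s by rewrite divr_gt0// mulr_gt0// ltr_wpDl.
  have sl : s * l <= eps / 2.
    rewrite /s invfM mulrA -mulrA ler_piMr ?divr_ge0 ?(ltW eps0)//.
    by rewrite mulrC ler_pdivrMr ?ltr_wpDl// mul1r lerDl.
  have se : 0 < s * (eps / 2) by rewrite mulr_gt0// divr_gt0.
  have [N1 _ H1] : \forall k \near \oo, ip (U k - u) (U k - u) < s * (eps / 2).
    by have /cvgr_lt := Uu; apply.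
  have [N2 _ H2] : \forall k \near \oo, ip (D k - g) (D k - g) < s * (eps / 2).
    by have /cvgr_lt := Dg; apply.
  have B (h : X) : sq h -> ip h h < s * (eps / 2) ->
      \int[lam]_(x in K) `|pr (h (pt e x))| <= eps.
    move=> sh hs; have [_ b] := sqint_compact_bound (spr _ sh) cK Ke s0.
    apply: (le_trans b).
    have : \int[mu]_p (pr (h p) ^+ 2) <= ip h h.
      rewrite ip_normc; apply: le_Rintegral => //; first by case: (spr _ sh).
        exact: sq_normc_integrable.
      move=> p _; rewrite -real_normK ?num_real//.
      by rewrite lerXn2r ?nnegrE ?normc_ge0.
    move=> /le_lt_trans /(_ hs) ph.
    have : s^-1 * \int[mu]_p (pr (h p) ^+ 2) <= eps / 2.
      by rewrite ler_pdivrMl// ltW.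
    by move: sl; rewrite -/l; lra.
  have subsp := sq_subspace (G := G).
  exists (maxn N1 N2); split.
    have -> : \int[lam]_(x in K) `|pr (U (maxn N1 N2) (pt e x)) - pr (u (pt e x))| =
      \int[lam]_(x in K) `|pr ((U (maxn N1 N2) - u) (pt e x))|.
      by apply: eq_Rintegral => x _; rewrite -prB.
    apply: B; first exact: lin_subspaceB.
    by apply: H1 => /=; exact: leq_maxl.
  have -> : \int[lam]_(x in K) `|pr (D (maxn N1 N2) (pt e x)) - pr (g (pt e x))| =
    \int[lam]_(x in K) `|pr ((D (maxn N1 N2) - g) (pt e x))|.
    by apply: eq_Rintegral => x _; rewrite -prB.
  apply: B; first exact: lin_subspaceB.
  by apply: H2 => /=; exact: leq_maxr.
have oe : open (open_edge e) by exact: open_edge_open.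
split.
  apply: (@weak_deriv1_limit _ _ _ _ (fun k x => Re (U k (pt e x))) (fun k x => Re (D k (pt e x)))).
  - apply: continuous_locally_integrable; first exact: oe.
    by move=> x ex; exact: (continuous_comp_pt cu ex).
  - by apply: (@sqint_locally_integrable (fun p => Re (g p))); case: sg.
  - move=> k; apply: continuous_locally_integrable; first exact: oe.
    by move=> x ex; exact: (continuous_comp_pt (cU k) ex).
  - by move=> k; have /weak_derivativeP /(_ e) [] := wU k.
  - move=> K; apply: lim; [exact: raddfB|exact: Re_le_normc|by move=> h []].
apply: (@weak_deriv1_limit _ _ _ _ (fun k x => Im (U k (pt e x))) (fun k x => Im (D k (pt e x)))).
- apply: continuous_locally_integrable; first exact: oe.
  by move=> x ex; exact: (continuous_comp_pt_Im cu ex).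
- by apply: (@sqint_locally_integrable (fun p => Im (g p))); case: sg.
- move=> k; apply: continuous_locally_integrable; first exact: oe.
  by move=> x ex; exact: (continuous_comp_pt_Im (cU k) ex).
- by move=> k; have /weak_derivativeP /(_ e) [] := wU k.
- move=> K; apply: lim; [exact: raddfB|exact: Im_le_normc|by move=> h []].
Qed.

End H1Space.

Section H1Complete.
Context {R : realType} {G : metricGraph R}.
Local Notation lam := (@lebesgue_measure R).
Local Notation mu := (gmeasure G).
Local Notation X := (gpoint G -> Rcomplex R).
Local Notation Re := complex.Re.
Local Notation Im := complex.Im.
Implicit Types (u v w g : X) (e : edge G) (x y : R) (p : gpoint G).

Lemma scaleRcE (c : R) (z : R[i]) : (c *: (z : Rcomplex R)) = (c%:C)%C * z :> R[i].
Proof. by case: z => a b; apply/eqP; rewrite eq_complex /= !mul0r subr0 addr0 !eqxx. Qed.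

Lemma H1_0 : @H1 R G (0 : X).
Proof.
have c0 : continuous ((0 : X) : gpoint G -> R[i]^o).
  apply/gcontinuousP => p eps eps0; apply: (@filterE _ _ (nbhs_filter p)) => p'.
  by rewrite subrr Normc.normc0.
have s0 : sq (0 : X) by exact: (sq_subspace (G := G)).1.
split => //; first exact/Lp2P.
exists (0 : X); last exact/Lp2P.
have Z (e : edge G) : weak_deriv1 (open_edge e) (fun=> 0 : R) (fun=> 0 : R).
  split; first by apply: (sqint_locally_integrable (h := fun=> 0)); exact: sqint_cst0.
  move=> phi _; under eq_Rintegral do rewrite mul0r.
  under [in RHS]eq_Rintegral do rewrite mul0r.
  by rewrite Rintegral_cst ?mul0r ?oppr0//; exact: measurable_open_edge.
by apply/weak_derivativeP => e; split; exact: Z.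
Qed.

Lemma H1_linR (c : R) u v : H1 u -> H1 v -> H1 (c *: u + v) /\
  {ae mu, forall p, wderiv (c *: u + v) p = (c *: (wderiv u : X) + (wderiv v : X)) p}.
Proof.
move=> hu hv; have := H1_lin (c%:C)%C hu hv.
have E (a b : X) : (fun p => (c%:C)%C * a p + b p) = (c *: a + b : X).
  by apply/funext => p; rewrite -scaleRcE.
by rewrite !E => -[? ae]; split => //; apply: filterS ae => p ->; rewrite -scaleRcE.
Qed.

Lemma H1_subspace : lin_subspace (@H1 R G : set X).
Proof. by split; [exact: H1_0|move=> c u v hu hv; exact: (H1_linR c hu hv).1]. Qed.

Lemma H1_sq u : H1 u -> sq u.
Proof. by move=> /H1E[]. Qed.

Lemma H1_sqd u : H1 u -> sq (wderiv u).
Proof. by move=> /H1E[]. Qed.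

Definition dip u v : R := ip (wderiv u) (wderiv v).

Lemma dip_form : sym_form (@H1 R G : set X) dip.
Proof.
split=> [u v /H1_sqd hu /H1_sqd hv|c u v w hu hv hw].
  exact: (ip_form (G := G)).1.
have [huv ae] := H1_linR c hu hv.
rewrite -(ip_form (G := G)).2; try exact: H1_sqd.
apply: sq_ae_ip => //; try exact: H1_sqd.
  by apply: (sq_subspace (G := G)).2; exact: H1_sqd.
exact: aeW.
Qed.

Lemma dip_sqrB u v : H1 u -> H1 v ->
  dip (u - v) (u - v) = ip ((wderiv u : X) - (wderiv v : X)) ((wderiv u : X) - (wderiv v : X)).
Proof.
move=> hu hv; rewrite /dip.
have [huv ae] := H1_linR (-1) hv hu.
have E (a b : X) : -1 *: a + b = b - a by rewrite scaleN1r addrC.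
rewrite !E in huv ae.
have ss := sq_subspace (G := G).
apply: sq_ae_ip => //; try exact: H1_sqd; try by apply: lin_subspaceB => //; exact: H1_sqd.
Qed.

End H1Complete.

Section GeometricCauchy.
Context {R : realType}.

Lemma lim_dist_le (f : nat -> R) (l c : R) (b : R) n : f m @[m --> \oo] --> l ->
  (forall m, (n <= m)%N -> `|c - f m| <= b) -> `|c - l| <= b.
Proof.
move=> fl cb; have : `|c - f m| @[m --> \oo] --> `|c - l|.
  by apply: cvg_norm; apply: cvgB => //; exact: cvg_cst.
move=> H; rewrite -(cvg_lim (@Rhausdorff R) H); apply: limr_le.
  by apply/cvg_ex; eexists; exact: H.
by exists n => //= m; exact: cb.
Qed.

(** A fourth root: [8^-1 * 8^-1] is at most [2^-1 ^+ 4], and C is at most [(C + 1) ^+ 4]. *)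
Lemma pow2_geometric (n : nat) (C x : R) : 0 <= C -> 0 <= x ->
  x ^+ 4 <= C * (8^-1 ^+ n.+1 * 8^-1 ^+ n.+1) -> x <= (C + 1) * 2^-1 ^+ n.
Proof.
move=> C0 x0 h; rewrite -(@ler_pXn2r _ 4) ?nnegrE ?mulr_ge0 ?addr_ge0 ?exprn_ge0//.
apply: (le_trans h); rewrite exprMn -(exprMn_comm _ (mulrC _ _)).
rewrite [(2^-1 ^+ n) ^+ 4](_ : _ = (2^-1 ^+ 4) ^+ n); last by rewrite -!exprM mulnC.
have H : (8^-1 * 8^-1 : R) ^+ n.+1 <= (2^-1 ^+ 4) ^+ n.
  rewrite exprS; apply: (@le_trans _ _ ((8^-1 * 8^-1) ^+ n)).
    by rewrite ler_piMl ?exprn_ge0 ?mulr_ge0// -invfM invf_le1 // ?mulr_gt0//; lra.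
  rewrite lerXn2r ?nnegrE ?mulr_ge0 ?exprn_ge0//.
  rewrite (_ : 2^-1 ^+ 4 = 4 * (8^-1 * 8^-1)); last by field.
  by rewrite ler_peMl ?mulr_ge0// ler1n.
apply: (@le_trans _ _ (C * (2^-1 ^+ 4) ^+ n)); first by rewrite ler_wpM2l.
rewrite ler_wpM2r ?exprn_ge0//.
have : 1 <= C + 1 by lra.
move=> h1; apply: (@le_trans _ _ (C + 1)); first lra.
by rewrite ler_eXnr.
Qed.

End GeometricCauchy.

Section H1Complete.
Context {R : realType} {G : metricGraph R}.
Local Notation mu := (gmeasure G).
Local Notation X := (gpoint G -> Rcomplex R).
Local Notation Re := complex.Re.
Local Notation Im := complex.Im.
Implicit Types (u v w g : X) (e : edge G) (x y : R) (p : gpoint G).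

Definition h1 u v : R := ip u v + dip u v.

Lemma Re_sqr_le_ip u : sq u -> \int[mu]_p (Re (u p) ^+ 2) <= ip u u.
Proof.
move=> su; apply: le_Rintegral => //; first by case: su => -[].
  exact: ip_integrable.
by move=> p _; rewrite -!expr2 lerDl sqr_ge0.
Qed.

Lemma Im_sqr_le_ip u : sq u -> \int[mu]_p (Im (u p) ^+ 2) <= ip u u.
Proof.
move=> su; apply: le_Rintegral => //; first by case: su => _ [].
  exact: ip_integrable.
by move=> p _; rewrite -!expr2 lerDr sqr_ge0.
Qed.

Lemma ip_sqrE u : sq u ->
  ip u u = \int[mu]_p (Re (u p) ^+ 2) + \int[mu]_p (Im (u p) ^+ 2).
Proof.
move=> [[mr ir] [mi ii]]; by rewrite -RintegralD.
Qed.

Lemma sq_complete (U : nat -> X) : (forall n, sq (U n)) ->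
  (forall n m, (n <= m)%N -> ip (U n - U m) (U n - U m) <= 8^-1 ^+ n.+1) ->
  exists g, sq g /\ forall n, ip (U n - g) (U n - g) <= 2 * 8^-1 ^+ n.+1.
Proof.
move=> sU UC; have ss := sq_subspace (G := G).
have sB n m : sq (U n - U m) by exact: lin_subspaceB.
have [||gr [sgr bgr _]] := @sqint_complete _ _ _ mu (fun n p => Re (U n p)).
- by move=> n; case: (sU n).
- move=> n m nm; apply: le_trans (UC n m nm); apply: le_trans (Re_sqr_le_ip (sB n m)).
  by rewrite le_eqVlt; apply/orP; left; apply/eqP; apply: eq_Rintegral => p _; rewrite -raddfB.
have [||gi [sgi bgi _]] := @sqint_complete _ _ _ mu (fun n p => Im (U n p)).
- by move=> n; case: (sU n).
- move=> n m nm; apply: le_trans (UC n m nm); apply: le_trans (Im_sqr_le_ip (sB n m)).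
  by rewrite le_eqVlt; apply/orP; left; apply/eqP; apply: eq_Rintegral => p _; rewrite -raddfB.
pose g : X := fun p => (gr p +i* gi p)%C.
have sg : sq g by [].
exists g; split => // n.
rewrite ip_sqrE; last exact: lin_subspaceB.
rewrite mulr2n mulrDl mul1r; apply: lerD.
  apply: le_trans (bgr n); rewrite le_eqVlt; apply/orP; left; apply/eqP.
  by apply: eq_Rintegral => p _; congr (_ ^+ 2); exact: raddfB.
apply: le_trans (bgi n); rewrite le_eqVlt; apply/orP; left; apply/eqP.
by apply: eq_Rintegral => p _; congr (_ ^+ 2); exact: raddfB.
Qed.

(** By the sup bound the sequence is uniformly Cauchy, so its pointwise limit is continuous. Fatou's
    lemma gives the L^2 estimate, and the L^2 limit of the derivatives is the weak derivative of the
    limit, as weak differentiation is closed. *)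
Lemma H1_complete (U : nat -> X) : connected [set: gpoint G] -> countable [set: edge G] ->
  (forall n, H1 (U n)) ->
  (forall n m, (n <= m)%N -> h1 (U n - U m) (U n - U m) <= 8^-1 ^+ n.+1) ->
  exists u, H1 u /\ forall n, h1 (U n - u) (U n - u) <= 4 * 8^-1 ^+ n.+1.
Proof.
move=> conn cnt hU UC; have ss := sq_subspace (G := G); have hs := H1_subspace (G := G).
have hB n m : H1 (U n - U m) by exact: lin_subspaceB.
have r0 n : 0 <= 8^-1 ^+ n.+1 :> R by rewrite exprn_ge0.
have UCi n m : (n <= m)%N -> ip (U n - U m) (U n - U m) <= 8^-1 ^+ n.+1.
  by move=> /UC; apply: le_trans; rewrite lerDl ip_ge0.
have UCd n m : (n <= m)%N -> dip (U n - U m) (U n - U m) <= 8^-1 ^+ n.+1.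
  by move=> /UC; apply: le_trans; rewrite lerDr ip_ge0.
have [C C0 HC] := H1_sup conn cnt.
have unif n m p : (n <= m)%N -> normc (U n p - U m p) <= (2 * C + 1) * 2^-1 ^+ n.
  move=> nm; apply: pow2_geometric; [by rewrite mulr_ge0// ltW|exact: normc_ge0|].
  apply: (le_trans (HC (U n - U m) p (hB n m))).
  rewrite (mulrC 2) -mulrA ler_wpM2l ?(ltW C0)// mulrA (mulrC 2) -mulrA.
  apply: ler_pM; [exact: ip_ge0|by rewrite addr_ge0 ?ip_ge0|exact: UCi|].
  by have := UCi n m nm; have := UCd n m nm; rewrite /dip; lra.
have C1 : 0 <= 2 * C + 1 by rewrite addr_ge0// mulr_ge0// ltW.
have cR p : cvgn (fun n => Re (U n p)).
  apply: (geometric_cvg C1) => n; rewrite -raddfB (le_trans (Re_le_normc _))//.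
  by rewrite normc_distC unif.
have cI p : cvgn (fun n => Im (U n p)).
  apply: (geometric_cvg C1) => n; rewrite -raddfB (le_trans (Im_le_normc _))//.
  by rewrite normc_distC unif.
pose u : X := fun p => (limn (fun n => Re (U n p)) +i* limn (fun n => Im (U n p)))%C.
have unif_u n p : normc (U n p - u p) <= 2 * (2 * C + 1) * 2^-1 ^+ n.
  apply: (le_trans (normc_le_ReIm _)); rewrite !raddfB -mulrA mulr2n mulrDl mul1r.
  apply: lerD.
    apply: (lim_dist_le (n := n) (cR p)) => m nm; rewrite -raddfB.
    exact: le_trans (Re_le_normc _) (unif n m p nm).
  apply: (lim_dist_le (n := n) (cI p)) => m nm; rewrite -raddfB.
  exact: le_trans (Im_le_normc _) (unif n m p nm).
have cu : continuous (u : gpoint G -> R[i]^o).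
  apply/gcontinuousP => p eps eps0.
  have [n hn] : exists n, 2 * (2 * C + 1) * 2^-1 ^+ n < eps / 4.
    have : (2 * (2 * C + 1)) * 2^-1 ^+ n @[n --> \oo] --> (2 * (2 * C + 1)) * 0.
      apply: cvgM; first exact: cvg_cst.
      by apply: cvg_expr; rewrite ger0_norm// invf_lt1// ltr1n.
    rewrite mulr0 => /cvgr_lt /(_ (eps / 4)); rewrite divr_gt0// => /(_ isT).
    by move=> [n _ /(_ n (leqnn n))]; exists n.
  have /H1E[/gcontinuousP cUn _ _ _] := hU n.
  have := cUn p (eps / 2); rewrite divr_gt0// => /(_ isT).
  apply: (@filterS _ _ (nbhs_filter p)) => p' h.
  have E (a b c d : R[i]) : c - d = (a - b) - (a - c) + (b - d) by ring.
  rewrite (E (U n p) (U n p') (u p) (u p')).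
  rewrite (le_lt_trans (le_normcD _ _))//.
  have h1' := le_normcD (U n p - U n p') (- (U n p - u p)).
  rewrite normcN in h1'.
  by have := unif_u n p; have := unif_u n p'; lra.
have meas (pr : R[i] -> R) : (forall n, measurable_fun setT (fun p => pr (U n p))) ->
    (forall p, pr (U n p) @[n --> \oo] --> pr (u p)) -> measurable_fun setT (fun p => pr (u p)).
  move=> mU cU; apply/measurable_EFinP.
  apply: (emeasurable_fun_cvg (fun n p => (pr (U n p))%:E)).
    by move=> n; exact/measurable_EFinP.
  by move=> p _; apply: cvg_EFin; [exact: nearW|exact: cU].
have sU n := H1_sq (hU n).
have mRu : measurable_fun setT (fun p => Re (u p)).
  by apply: meas => [n|p]; [case: (sU n) => -[]|exact: cR].
have mIu : measurable_fun setT (fun p => Im (u p)).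
  by apply: meas => [n|p]; [case: (sU n) => _ []|exact: cI].
have sB n m : sq (U n - U m) by exact: H1_sq.
have FR n : sqint mu (fun p => Re (U n p) - Re (u p)) /\
    \int[mu]_p ((Re (U n p) - Re (u p)) ^+ 2) <= 8^-1 ^+ n.+1.
  apply: (@sqint_Fatou _ _ _ _ (fun m p => Re (U m p))) => //.
  - by move=> m; case: (sU m).
  - by case: (sU n).
  - by apply: aeW => p; exact: cR.
  - exists n => // m /= nm; apply: le_trans (UCi n m nm).
    apply: le_trans (Re_sqr_le_ip (sB n m)); rewrite le_eqVlt; apply/orP; left; apply/eqP.
    by apply: eq_Rintegral => p _; rewrite -raddfB.
have FI n : sqint mu (fun p => Im (U n p) - Im (u p)) /\
    \int[mu]_p ((Im (U n p) - Im (u p)) ^+ 2) <= 8^-1 ^+ n.+1.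
  apply: (@sqint_Fatou _ _ _ _ (fun m p => Im (U m p))) => //.
  - by move=> m; case: (sU m).
  - by case: (sU n).
  - by apply: aeW => p; exact: cI.
  - exists n => // m /= nm; apply: le_trans (UCi n m nm).
    apply: le_trans (Im_sqr_le_ip (sB n m)); rewrite le_eqVlt; apply/orP; left; apply/eqP.
    by apply: eq_Rintegral => p _; rewrite -raddfB.
have sUu n : sq (U n - u).
  split; first by under eq_fun do rewrite raddfB; exact: (FR n).1.
  by under eq_fun do rewrite raddfB; exact: (FI n).1.
have su : sq u by rewrite -(subKr (U 0%N) u); exact: lin_subspaceB.
have bu n : ip (U n - u) (U n - u) <= 2 * 8^-1 ^+ n.+1.
  rewrite ip_sqrE// mulr2n mulrDl mul1r; apply: lerD.
    by apply: le_trans (FR n).2; rewrite le_eqVlt; apply/orP; left; apply/eqP;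
       apply: eq_Rintegral => p _; rewrite -raddfB.
  by apply: le_trans (FI n).2; rewrite le_eqVlt; apply/orP; left; apply/eqP;
       apply: eq_Rintegral => p _; rewrite -raddfB.
have [||g [sg bg]] := @sq_complete (fun n => wderiv (U n)).
- by move=> n; exact: H1_sqd.
- by move=> n m nm; rewrite -dip_sqrB//; exact: UCd.
have to0 (F : nat -> X) (f : X) : (forall n, ip (F n - f) (F n - f) <= 2 * 8^-1 ^+ n.+1) ->
    ip (F n - f) (F n - f) @[n --> \oo] --> 0.
  move=> Ff; apply: (@squeeze_cvgr _ _ _ _ (cst 0) (fun n => (2 * 8^-1) * 8^-1 ^+ n)).
  - by apply: nearW => n; rewrite ip_ge0/= -mulrA -exprS; exact: Ff.
  - exact: cvg_cst.
  - rewrite -[X in _ --> X](mulr0 (2 * 8^-1)); apply: cvgM; first exact: cvg_cst.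
    by apply: cvg_expr; rewrite ger0_norm// invf_lt1// ltr1n.
have wug : weak_derivative u g.
  apply: (weak_derivative_limit cu su sg (U := U) (D := fun n => wderiv (U n)) _ sU).
  - by move=> k; have /H1E[] := hU k.
  - by move=> k; exact: H1_sqd.
  - by move=> k; have /H1E[] := hU k.
  - exact: to0.
  - exact: (to0 (fun n => wderiv (U n))).
have hu : H1 u by split; [|exact/Lp2P|exists g => //; exact/Lp2P].
exists u; split => // n.
have -> : (4 : R) = 2 + 2 by ring.
rewrite mulrDl; apply: lerD; first exact: bu.
rewrite dip_sqrB//; apply: le_trans (bg n).
have /H1E[_ _ wd swd] := hu.
have ae := weak_derivative_unique cu wd wug.
rewrite le_eqVlt; apply/orP; left; apply/eqP.
have sd := H1_sqd (hU n).
have sq1 : sq ((wderiv (U n) : X) - (wderiv u : X)) by exact: (lin_subspaceB ss sd swd).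
have sq2 : sq ((wderiv (U n) : X) - g) by exact: (lin_subspaceB ss sd sg).
have aeB : {ae mu, forall p, ((wderiv (U n) : X) - (wderiv u : X)) p = ((wderiv (U n) : X) - g) p}.
  by apply: filterS ae => p h; rewrite /GRing.add /= /GRing.opp /= h.
exact: (sq_ae_ip sq1 sq2 sq1 sq2 aeB aeB).
Qed.

End H1Complete.

(** * Resolvents and spectral gap of forms *)

(** Choose [s k >= k] in the sets that belong to the accuracies 0 to k; for n <= m both [s n] and
    [s m] lie in the n-th one. *)
Lemma proper_filter_subseq {R : realType} (F : set_system nat) (q : nat -> nat -> R) :
  ProperFilter F -> (forall N, F [set n | (N <= n)%N]) ->
  (forall e, 0 < e -> exists2 A, F A & forall n m, A n -> A m -> q n m <= e) ->
  exists s : nat -> nat, (forall n, (n <= s n)%N) /\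
    forall n m, (n <= m)%N -> q (s n) (s m) <= 8^-1 ^+ n.+1.
Proof.
move=> FF Foo H.
have /choice[A hA] : forall k, exists A, F A /\ forall n m, A n -> A m ->
    q n m <= 8^-1 ^+ k.+1.
  by move=> k; have [|A FA hA] := H (8^-1 ^+ k.+1); [rewrite exprn_gt0|exists A].
have /choice[s hs] : forall k, exists n, (k <= n)%N /\ forall j, (j <= k)%N -> A j n.
  move=> k; have : F [set n | (k <= n)%N /\ forall j, (j <= k)%N -> A j n].
    apply: filterI; first exact: Foo.
    elim: k => [|k IH].
      by apply: filterS (hA 0%N).1 => n An j; rewrite leqn0 => /eqP->.
    apply: filterS2 IH (hA k.+1).1 => n h1 h2 j; rewrite leq_eqVlt => /predU1P[->//|].
    by rewrite ltnS; exact: h1.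
  by move=> /filter_ex[n hn]; exists n.
exists s; split => [n|n m nm]; first exact: (hs n).1.
by apply: (hA n).2; [exact: (hs n).2|exact: (hs m).2].
Qed.

Lemma cauchy_subseq {R : realType} (q : nat -> nat -> R) :
  (forall e, 0 < e -> exists N, forall n m, (N <= n)%N -> (N <= m)%N -> q n m <= e) ->
  exists s : nat -> nat, (forall n, (n <= s n)%N) /\
    forall n m, (n <= m)%N -> q (s n) (s m) <= 8^-1 ^+ n.+1.
Proof.
move=> H; apply: (@proper_filter_subseq R \oo q _) => [N|e e0]; first by exists N.
have [N hN] := H e e0; exists [set n | (N <= n)%N]; first by exists N.
by move=> n m; exact: hN.
Qed.

Section AbstractForms.
Context {R : realType} {X : lmodType R}.
Variables (H : set X) (ip : X -> X -> R).
Hypotheses (sH : lin_subspace H) (sip : sym_form H ip) (ip_ge0 : forall u, H u -> 0 <= ip u u).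

(* If [p h = ip f] has a solution bounded by [C * f], then [f]^2 = p(h,f), and
   the Cauchy-Schwarz inequality for [p] bounds [f] by [p f f]. *)
Lemma CS_inversion (Y : set X) (p : X -> X -> R) (C : R) : lin_subspace Y -> Y `<=` H ->
  sym_form Y p -> (forall u, Y u -> 0 <= p u u) -> 0 < C ->
  (forall f, Y f -> exists h, [/\ Y h, forall v, Y v -> p h v = ip f v &
     ip h h <= C ^+ 2 * ip f f]) ->
  forall f, Y f -> ip f f <= C * p f f.
Proof.
move=> sY YH sp p0 C0 inv f Yf; have [h [Yh hE hC]] := inv f Yf.
have Hf := YH _ Yf; have Hh := YH _ Yh.
have f0 := ip_ge0 Hf; have pf0 := p0 _ Yf.
have cs1 := sf_CS sY sp p0 Yh Yf; rewrite !hE// in cs1.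
have cs2 := sf_CS sH sip ip_ge0 Hf Hh.
have fh : ip f h <= C * ip f f.
  rewrite (le_trans (ler_norm _))//.
  rewrite -(@ler_pXn2r _ 2) ?nnegrE ?mulr_ge0 ?(ltW C0)// real_normK ?num_real//.
  apply: (le_trans cs2).
  rewrite (_ : (C * _) ^+ 2 = ip f f * (C ^+ 2 * ip f f)); last by ring.
  by rewrite ler_wpM2l.
have : ip f f ^+ 2 <= C * ip f f * p f f.
  by apply: (le_trans cs1); rewrite ler_wpM2r.
move: f0; rewrite le_eqVlt => /predU1P[<- _|f0]; first by rewrite mulr_ge0// ltW.
by rewrite (_ : C * _ * _ = ip f f * (C * p f f)) 1?expr2 ?ler_pM2l//; ring.
Qed.

(** Weak solvability of (b - z) h = f with a bounded solution; [C] is squared because [ip h h] is a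
    squared norm. Uniqueness is recovered from symmetry in [solves_unique]. *)
Definition resolvent_at (D : set X) (b : X -> X -> R) (z : R) := exists2 C : R, 0 < C &
  forall f, H f -> exists h, [/\ D h, forall v, D v -> b h v = ip (f + z *: h) v &
     ip h h <= C ^+ 2 * ip f f].

Lemma form_shift (D : set X) (b : X -> X -> R) (m : R) : D `<=` H -> sym_form D b ->
  sym_form D (fun u v => b u v - m * ip u v).
Proof.
move=> DH sb; split=> [u v Du Dv|c u v w Du Dv Dw].
  by rewrite sb.1// sip.1//; exact: DH.
by rewrite sb.2// sip.2 //; try exact: DH; ring.
Qed.

(** At a resolvent point [m], [CS_inversion] applies to the nonnegative form [b - m * ip] and bounds
    it below by [C^-1 * ip]. Hence the largest lower bound of a form is never a resolvent point. *)
Lemma bottom_resolvent (D : set X) (b : X -> X -> R) (m : R) : lin_subspace D -> D `<=` H ->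
  sym_form D b -> (forall u, D u -> m * ip u u <= b u u) -> resolvent_at D b m ->
  exists2 d : R, 0 < d & forall u, D u -> (m + d) * ip u u <= b u u.
Proof.
move=> sD DH sb bm [C C0 res].
have H0 := @CS_inversion D (fun u v => b u v - m * ip u v) C sD DH (form_shift m DH sb) _ C0.
exists C^-1; first by rewrite invr_gt0.
move=> u Du; rewrite mulrDl addrC -lerBrDr ler_pdivrMl//.
apply: H0 => // [v Dv|f Df]; first by rewrite subr_ge0 bm.
have [h [Dh hE hC]] := res f (DH _ Df); exists h; split => // v Dv.
have [Hf Hh Hv] := And3 (DH _ Df) (DH _ Dh) (DH _ Dv).
by rewrite hE// (sf_Dl sip)// ?(sf_Zl sH sip)// ?addrK//; exact: lin_subspaceZ.
Qed.

Section Gap.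
Variables (D : set X) (b : X -> X -> R) (z : R).
Hypotheses (sD : lin_subspace D) (DH : D `<=` H) (sb : sym_form D b).
Hypothesis b_ge0 : forall u, D u -> 0 <= b u u.
Hypothesis z0 : 0 < z.
Hypothesis res : forall w, 0 < w -> w < 2 * z -> resolvent_at D b w.
Hypothesis complete : forall U : nat -> X, (forall n, H (U n)) ->
  (forall n m, (n <= m)%N -> ip (U n - U m) (U n - U m) <= 8^-1 ^+ n.+1) ->
  exists g, H g /\ forall n, ip (U n - g) (U n - g) <= 2 * 8^-1 ^+ n.+1.

Definition solves (w : R) (f h : X) := D h /\ forall v, D v -> b h v = ip (f + w *: h) v.

(** The resolvent is symmetric: test each of the two equations with the solution of the other. *)
Lemma solves_sym w f g h k : H f -> H g -> solves w f h -> solves w g k ->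
  ip h g = ip f k.
Proof.
move=> Hf Hg [Dh hE] [Dk kE].
have [Hh Hk] := (DH Dh, DH Dk).
have Hwh : H (w *: h) by exact: lin_subspaceZ.
have Hwk : H (w *: k) by exact: lin_subspaceZ.
have E1 := hE _ Dk; have E2 := kE _ Dh.
rewrite (sf_Dl sip)// (sf_Zl sH sip)// in E1.
rewrite (sf_Dl sip)// (sf_Zl sH sip)// in E2.
have E3 : b h k = b k h by exact: sb.1.
have E4 : ip h k = ip k h by exact: sip.1.
have E5 : ip h g = ip g h by exact: sip.1.
by move: E1; rewrite E3 E2 E4 E5 => /addIr.
Qed.

(** Both sides equal [ip f k], with [k] a solution for the right-hand side [v]. As [ip] may be
    degenerate, uniqueness is a statement about pairings. *)
Lemma solves_unique w f h h' v : 0 < w -> w < 2 * z -> H f -> H v ->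
  solves w f h -> solves w f h' -> ip h v = ip h' v.
Proof.
move=> w0 wz Hf Hv sh sh'; have [C _ /(_ v Hv)[k [Dk kE _]]] := res w0 wz.
have sk : solves w v k by [].
by rewrite (solves_sym Hf Hv sh sk) (solves_sym Hf Hv sh' sk).
Qed.

Lemma solves_exists w : 0 < w -> w < 2 * z -> exists2 S : X -> X,
  forall f, H f -> solves w f (S f) &
  exists2 C : R, 0 < C & forall f, H f -> ip (S f) (S f) <= C ^+ 2 * ip f f.
Proof.
move=> w0 wz; have [C C0 hC] := res w0 wz.
have /choice[S hS] : forall f, exists h, H f -> solves w f h /\ ip h h <= C ^+ 2 * ip f f.
  move=> f; case: (pselect (H f)) => Hf; last by exists 0.
  by have [h [Dh hE hb]] := hC f Hf; exists h.
by exists S => [f Hf|]; [exact: (hS f Hf).1|exists C => // f Hf; exact: (hS f Hf).2].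
Qed.

Let HZ c f : H f -> H (c *: f).
Proof. exact: lin_subspaceZ. Qed.
Let HD f g : H f -> H g -> H (f + g).
Proof. exact: lin_subspaceD. Qed.
Let HB f g : H f -> H g -> H (f - g).
Proof. exact: lin_subspaceB. Qed.

(* On [0, 2z[ the only possible spectrum is {0}, so |R_z| <= 1/z: otherwise
   1/|R_z|^2 - R_z^2 would be invertible. *)
Lemma resolvent_bound (S : X -> X) : (forall f, H f -> solves z f (S f)) ->
  forall f, H f -> z ^+ 2 * ip (S f) (S f) <= ip f f.
Proof.
move=> SP; have z0' := z0; have z2 : z < 2 * z by lra.
have HS f : H f -> H (S f) by move=> Hf; apply: DH; case: (SP f Hf).
have Ssym f g : H f -> H g -> ip (S f) g = ip f (S g).
  by move=> Hf Hg; exact: solves_sym (SP f Hf) (SP g Hg).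
(* The infimum of these constants is the squared operator norm of [S]. *)
pose K : set R := [set k | 0 <= k /\ forall f, H f -> ip (S f) (S f) <= k * ip f f].
have [S' S'P [C C0 S'C]] := solves_exists z0 z2.
have KC : K (C ^+ 2).
  split; first exact: sqr_ge0.
  move=> f Hf; apply: le_trans (S'C f Hf).
  have HS'f : H (S' f) by apply: DH; case: (S'P f Hf).
  have E v : H v -> ip (S f) v = ip (S' f) v.
    by move=> Hv; exact: (solves_unique z0 z2 Hf Hv (SP f Hf) (S'P f Hf)).
  have HSf := HS _ Hf.
  by rewrite (E _ HSf) (sip.1 _ _ HS'f HSf) (E _ HS'f).
have K0 : lbound K 0 by move=> k [].
pose k := inf K.
have kK : K k.
  split; first by apply: lb_le_inf => //; exists (C ^+ 2).
  move=> f Hf; have := ip_ge0 Hf; rewrite le_eqVlt => /predU1P[f0|f0].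
    by rewrite -f0 mulr0; have := KC.2 f Hf; rewrite -f0 mulr0.
  rewrite -ler_pdivrMr//; apply: lb_le_inf; first by exists (C ^+ 2).
  by move=> k' [_ /(_ f Hf)]; rewrite ler_pdivrMr.
have [k0 kP] := kK.
suff kz : k <= (z ^+ 2)^-1.
  move=> f Hf; rewrite -ler_pdivlMl ?exprn_gt0//.
  by apply: (le_trans (kP f Hf)); rewrite ler_wpM2r ?ip_ge0.
rewrite leNgt; apply/negP => zk.
have kpos : 0 < k by apply: le_lt_trans zk; rewrite invr_ge0 sqr_ge0.
(* The reciprocal of the norm. If the claim fails then [r < z], so that [z - r] and [z + r] both lie
   in ]0, 2z[. *)
pose r := (Num.sqrt k)^-1.
have r0 : 0 < r by rewrite invr_gt0 sqrtr_gt0.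
have r2 : k * r ^+ 2 = 1 by rewrite exprVn sqr_sqrtr// mulfV// gt_eqF.
have rz : r < z.
  rewrite -(@ltr_pXn2r _ 2) ?nnegrE ?(ltW r0) ?(ltW z0)//.
  have -> : r ^+ 2 = k^-1 by rewrite exprVn sqr_sqrtr.
  by rewrite -[ltRHS]invrK ltf_pV2// posrE ?invr_gt0 exprn_gt0.
(* The form of k - S^2 = k (1 + r S) (1 - r S). *)
pose p f g := k * ip f g - ip (S f) (S g).
have Slin c f g v : H f -> H g -> H v -> ip (S (c *: f + g)) v = c * ip (S f) v + ip (S g) v.
  move=> Hf Hg Hv; have Hfg := sH.2 c _ _ Hf Hg.
  by rewrite !Ssym// sip.2//; exact: HS.
have sp : sym_form H p.
  split=> [f g Hf Hg|c f g v Hf Hg Hv].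
    by rewrite /p (sip.1 f g)// (sip.1 (S f) (S g))//; exact: HS.
  by rewrite /p sip.2// Slin//; [ring|exact: HS].
have p0 f : H f -> 0 <= p f f by move=> Hf; rewrite /p subr_ge0 kP.
have [w1 w1'] : 0 < z - r /\ z - r < 2 * z by split; lra.
have [w2 w2'] : 0 < z + r /\ z + r < 2 * z by split; lra.
have [S1 S1P [C1 C10 S1C]] := solves_exists w1 w1'.
have [S2 S2P [C2 C20 S2C]] := solves_exists w2 w2'.
have HS1 f : H f -> H (S1 f) by move=> Hf; apply: DH; case: (S1P f Hf).
have HS2 f : H f -> H (S2 f) by move=> Hf; apply: DH; case: (S2P f Hf).
(* Resolvent identities: S (1 - r S1) = S1 and, below, S (1 + r S2) = S2. Hence 1 - r S1 inverts 1 +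
   r S, and 1 + r S2 inverts 1 - r S. *)
have E1 f v : H f -> H v -> ip (S (f - r *: S1 f)) v = ip (S1 f) v.
  move=> Hf Hv; have H1 : H (f - r *: S1 f) by apply: HB => //; apply: HZ; exact: HS1.
  apply: (solves_unique z0 z2 H1 Hv (SP _ H1)).
  have [D1 b1] := S1P f Hf; split => // w Dw; rewrite b1//; congr (ip _ w).
  by rewrite scalerBl [_ - r *: _]addrC addrA.
have E2 f v : H f -> H v -> ip (S (f + r *: S2 f)) v = ip (S2 f) v.
  move=> Hf Hv; have H1 : H (f + r *: S2 f) by apply: HD => //; apply: HZ; exact: HS2.
  apply: (solves_unique z0 z2 H1 Hv (SP _ H1)).
  have [D1 b1] := S2P f Hf; split => // w Dw; rewrite b1//; congr (ip _ w).
  by rewrite scalerDl -addrA; congr (_ + _); rewrite addrC.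
have HS1f f : H f -> H (f - r *: S1 f) by move=> Hf; apply: HB => //; apply: HZ; exact: HS1.
have HS2f f : H f -> H (f + r *: S2 f) by move=> Hf; apply: HD => //; apply: HZ; exact: HS2.
(* [B] bounds the squared norm of the solution [r ^+ 2 *: w]; as [CS_inversion] squares its
   constant, [1 + B] serves there. *)
pose B := (r ^+ 2) ^+ 2 * ((2 + 2 * (r ^+ 2 * C2 ^+ 2)) * (2 + 2 * (r ^+ 2 * C1 ^+ 2))).
have B0 : 0 <= B by rewrite /B !(mulr_ge0, addr_ge0, exprn_ge0)// ltW.
have C0' : 0 < 1 + B by rewrite ltr_pwDl.
have inv f : H f -> ip f f <= (1 + B) * p f f.
  apply: (CS_inversion sH (@subset_refl _ H) sp p0 C0') => {}f Hf.
  pose g := f - r *: S1 f; have Hg : H g by exact: HS1f.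
  pose w := g + r *: S2 g; have Hw : H w by exact: HS2f.
  have HSg : H (S2 g) by exact: HS2.
  have HSf : H (S1 f) by exact: HS1.
  exists (r ^+ 2 *: w); split; first exact: HZ.
    move=> v Hv; have HSv := HS _ Hv; have HSw := HS _ Hw.
    have -> : ip f v = ip g v + r * ip (S1 f) v.
      rewrite -(sf_Zl sH sip)// -(sf_Dl sip)//; last exact: HZ.
      by rewrite /g subrK.
    have := sp.2 (r ^+ 2) w 0 v Hw sH.1 Hv; rewrite addr0 => ->.
    rewrite (sf_0l sH sp)// addr0 /p mulrBr mulrA (mulrC _ k) r2 mul1r.
    have -> : ip w v = ip g v + r * ip (S w) v.
      by rewrite E2// -(sf_Zl sH sip)// -(sf_Dl sip)//; exact: HZ.
    rewrite -(E1 f v)// -/g.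
    have -> : ip (S w) v = ip g (S v) + r * ip (S w) (S v).
      rewrite (Ssym w)// E2// -(sf_Zl sH sip)// -(sf_Dl sip)//; exact: HZ.
    by rewrite (Ssym g)//; ring.
  rewrite (sf_Zl sH sip)// ?(sf_Zr sH sip)//; try exact: HZ.
  have bg : ip g g <= (2 + 2 * (r ^+ 2 * C1 ^+ 2)) * ip f f.
    have HZf : H (- r *: S1 f) by exact: HZ.
    rewrite /g -scaleNr; apply: (le_trans (sf_sqrD_le sH sip ip_ge0 Hf HZf)).
    rewrite (sf_Zl sH sip)// (sf_Zr sH sip)//.
    have := ler_wpM2l (sqr_ge0 r) (S1C _ Hf); nra.
  have bw : ip w w <= (2 + 2 * (r ^+ 2 * C2 ^+ 2)) * ip g g.
    have HZf : H (r *: S2 g) by exact: HZ.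
    rewrite /w; apply: (le_trans (sf_sqrD_le sH sip ip_ge0 Hg HZf)).
    rewrite (sf_Zl sH sip)// (sf_Zr sH sip)//.
    have := ler_wpM2l (sqr_ge0 r) (S2C _ Hg); nra.
  have bb : ip w w <= (2 + 2 * (r ^+ 2 * C2 ^+ 2)) * ((2 + 2 * (r ^+ 2 * C1 ^+ 2)) * ip f f).
    apply: (le_trans bw); rewrite ler_wpM2l//.
    by rewrite !(mulr_ge0, addr_ge0, exprn_ge0)// ltW.
  apply: (@le_trans _ _ (B * ip f f)).
    rewrite mulrA -expr2 [leRHS](_ : _ = (r ^+ 2) ^+ 2 * ((2 + 2 * (r ^+ 2 * C2 ^+ 2)) *
      ((2 + 2 * (r ^+ 2 * C1 ^+ 2)) * ip f f))); last by rewrite /B; ring.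
    by rewrite ler_wpM2l// sqr_ge0.
  rewrite ler_wpM2r ?ip_ge0//; have := sqr_ge0 B; nra.
(* By [inv] the constant [k] can be lowered, against its minimality; the maximum with 0 keeps the
   new constant in [K]. *)
have : k <= Num.max 0 (k - (1 + B)^-1).
  apply: ge_inf; first by exists 0 => ? [].
  split; first by rewrite le_max lexx.
  move=> f Hf; apply: (@le_trans _ _ ((k - (1 + B)^-1) * ip f f)).
    have := inv f Hf; rewrite /p -ler_pdivrMl//; lra.
  by rewrite ler_wpM2r ?ip_ge0// le_max lexx orbT.
by have := C0'; rewrite -invr_gt0 => ?; rewrite le_max => /orP[]; lra.
Qed.

End Gap.
End AbstractForms.

Lemma geometric_le0 {R : realType} (r K : R) :
  (forall n, r <= K * 8^-1 ^+ n.+1) -> r <= 0.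
Proof.
move=> rK; have K0 : (fun n => (K * 8^-1) * 8^-1 ^+ n : R) @ \oo --> (0 : R).
  by apply: cvg_geometric; rewrite ger0_norm ?invf_lt1 ?ltr1n// invr_ge0.
rewrite -(cvg_lim (@Rhausdorff R) K0); apply: limr_ge; first by apply/cvg_ex; exists 0.
by near=> n; rewrite -mulrA -exprS.
Unshelve. all: end_near. Qed.

Lemma nonincreasing_cauchy {R : realType} (c : nat -> R) :
  (forall n, c n.+1 <= c n) -> (forall n, 0 <= c n) ->
  forall e, 0 < e -> exists N, forall n m, (N <= n)%N -> (N <= m)%N -> c n - c m <= e.
Proof.
move=> cd c0 e e0.
have cdn : nonincreasing_seq c by apply/nonincreasing_seqP.
have hl : has_inf (range c).
  by split; [exists (c 0%N), 0%N|exists 0 => _ [n _ <-]].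
have [_ [N _ <-] hN] := inf_adherent e0 hl.
exists N => n m Nn Nm; have h1 := cdn _ _ Nn.
have : inf (range c) <= c m by apply: ge_inf; [exact: hl.2|exists m].
lra.
Qed.

Section Gap.
Context {R : realType} {X : lmodType R}.
Variables (H : set X) (ip : X -> X -> R).
Hypotheses (sH : lin_subspace H) (sip : sym_form H ip) (ip_ge0 : forall u, H u -> 0 <= ip u u).
Variables (D : set X) (b : X -> X -> R) (z : R).
Hypotheses (sD : lin_subspace D) (DH : D `<=` H) (sb : sym_form D b).
Hypothesis b_ge0 : forall u, D u -> 0 <= b u u.
Hypothesis z0 : 0 < z.
Hypothesis complete : forall U : nat -> X, (forall n, H (U n)) ->
  (forall n m, (n <= m)%N -> ip (U n - U m) (U n - U m) <= 8^-1 ^+ n.+1) ->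
  exists g, H g /\ forall n, ip (U n - g) (U n - g) <= 2 * 8^-1 ^+ n.+1.
Variable S : X -> X.
Hypothesis SP : forall f, H f -> solves ip D b z f (S f).
Hypothesis Sbound : forall f, H f -> z ^+ 2 * ip (S f) (S f) <= ip f f.

Let HZ c f : H f -> H (c *: f). Proof. exact: lin_subspaceZ. Qed.
Let HD f g : H f -> H g -> H (f + g). Proof. exact: lin_subspaceD. Qed.
Let HB f g : H f -> H g -> H (f - g). Proof. exact: lin_subspaceB. Qed.
Let DS f : H f -> D (S f). Proof. by move=> Hf; case: (SP Hf). Qed.
Let HS f : H f -> H (S f). Proof. by move=> Hf; apply: DH; exact: DS. Qed.
(** Formally the operator of [b] composed with its resolvent [S]; compare [bS]. *)
Let T f := f + z *: S f.
Let HT f : H f -> H (T f). Proof. by move=> Hf; apply: HD => //; apply: HZ; exact: HS. Qed.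
Let bS f v : H f -> D v -> b (S f) v = ip (T f) v.
Proof. by move=> Hf Dv; case: (SP Hf) => _; exact. Qed.

Let Ssym f g : H f -> H g -> ip (S f) g = ip f (S g).
Proof. by move=> Hf Hg; exact: (solves_sym sH sip DH sb Hf Hg (SP Hf) (SP Hg)). Qed.

Let TE f v : H f -> H v -> ip (T f) v = ip f v + z * ip (S f) v.
Proof.
move=> Hf Hv; have HSf := HS Hf.
by rewrite /T (sf_Dl sip)// ?(sf_Zl sH sip)//; exact: HZ.
Qed.

Let Tsym f g : H f -> H g -> ip (T f) g = ip f (T g).
Proof.
move=> Hf Hg; have HTg := HT Hg; have HSg := HS Hg.
by rewrite TE// (sip.1 f (T g))// TE// Ssym// (sip.1 g f)// (sip.1 (S g) f).
Qed.

Let TT f : H f -> ip (T f) (T f) = ip f f + 2 * z * ip (S f) f + z ^+ 2 * ip (S f) (S f).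
Proof.
move=> Hf; have HTf := HT Hf; have HSf := HS Hf.
rewrite TE// (sip.1 f (T f))// (sip.1 (S f) (T f))// !TE// (sip.1 f (S f))//.
by ring.
Qed.

(** The operator inequality T^2 <= 2 T, which is the bound |z S| <= 1 rewritten. *)
Let TT_le f : H f -> ip (T f) (T f) <= 2 * ip (T f) f.
Proof. by move=> Hf; rewrite TT// TE//; have := Sbound Hf; lra. Qed.

(** Cauchy-Schwarz for [b] between [S f] and [v], with 2 z b(S f, S f) <= |T f|^2, again from |z S|
    <= 1. The constant of the gap originates here. *)
Let T_CS f v : H f -> D v -> 2 * z * ip (T f) v ^+ 2 <= ip (T f) (T f) * b v v.
Proof.
move=> Hf Dv; have HSf := HS Hf; have Dw := DS Hf; rewrite -bS//.
apply: (@le_trans _ _ (2 * z * (b (S f) (S f) * b v v))).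
  by rewrite ler_pM2l ?mulr_gt0//; exact: (sf_CS sD sb b_ge0).
rewrite mulrA ler_wpM2r ?b_ge0// bS// TT// TE// (sip.1 f (S f))//.
by have := Sbound Hf; lra.
Qed.

(** At a spectral value t of [b] this is (t - 2z) / (2 (t - z)): it is 1 at t = 0 and lies in [0,
    1/2[ for t >= 2z, so the powers of [A] single out the kernel. *)
Let A f := f - 2^-1 *: T f.
Let HA f : H f -> H (A f). Proof. by move=> Hf; apply: HB => //; apply: HZ; exact: HT. Qed.
Let AE f v : H f -> H v -> ip (A f) v = ip f v - 2^-1 * ip (T f) v.
Proof.
move=> Hf Hv; have HTf := HT Hf.
by rewrite /A (sf_Bl sH sip)// ?(sf_Zl sH sip)//; exact: HZ.
Qed.
Let Asym f g : H f -> H g -> ip (A f) g = ip f (A g).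
Proof.
move=> Hf Hg; have HAg := HA Hg; have HTg := HT Hg.
by rewrite AE// (sip.1 f (A g))// AE// (sip.1 g f)// (Tsym Hf Hg) (sip.1 (T g) f).
Qed.

(* [A = (1 - z S) / 2] satisfies [0 <= A^(n+1) <= A^n], so [A^n u] converges; the
   limit is fixed by [A], hence lies in the kernel of [b] and vanishes.  Thus [u]
   is the limit of [u - A^n u], which is in the range of [T], where [T_CS] holds. *)
Lemma spectral_gap u : D u -> (forall n, D n -> (forall v, D v -> b n v = 0) -> ip n u = 0) ->
  2 * z * ip u u <= b u u.
Proof.
move=> Du orth; have Hu := DH Du.
pose x n := iter n A u.
have Hx n : H (x n) by elim: n => //= n IH; exact: HA.
pose c n := ip (x n) u.
have cE n m : ip (x n) (x m) = c (n + m)%N.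
  elim: m n => [|m IH] n; first by rewrite addn0.
  by rewrite /x -(Asym (Hx n) (Hx m)) -[A _]/(x n.+1) IH addnS addSn.
have T0 f : H f -> 0 <= ip (T f) f.
  by move=> Hf; have := TT_le Hf; have := ip_ge0 (HT Hf); lra.
have c0 n : 0 <= c n /\ c n.+1 <= c n.
  (* At even indices [c] is the squared norm of an iterate; odd indices are compared with their
     neighbours through [TT_le]. *)
  rewrite -(odd_double_half n); case: (odd n); rewrite /= ?add1n ?add0n; set k := n./2.
    have E1 : c k.*2.+2 = ip (x k.+1) (x k.+1) by rewrite cE addnS addSn addnn.
    have E2 : c k.*2.+1 = ip (x k.+1) (x k) by rewrite cE addSn addnn.
    have Hk := Hx k; have HTk := HT Hk; have HAk := HA Hk.
    suff cle : c k.*2.+2 <= c k.*2.+1.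
      by split => //; apply: le_trans cle; rewrite E1 ip_ge0.
    rewrite E1 E2 /= -/(x k) [leLHS]AE// (sip.1 (x k))// (sip.1 (T _) (A _))// !AE//.
    by rewrite (sip.1 (x k) (T _))//; have := TT_le Hk; lra.
  rewrite -addnn -cE; split; first exact: ip_ge0.
  have -> : c (k + k)%N.+1 = ip (x k.+1) (x k) by rewrite cE addSn.
  by rewrite /= -/(x k) AE//; have := T0 _ (Hx k); lra.
have cc := nonincreasing_cauchy (fun n => (c0 n).2) (fun n => (c0 n).1).
have dc n m : ip (x n - x m) (x n - x m) = c (n + n)%N - 2 * c (n + m)%N + c (m + m)%N.
  by rewrite (sf_sqrB sH sip)// !cE.
have [s [sn scau]] : exists s : nat -> nat, (forall n, (n <= s n)%N) /\
    forall n m, (n <= m)%N -> ip (x (s n) - x (s m)) (x (s n) - x (s m)) <= 8^-1 ^+ n.+1.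
  apply: (@cauchy_subseq _ (fun n m => ip (x n - x m) (x n - x m))) => e e0.
  have e2 : 0 < e / 2 by rewrite divr_gt0.
  have [N hN] := cc _ e2; exists N => n m Nn Nm.
  have h k l : (N <= k)%N -> (N <= k + l)%N by move=> /leq_trans; apply; rewrite leq_addr.
  have := hN (n + n)%N (n + m)%N (h _ _ Nn) (h _ _ Nn).
  have := hN (m + m)%N (n + m)%N (h _ _ Nm) (h _ _ Nn).
  by rewrite dc; lra.
have [e [He eP]] := complete (fun n => Hx (s n)) scau.
(* For x = [x (s k)] and N = [s k], |T x|^2 <= 2 <T x, x> = 4 (c(2N) - c(2N + 1)) tends to 0, and
   the symmetry of [T] handles the difference between x and [e]. *)
have Te f : H f -> ip (T e) f = 0.
  move=> Hf.
  have key n d : 0 < d -> exists2 k, (n <= k)%N & ip (T (x (s k))) (T (x (s k))) <= d.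
    move=> d0; have d4 : 0 < d / 4 by rewrite divr_gt0.
    have [N hN] := cc _ d4; pose k := maxn n N; exists k; first exact: leq_maxl.
    have Nk : (N <= s k)%N by apply: leq_trans (sn k); exact: leq_maxr.
    apply: (le_trans (TT_le (Hx (s k)))).
    have h1 : (N <= s k + s k)%N by apply: leq_trans Nk (leq_addr _ _).
    have := hN (s k + s k)%N (s k + s k)%N.+1 h1 (leqW h1).
    have -> : c (s k + s k)%N.+1 = ip (x (s k).+1) (x (s k)) by rewrite cE addSn.
    by rewrite -cE /= -/(x _) AE//; lra.
  have HTf := HT Hf; have HTe := HT He.
  suff : ip (T e) f ^+ 2 <= 0 by rewrite le_eqVlt ltNge sqr_ge0 orbF sqrf_eq0 => /eqP.
  apply: (@geometric_le0 _ _ (4 * ip (T f) (T f) + 2 * ip f f)) => n.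
  have g0 : 0 < 8^-1 ^+ n.+1 :> R by rewrite exprn_gt0.
  have [k nk kP] := key n _ g0.
  have Hk := Hx (s k); have HTk := HT Hk; have Hek := HB He Hk; have Hke := HB Hk He.
  have E : ip (T e) f = - ip (x (s k) - e) (T f) + ip (T (x (s k))) f.
    rewrite (Tsym He)// (Tsym Hk)// (sf_Bl sH sip)//; ring.
  have b1 := sf_CS sH sip ip_ge0 Hke HTf.
  have b2 := sf_CS sH sip ip_ge0 HTk Hf.
  have b3 : ip (x (s k) - e) (x (s k) - e) <= 2 * 8^-1 ^+ n.+1.
    apply: (le_trans (eP k)); rewrite ler_pM2l// ler_wiXn2l//.
    by rewrite invf_le1// ler1n.
  have b1' := le_trans b1 (ler_wpM2r (ip_ge0 HTf) b3).
  have b2' := le_trans b2 (ler_wpM2r (ip_ge0 Hf) kP).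
  rewrite E; set p := ip (_ - e) _ in b1' *; set r := ip _ f in b2' *.
  have : 0 <= (p + r) ^+ 2 by exact: sqr_ge0.
  by move: b1' b2'; set G := 8^-1 ^+ n.+1; nra.
(* [e] is only a limit in [H]. Since [T e] pairs to 0 with everything, [e] has the same pairings as
   this vector, which lies in the form domain. *)
pose e' := - z *: S e.
have De' : D e' by apply: lin_subspaceZ => //; exact: DS.
have He' := DH De'; have HSe := HS He.
have ee' v : H v -> ip e v = ip e' v.
  move=> Hv; have := Te v Hv; rewrite TE// /e' (sf_Zl sH sip)//; lra.
have Ne' v : D v -> b e' v = 0.
  move=> Dv; have DSe := DS He; have Hv := DH Dv.
  by rewrite /e' (sf_Zl sD sb)// bS// Te// mulr0.
have eu : ip e u = 0 by rewrite ee'//; exact: orth.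
have ex n : ip e (x n) = 0.
  elim: n => //= n IH; have HTx := HT (Hx n).
  by rewrite -Asym//; rewrite AE// Te// IH; ring.
have ee : ip e e = 0.
  suff : ip e e ^+ 2 <= 0 by rewrite le_eqVlt ltNge sqr_ge0 orbF sqrf_eq0 => /eqP.
  apply: (@geometric_le0 _ _ (2 * ip e e)) => n.
  have Hn := Hx (s n); have Hne := HB Hn He.
  have E : ip e e = - ip e (x (s n) - e) by rewrite (sf_Br sH sip)// ex; ring.
  rewrite {1}E sqrrN; apply: (le_trans (sf_CS sH sip ip_ge0 He Hne)).
  by have := ler_wpM2l (ip_ge0 He) (eP n); lra.
have cs n : c (s n + s n)%N <= 4 * 8^-1 ^+ n.+1.
  have Hn := Hx (s n); have Hne := HB Hn He.
  have := sf_sqrD_le sH sip ip_ge0 Hne He.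
  by rewrite subrK cE ee mulr0 addr0; have := eP n; lra.
(* As T / 2 = 1 - A, [T (f n)] telescopes to [u - x n]. *)
pose f n := \sum_(k < n) 2^-1 *: x k.
have Hf n : H (f n).
  elim: n => [|n IH]; first by rewrite /f big_ord0; exact: sH.1.
  by rewrite /f big_ord_recr /=; apply: HD => //; exact: HZ.
have Tf n v : H v -> ip (T (f n)) v = ip (u - x n) v.
  move=> Hv; have HTv := HT Hv; have Hn k := Hx k.
  rewrite (Tsym (Hf n) Hv) (sf_Bl sH sip)//; elim: n => [|n IH].
    by rewrite /f big_ord0 (sf_0l sH sip)// subrr.
  have Hxn : H (2^-1 *: x n) by exact: HZ.
  have -> : f n.+1 = f n + 2^-1 *: x n by rewrite /f big_ord_recr.
  rewrite (sf_Dl sip)// IH (sf_Zl sH sip)// -(Tsym (Hx n))//.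
  by rewrite -/(x n) AE//; ring.
have main n : 2 * z * (c 0%N - c n) ^+ 2 <= (c 0%N - 2 * c n + c (n + n)%N) * b u u.
  have Hux : H (u - x n) by exact: HB.
  have HTfn := HT (Hf n).
  have Hux0 : H (x 0%N - x n) by [].
  have := T_CS (Hf n) Du; rewrite (Tf _ _ HTfn) (sip.1 _ (T _) Hux HTfn) (Tf _ _ Hux) (Tf _ _ Hu).
  by rewrite -[u in u - x n]/(x 0%N) dc !add0n (sf_Bl sH sip).
have c2n n : c (n + n)%N <= c n.
  have /nonincreasing_seqP : forall n, c n.+1 <= c n by move=> k; exact: (c0 k).2.
  by apply; exact: leq_addr.
have cn n : c n <= c 0%N.
  have /nonincreasing_seqP : forall n, c n.+1 <= c n by move=> k; exact: (c0 k).2.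
  by apply.
have bu := b_ge0 Du.
(* One factor [c 0 - c n] of [main] is cancelled by means of [c2n]; then [c n] tends to 0 along the
   subsequence by [cs]. *)
have fin n : 2 * z * c 0%N <= b u u + 2 * z * c n.
  have := cn n; rewrite le_eqVlt => /predU1P[->|lt]; first by lra.
  have d0 : 0 < c 0%N - c n by rewrite subr_gt0.
  have : 2 * z * (c 0%N - c n) * (c 0%N - c n) <= b u u * (c 0%N - c n).
    apply: le_trans (_ : (c 0%N - 2 * c n + c (n + n)%N) * b u u <= _); last first.
      by rewrite mulrC ler_wpM2l//; have := c2n n; lra.
    by rewrite -mulrA -expr2.
  by rewrite ler_pM2r// mulrBr; lra.
rewrite -[ip u u]/(c 0%N) -subr_le0.
apply: (@geometric_le0 _ _ (2 * z * 4)) => n.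
have := fin (s n + s n)%N; have := ler_wpM2l (ltW z0) (cs n); lra.
Qed.

End Gap.

(** * The magnetic form *)

Section Coefficients.
Context {R : realType} {G : metricGraph R}.
Local Notation mu := (gmeasure G).
Local Notation X := (gpoint G -> Rcomplex R).
Local Notation Re := complex.Re.
Local Notation Im := complex.Im.
Implicit Types (u v w : X) (e : edge G) (x y : R) (p : gpoint G) (f g : gpoint G -> R).

Definition bounded_coef f := measurable_fun setT f /\
  exists C : R, {ae mu, forall p, `|f p| <= C}.

Definition sqint_plus_bounded f := exists f1 f2,
  [/\ sqint mu f1, bounded_coef f2 & forall p, f p = f1 p + f2 p].

Lemma Lpoo_bounded u : Lp +oo%E u -> bounded_coef (fun p => Re (u p)).
Proof.
move=> [mr _ fin]; split => //.
(* The L^oo norm is an essential supremum if the measure is nonzero; for the zero measure every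
   bound holds almost everywhere. *)
move: fin; rewrite /norm_Lp unlock; case: ifPn => [mu0 fin|mu0 _]; last first.
  exists 0; exists setT; split => //.
  by apply/eqP; rewrite eq_le measure_ge0 andbT leNgt.
have : (ess_sup mu (EFin \o (fun p => normc (u p))) < +oo)%E.
  by apply: le_lt_trans fin; apply: le_ess_sup; apply: nearW => p /=; rewrite lee_fin ler_norm.
move=> /ess_supr_bounded[C hC]; exists C; apply: filterS hC => p.
by apply: le_trans; exact: Re_le_normc.
Qed.

Lemma bounded_coefD f g : bounded_coef f -> bounded_coef g -> bounded_coef (fun p => f p + g p).
Proof.
move=> [mf [C fC]] [mg [C' gC]]; split; first exact: measurable_funD.
exists (C + C'); apply: filterS2 fC gC => p h1 h2.
exact: le_trans (ler_normD _ _) (lerD h1 h2).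
Qed.

Lemma sqint_plus_boundedP f : sum_space (Lp 2%:E) (Lp +oo%E) (real_fun f) ->
  sqint_plus_bounded f.
Proof.
move=> [v [w [/Lp2P sv /Lpoo_bounded bw E]]].
exists (fun p => Re (v p)), (fun p => Re (w p)); split => //; first by case: sv.
by move=> p; have := E p; rewrite /real_fun => /(congr1 (@Re R)); rewrite raddfD.
Qed.

Hypotheses (conn : connected [set: gpoint G]) (cnt : countable [set: edge G]).

Lemma H1_bounded u : H1 u -> exists C : R, forall p, normc (u p) <= C.
Proof.
have [C C0 hC] := H1_sup conn cnt; move=> hu.
set K := C * (ip u u * (ip u u + ip (wderiv u) (wderiv u))); exists (K + 1) => p.
have := hC u p hu; rewrite -/K; set x := normc _ => h.
have x0 : 0 <= x by exact: normc_ge0.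
have K0 : 0 <= K by apply: le_trans h; rewrite exprn_ge0.
rewrite leNgt; apply/negP => xK.
have : x <= x ^+ 4 by rewrite ler_eXnr//; lra.
lra.
Qed.

(** The sup bound controls the H1 summand, and the L^oo norm the other one. *)
Lemma bounded_coefP f : sum_space (@H1 R G) (W1 +oo%E) (real_fun f) -> bounded_coef f.
Proof.
move=> [v [w [hv [_ /Lpoo_bounded bw _] E]]].
rewrite (_ : f = fun p => Re (v p) + Re (w p)); last first.
  apply/funext => p; have := E p; rewrite /real_fun => /(congr1 (@Re R)).
  by rewrite raddfD.
apply: bounded_coefD => //; split; first by case: (H1_sq hv) => -[].
have [C hC] := H1_bounded hv; exists C; apply: aeW => p.
exact: le_trans (Re_le_normc _) (hC p).
Qed.

End Coefficients.

Section Form.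
Context {R : realType} {G : metricGraph R}.
Local Notation mu := (gmeasure G).
Local Notation X := (gpoint G -> Rcomplex R).
Local Notation Re := complex.Re.
Local Notation Im := complex.Im.
Implicit Types (u v w : X) (e : edge G) (x y : R) (p : gpoint G) (f g : gpoint G -> R).
Hypotheses (conn : connected [set: gpoint G]) (cnt : countable [set: edge G]).
Variables (V M : gpoint G -> R).
Hypotheses (bM : bounded_coef M) (bV : sqint_plus_bounded V).

Lemma momentumE u p : Re (momentum M u p) = M p * Re (u p) - Im (wderiv u p) /\
  Im (momentum M u p) = M p * Im (u p) + Re (wderiv u p).
Proof.
rewrite /momentum; case: (wderiv u p) (u p) => [a b] [c d] /=.
by split; ring.
Qed.

Lemma momentum_sq u : H1 u -> sq (momentum M u).
Proof.
move=> hu; have [su1 su2] := H1_sq hu; have [sd1 sd2] := H1_sqd hu.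
have [mM [C hC]] := bM.
split.
  under eq_fun do rewrite (momentumE u _).1.
  by apply: sqintB => //; exact: sqintM_bounded hC.
under eq_fun do rewrite (momentumE u _).2.
under eq_fun do rewrite -[M _ * _]mul1r.
by apply: sqint_lin => //; exact: sqintM_bounded hC.
Qed.

Lemma momentum_lin (c : R[i]) u v : H1 u -> H1 v -> {ae mu, forall p,
  momentum M (fun p => c * u p + v p) p = c * momentum M u p + momentum M v p}.
Proof.
move=> hu hv; have [_ ae] := H1_lin c hu hv; apply: filterS ae => p.
by rewrite /momentum => ->; ring.
Qed.

Lemma momentum_linR (c : R) u v : H1 u -> H1 v -> {ae mu, forall p,
  momentum M (c *: u + v) p = (c *: (momentum M u : X) + (momentum M v : X)) p}.
Proof.
move=> hu hv; have [_ ae] := H1_linR c hu hv; apply: filterS ae => p.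
have E a b : (c *: (a : X) + (b : X)) p = (c%:C)%C * (a p : R[i]) + b p by rewrite -scaleRcE.
by rewrite /momentum => ->; rewrite !E; ring.
Qed.

Definition vf u v : R := \int[mu]_p (V p * (Re (u p) * Re (v p) + Im (u p) * Im (v p))).

(** The real part of [form]; the imaginary part is [af] with the second argument rotated. *)
Definition af u v : R := ip (momentum M u) (momentum M v) + vf u v.

(** [u] is bounded, so products of components of [u] and [v] are square integrable and pair with the
    L^2 part of [V]. *)
Lemma vf_integrable u v : H1 u -> H1 v -> mu.-integrable setT
  (EFin \o (fun p => V p * (Re (u p) * Re (v p) + Im (u p) * Im (v p)))).
Proof.
move=> hu hv; have [V1 [V2 [sV1 [mV2 [C hC]] VE]]] := bV.
have [C1 hC1] := H1_bounded conn cnt hu.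
have [ru iu] := H1_sq hu; have [rv iv] := H1_sq hv.
have E : (fun p => V p * (Re (u p) * Re (v p) + Im (u p) * Im (v p))) =
    (fun p => (V1 p * (Re (u p) * Re (v p)) + V1 p * (Im (u p) * Im (v p)))
     + ((V2 p * Re (u p)) * Re (v p) + (V2 p * Im (u p)) * Im (v p))).
  by apply/funext => p; rewrite VE; ring.
rewrite E; apply: integrableD_EFin => //; apply: integrableD_EFin => //; apply: sqint_mul => //.
- apply: sqintM_bounded => //; [by case: ru|].
  by apply: aeW => p; exact: le_trans (Re_le_normc _) (hC1 p).
- apply: sqintM_bounded => //; [by case: iu|].
  by apply: aeW => p; exact: le_trans (Im_le_normc _) (hC1 p).
- exact: sqintM_bounded hC.
- exact: sqintM_bounded hC.
Qed.

Lemma vf_form : sym_form (@H1 R G : set X) vf.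
Proof.
split=> [u v hu hv|c u v w hu hv hw].
  by apply: eq_Rintegral => p _; congr (_ * _); ring.
rewrite /vf -RintegralZl//; last exact: vf_integrable.
rewrite -RintegralD//; last 2 first.
- by apply: integrableZ_EFin => //; exact: vf_integrable.
- exact: vf_integrable.
by apply: eq_Rintegral => p _; rewrite Re_scale Im_scale; ring.
Qed.

Lemma af_form : sym_form (@H1 R G : set X) af.
Proof.
have sv := vf_form; have si := ip_form (G := G); have hs := H1_subspace (G := G).
split=> [u v hu hv|c u v w hu hv hw].
  by rewrite /af sv.1// si.1//; exact: momentum_sq.
rewrite /af sv.2// mulrDr addrACA; congr (_ + _).
rewrite -si.2; try exact: momentum_sq.
apply: sq_ae_ip; try exact: momentum_sq.
- by apply: momentum_sq; exact: hs.2.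
- by apply: (sq_subspace (G := G)).2; exact: momentum_sq.
- exact: momentum_linR.
- exact: aeW.
Qed.

Lemma form_Re u v : H1 u -> H1 v -> Re (Defs.form V M u v) = af u v.
Proof.
move=> hu hv; rewrite /Defs.form /Cint /= /af /ip /vf -RintegralD//.
- apply: eq_Rintegral => p _; case: (momentum M u p) (momentum M v p) (u p) (v p) => [a b] [c d] [a' b'] [c' d'] /=.
  ring.
- by apply: ip_integrable; exact: momentum_sq.
- exact: vf_integrable.
Qed.

End Form.

Section Operator.
Context {R : realType} {G : metricGraph R}.
Local Notation mu := (gmeasure G).
Local Notation X := (gpoint G -> Rcomplex R).
Local Notation Re := complex.Re.
Local Notation Im := complex.Im.
Implicit Types (u v w : X) (e : edge G) (x y : R) (p : gpoint G) (f g : gpoint G -> R).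
Hypotheses (conn : connected [set: gpoint G]) (cnt : countable [set: edge G]).
Variables (V M : gpoint G -> R).
Hypotheses (bM : bounded_coef M) (bV : sqint_plus_bounded V).

(** This is -i v, written as [c * v + v] to match the shape of [H1_lin]. *)
Definition rotate (v : X) : X := fun p => ((-'i)%C - 1) * (v p : R[i]) + v p.

Lemma rotateE (z : R[i]) : Re (((-'i)%C - 1) * z + z) = Im z /\ Im (((-'i)%C - 1) * z + z) = - Re z.
Proof. by case: z => a b /=; split; ring. Qed.

Lemma form_Im u v : H1 u -> H1 v -> Im (Defs.form V M u v) = af V M u (rotate v).
Proof.
move=> hu hv; have [hr _] := H1_lin ((-'i)%C - 1) hv hv.
have sP := momentum_sq bM.
rewrite /af (@sq_ae_ip _ _ _ (momentum M u) _ (rotate (momentum M v))); last 6 first.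
- exact: sP.
- exact: sP.
- exact: sP.
- by apply: sqM; exact: sP.
- exact: aeW.
- exact: momentum_lin.
rewrite /ip /vf -RintegralD//; last 2 first.
- by apply: ip_integrable; [exact: sP|apply: sqM; exact: sP].
- exact: vf_integrable.
rewrite /Defs.form /Cint /=; apply: eq_Rintegral => p _.
rewrite /rotate !(rotateE _).1 !(rotateE _).2.
by case: (momentum M u p) (momentum M v p) (u p) (v p) => [a b] [c d] [a' b'] [c' d'] /=; ring.
Qed.

(** H1 is stable under multiplication by -i, so testing the real identity with rotated functions
    recovers the imaginary part. *)
Lemma operatorP u w : operator V M u w <->
  [/\ H1 u, sq w & forall v, H1 v -> af V M u v = ip w v].
Proof.
have iE w' v : inner w' v = (ip w' v +i* ip w' (rotate v))%C.
  rewrite /inner /Cint /ip; congr (_ +i* _)%C; apply: eq_Rintegral => p _; rewrite /rotate.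
    by case: (w' p) (v p) => [a b] [c d] /=; ring.
  by rewrite (rotateE _).1 (rotateE _).2; case: (w' p) (v p) => [a b] [c d] /=; ring.
split=> [[hu /Lp2P sw H]|[hu sw H]].
  split => // v hv; rewrite -form_Re// H// iE//.
split => //; first exact/Lp2P.
move=> v hv; have [hr _] := H1_lin ((-'i)%C - 1) hv hv.
have := form_Re conn cnt bM bV hu hv; have := form_Im hu hv.
rewrite (H _ hv) (H _ hr) iE.
by case: (Defs.form V M u v) => a b /= -> ->.
Qed.

(** The L^2 part of [V] meets |u|^2, whose L^2 norm is at most |u|_oo |u|_2. The sup bound and two
    uses of Young's inequality leave one quarter of the Dirichlet form. *)
Lemma vf_small : exists2 C : R, 0 < C & forall u, H1 u ->
  `|vf V u u| <= 4^-1 * dip u u + C * ip u u.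
Proof.
have [V1 [V2 [sV1 [mV2 [C2 hC2]] VE]]] := bV.
have [C C0 hC] := H1_sup conn cnt.
pose A := \int[mu]_p (V1 p ^+ 2); have A0 : 0 <= A by apply: Rintegral_ge0 => p _; exact: sqr_ge0.
(* A/2 stems from the first Young inequality, C/4 + 1/4 from the second, |C2| from the bounded part
   of [V]. *)
exists (A / 2 + C / 4 + 4^-1 + `|C2|); first by have := normr_ge0 C2; lra.
move=> u hu; have [ru iu] := H1_sq hu; have su := H1_sq hu; have d0 := ip_ge0 (wderiv u).
have i0 := ip_ge0 u.
pose N p := Re (u p) * Re (u p) + Im (u p) * Im (u p).
have N0 p : 0 <= N p by rewrite /N -!expr2 addr_ge0 ?sqr_ge0.
have NE p : N p = normc (u p) ^+ 2 by rewrite normcE2 !expr2.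
have iN : mu.-integrable setT (EFin \o N) by exact: ip_integrable.
have mN : measurable_fun setT N by apply/measurable_EFinP; case/integrableP: iN.
pose s := Num.sqrt (C * (ip u u * (ip u u + dip u u))).
have s0 : 0 <= s by exact: sqrtr_ge0.
have sE : s ^+ 2 = C * (ip u u * (ip u u + dip u u)).
  by rewrite sqr_sqrtr// mulr_ge0 ?(ltW C0)// mulr_ge0// addr_ge0.
have Ns p : N p <= s.
  rewrite -(@ler_pXn2r _ 2) ?nnegrE// sE NE -exprM; exact: hC.
have sN : sqint mu N.
  split => //; apply: (@le_integrable_EFin _ _ _ _ setT _ (fun p => s * N p)) => //.
  - exact: measurable_funX.
  - by move=> p _; rewrite ger0_norm ?sqr_ge0// expr2 ler_wpM2r.
  - exact: integrableZ_EFin.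
have iN2 : \int[mu]_p (N p ^+ 2) <= s * ip u u.
  rewrite -RintegralZl//; apply: le_Rintegral => //; first by case: sN.
  - exact: integrableZ_EFin.
  - by move=> p _; rewrite expr2 ler_wpM2r.
pose t := \int[mu]_p (V1 p * N p).
have tt : t ^+ 2 <= A * (s * ip u u).
  pose E f : X := fun p => (f p)%:C%C.
  have sE' f : sqint mu f -> sq (E f) by split => //; exact: sqint_cst0.
  have ipE f g : ip (E f) (E g) = \int[mu]_p (f p * g p).
    by apply: eq_Rintegral => p _ /=; rewrite mulr0 addr0.
  have := sf_CS (sq_subspace (G := G)) (ip_form (G := G)) (fun u _ => ip_ge0 u) (sE' _ sV1) (sE' _ sN).
  rewrite !ipE; move/le_trans; apply; rewrite (_ : \int[mu]_x (V1 x * V1 x) = A); last first.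
    by rewrite /A; apply: eq_Rintegral => p _; rewrite expr2.
  rewrite ler_wpM2l// (_ : \int[mu]_x (N x * N x) = \int[mu]_x (N x ^+ 2))//.
have t1 : `|t| <= (A * ip u u + s) / 2.
  rewrite -(@ler_pXn2r _ 2) ?nnegrE// ?real_normK ?num_real//; last first.
    by rewrite divr_ge0// addr_ge0// mulr_ge0.
  apply: (le_trans tt); have := sqr_ge0 (A * ip u u - s); nra.
have s1 : s <= (C * ip u u + (ip u u + dip u u)) / 2.
  have d0' : 0 <= dip u u by [].
  rewrite -(@ler_pXn2r _ 2) ?nnegrE//; last first.
    by rewrite divr_ge0// !addr_ge0// mulr_ge0// ltW.
  rewrite sE; have := sqr_ge0 (C * ip u u - (ip u u + dip u u)); nra.
have i1 : mu.-integrable setT (EFin \o (fun p => V1 p * N p)) by exact: sqint_mul.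
have m2 : measurable_fun setT (fun p => V2 p * N p) by exact: measurable_funM.
have i2 : mu.-integrable setT (EFin \o (fun p => V2 p * N p)).
  rewrite (_ : (fun p => V2 p * N p) = (fun p => (V2 p * Re (u p)) * Re (u p) + (V2 p * Im (u p)) * Im (u p))).
    apply: integrableD_EFin => //; apply: sqint_mul => //; exact: sqintM_bounded hC2.
  by apply/funext => p; rewrite /N; ring.
have b2 : `|\int[mu]_p (V2 p * N p)| <= `|C2| * ip u u.
  rewrite -RintegralZl//; apply: (le_trans (le_normr_Rintegral measurableT i2)).
  have i3 : mu.-integrable setT (EFin \o (fun p => `|V2 p * N p|)) by exact: integrable_norm.
  rewrite -lee_fin /Rintegral fineK; last exact: integrable_fin_num.
  have i4 : mu.-integrable setT (EFin \o (fun p => `|C2| * N p)) by exact: integrableZ_EFin.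
  rewrite fineK; last exact: integrable_fin_num.
  apply: ae_ge0_le_integral => //.
  - exact: (measurable_int _ i3).
  - by move=> p _; rewrite lee_fin; apply: mulr_ge0 => //; exact: N0.
  - exact: (measurable_int _ i4).
  - apply: filterS hC2 => p hp _; rewrite lee_fin normrM (ger0_norm (N0 p)) ler_wpM2r//.
    exact: le_trans hp (ler_norm _).
have -> : vf V u u = t + \int[mu]_p (V2 p * N p).
  by rewrite -RintegralD//; apply: eq_Rintegral => p _; rewrite VE /N; ring.
apply: (le_trans (ler_normD _ _)).
move: t1 s1 b2; set I := ip u u; set D := dip u u; lra.
Qed.

(** |a + b|^2 <= 2 |a|^2 + 2 |b|^2, used once for the sum of i u' and M u, and once to recover i u'
    as the momentum minus M u. *)
Lemma momentum_bound : exists2 C : R, 0 < C & forall u, H1 u ->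
  2^-1 * dip u u - C * ip u u <= ip (momentum M u) (momentum M u) /\
  ip (momentum M u) (momentum M u) <= 2 * dip u u + C * ip u u.
Proof.
have [mM [C hC]] := bM; exists (2 * C ^+ 2 + 1); first by have := sqr_ge0 C; lra.
move=> u hu; have [ru iu] := H1_sq hu; have sd := H1_sqd hu; have ss := sq_subspace (G := G).
have si := ip_form (G := G).
pose Mu : X := fun p => (M p)%:C%C * (u p : R[i]).
have ReE p : Re (Mu p) = M p * Re (u p) by rewrite /Mu; case: (u p) => a b /=; ring.
have ImE p : Im (Mu p) = M p * Im (u p) by rewrite /Mu; case: (u p) => a b /=; ring.
have sM : sq Mu.
  split; [under eq_fun do rewrite ReE|under eq_fun do rewrite ImE]; exact: sqintM_bounded hC.
pose iu' : X := fun p => 'i%C * (wderiv u p : R[i]).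
have ReE' p : Re (iu' p) = - Im (wderiv u p) by rewrite /iu'; case: (wderiv u p) => a b /=; ring.
have ImE' p : Im (iu' p) = Re (wderiv u p) by rewrite /iu'; case: (wderiv u p) => a b /=; ring.
have si' : sq iu'.
  split; [under eq_fun do rewrite ReE' -mulN1r|under eq_fun do rewrite ImE'].
    by apply: sqintZ; case: sd.
  by case: sd.
have di : ip iu' iu' = dip u u.
  by apply: eq_Rintegral => p _; rewrite ReE' ImE'; ring.
have bMu : ip Mu Mu <= C ^+ 2 * ip u u.
  have i4 := ip_integrable (H1_sq hu) (H1_sq hu); have i3 := ip_integrable sM sM.
  rewrite -RintegralZl// -lee_fin /Rintegral fineK; last exact: integrable_fin_num.
  rewrite fineK; last by apply/integrable_fin_num => //; exact: integrableZ_EFin.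
  apply: ae_ge0_le_integral => //.
  - by move=> p _; rewrite lee_fin -!expr2 addr_ge0 ?sqr_ge0.
  - exact: (measurable_int _ i3).
  - by move=> p _; rewrite lee_fin mulr_ge0 ?sqr_ge0// -!expr2 addr_ge0 ?sqr_ge0.
  - exact: (measurable_int _ (integrableZ_EFin (C ^+ 2) measurableT i4)).
  - apply: filterS hC => p hp _; rewrite lee_fin ReE ImE.
    have : M p ^+ 2 <= C ^+ 2.
      by rewrite -(real_normK (num_real (M p))) lerXn2r ?nnegrE// (le_trans _ hp).
    have := sqr_ge0 (Re (u p)); have := sqr_ge0 (Im (u p)); nra.
have E : momentum M u = (iu' : X) + (Mu : X) by [].
have D1 := sf_sqrD_le ss si (fun u _ => ip_ge0 u) si' sM.
have sm : sq (momentum M u) by exact: momentum_sq.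
have D2 := sf_sqrD_le ss si (fun u _ => ip_ge0 u) sm (_ : sq (- Mu)).
have sN : sq (- Mu) by rewrite -(add0r (- Mu)); apply: lin_subspaceB => //; exact: ss.1.
move: (D2 sN); have -> : (momentum M u : X) - Mu = iu' by rewrite E addrK.
have -> : ip (- Mu) (- Mu) = ip Mu Mu by apply: eq_Rintegral => p _; rewrite !raddfN; ring.
move: D1; rewrite -E di; have := ip_ge0 u.
by move: bMu; set a := ip Mu Mu; set b := ip u u; set c := ip _ _; move=> *; split; nra.
Qed.

Lemma af_coercive : exists2 C : R, 0 < C & forall u, H1 u ->
  4^-1 * dip u u - C * ip u u <= af V M u u /\
  af V M u u <= 3 * dip u u + C * ip u u.
Proof.
have [C C0 hC] := vf_small; have [C' C'0 hC'] := momentum_bound.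
exists (C + C'); first by rewrite addr_gt0.
move=> u hu; have [h1 h2] := hC' u hu; have := hC u hu.
rewrite /af ler_norml => /andP[h3 h4]; have : 0 <= dip u u by exact: ip_ge0.
by split; lra.
Qed.

End Operator.

(** * Forms with a finite-dimensional kernel *)

Section FiniteKernel.
Context {R : realType} {X : lmodType R}.
Variables (H : set X) (ip : X -> X -> R).
Hypotheses (sH : lin_subspace H) (sip : sym_form H ip) (ip_ge0 : forall u, H u -> 0 <= ip u u).
Variables (D : set X) (b : X -> X -> R) (d : R) (n0 : nat).
Hypotheses (sD : lin_subspace D) (DH : D `<=` H) (sb : sym_form D b).

Definition ker_form : set X := [set n | D n /\ forall v, D v -> b n v = 0].

Definition orthonormal_ker (k : nat) (e : nat -> X) :=
  (forall i, (i < k)%N -> ker_form (e i)) /\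
  forall i j, (i < k)%N -> (j < k)%N -> ip (e i) (e j) = (i == j)%:R.

Hypothesis gap : forall u, D u -> (forall n, ker_form n -> ip n u = 0) -> d * ip u u <= b u u.
Hypothesis dim_le : forall k e, orthonormal_ker k e -> (k <= n0)%N.

Lemma ker_form_subspace : lin_subspace ker_form.
Proof.
split; first by split; [exact: sD.1|move=> v Dv; exact: (sf_0l sD sb)].
move=> c u v [Du hu] [Dv hv]; split; first exact: sD.2.
by move=> w Dw; rewrite sb.2// hu// hv// mulr0 addr0.
Qed.

Definition proj (k : nat) (e : nat -> X) (u : X) : X := \sum_(i < k) ip (e i) u *: e i.

Lemma ker_form_proj k e u : (forall i, (i < k)%N -> ker_form (e i)) -> ker_form (proj k e u).
Proof.
move=> he; have sK := ker_form_subspace.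
rewrite /proj; elim/big_ind: _ => [|x y hx hy|i _]; first exact: sK.1.
  exact: lin_subspaceD.
by apply: lin_subspaceZ => //; exact: he.
Qed.

Lemma ip_sum k e (c : 'I_k -> R) v : (forall i, (i < k)%N -> H (e i)) -> H v ->
  H (\sum_(i < k) c i *: e i) /\
  ip (\sum_(i < k) c i *: e i) v = \sum_(i < k) c i * ip (e i) v.
Proof.
move=> he Hv; elim: k c he => [|k IH] c he.
  by rewrite !big_ord0; split; [exact: sH.1|exact: (sf_0l sH sip)].
rewrite !big_ord_recr /=.
have [|Hs E] := IH (fun i => c (widen_ord (leqnSn k) i)).
  by move=> i ik; apply: he; rewrite ltnW.
have Hk : H (c ord_max *: e k) by apply: lin_subspaceZ => //; exact: he.
split; first exact: lin_subspaceD.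
by rewrite (sf_Dl sip)// E (sf_Zl sH sip)//; exact: he.
Qed.

(** Take an orthonormal family in the kernel of maximal size. The remainder of a kernel vector has
    norm 0, as it could otherwise be normalized and added. So every remainder is orthogonal to the
    kernel, and [b] does not change when the projection is subtracted. *)
Lemma finite_kernel_gap : exists k e, (forall i, (i < k)%N -> ker_form (e i)) /\
  forall u, D u -> d * (ip u u - \sum_(i < k) ip (e i) u ^+ 2) <= b u u.
Proof.
have sK := ker_form_subspace.
have KH n : ker_form n -> H n by case=> Dn _; exact: DH.
pose P k := `[< exists e, orthonormal_ker k e >].
have exP : exists k, P k by exists 0%N; apply/asboolP; exists (fun=> 0); split.
have ubP k : P k -> (k <= n0)%N by move=> /asboolP[e]; exact: dim_le.
case: (ex_maxnP exP ubP) => k /asboolP[e [eK eo]] kmax.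
have He i : (i < k)%N -> H (e i) by move=> ik; exact: KH (eK _ ik).
pose r u := u - proj k e u.
have Hpr u v : H v -> H (proj k e u) /\ ip (proj k e u) v = \sum_(i < k) ip (e i) u * ip (e i) v.
  by move=> Hv; exact: (@ip_sum k e (fun i => ip (e i) u) v).
have Hp u : H (proj k e u) by exact: (Hpr u 0 sH.1).1.
have pe u j : H u -> (j < k)%N -> ip (proj k e u) (e j) = ip (e j) u.
  move=> Hu jk; rewrite (Hpr u (e j) (He _ jk)).2 (bigD1 (Ordinal jk))//= eo// eqxx mulr1.
  rewrite big1 ?addr0// => i /negP ij; rewrite eo// mulrC.
  by case: eqVneq => [E|_]; [case: ij; apply/eqP/val_inj|rewrite mul0r].
have Hr u : H u -> H (r u) by move=> Hu; exact: lin_subspaceB.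
have re u j : H u -> (j < k)%N -> ip (r u) (e j) = 0.
  by move=> Hu jk; have Hj := He _ jk; rewrite /r (sf_Bl sH sip)// pe// sip.1// subrr.
have rr u : H u -> ip (r u) (r u) = ip u u - \sum_(i < k) ip (e i) u ^+ 2.
  move=> Hu; have Hpu := Hp u; rewrite (sf_sqrB sH sip)// (sip.1 u)// !(Hpr _ _ _).2//.
  have -> : \sum_(i < k) ip (e i) u * ip (e i) (proj k e u) = \sum_(i < k) ip (e i) u ^+ 2.
    apply: eq_bigr => i _; rewrite (sip.1 (e i) (proj k e u))//; last exact: He.
    by rewrite pe// expr2.
  by under eq_bigr do rewrite -expr2; ring.
have null n : ker_form n -> ip (r n) (r n) = 0.
  move=> Kn; have Hn := KH _ Kn; have Krn : ker_form (r n).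
    by apply: lin_subspaceB => //; exact: ker_form_proj.
  apply/eqP; rewrite eq_le ip_ge0 ?andbT//; last exact: Hr.
  rewrite leNgt; apply/negP => pos.
  have : P k.+1.
    pose s := (Num.sqrt (ip (r n) (r n)))^-1.
    have s2 : s * (s * ip (r n) (r n)) = 1.
      by rewrite mulrA -expr2 exprVn sqr_sqrtr ?(ltW pos)// mulVf// gt_eqF.
    have Hrn := Hr _ Hn; have Hsr : H (s *: r n) by exact: lin_subspaceZ.
    apply/asboolP; exists (fun i => if (i < k)%N then e i else s *: r n); split.
      move=> i; rewrite ltnS leq_eqVlt => /predU1P[->|ik]; last by rewrite ik; exact: eK.
      by rewrite ltnn; exact: lin_subspaceZ.
    move=> i j; rewrite !ltnS => ik jk.
    move: ik jk; rewrite leq_eqVlt => /predU1P[->|ik]; rewrite leq_eqVlt => /predU1P[->|jk].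
    - by rewrite ltnn eqxx (sf_Zl sH sip)// (sf_Zr sH sip).
    - rewrite ltnn jk (sf_Zl sH sip)//; last exact: He.
      by rewrite re// mulr0 gtn_eqF.
    - rewrite ltnn ik (sf_Zr sH sip)//; last exact: He.
      by have Hi := He _ ik; rewrite sip.1// re// mulr0 ltn_eqF.
    - by rewrite ik jk eo.
  by move/kmax; rewrite ltnn.
exists k, e; split => // u Du; have Hu := DH Du.
have Kp := ker_form_proj u eK; have Dp : D (proj k e u) by case: Kp.
have Dr : D (r u) by exact: lin_subspaceB.
have -> : b u u = b (r u) (r u).
  by rewrite (sf_sqrB sD sb)// (sb.1 u)// !Kp.2//; ring.
rewrite -rr//; apply: gap => // n Kn; have Hn := KH _ Kn; have Hru := Hr _ Hu.
have Hpn := Hp n; have Hrn := Hr _ Hn.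
have -> : n = r n + proj k e n by rewrite /r subrK.
rewrite (sf_Dl sip)//; have -> : ip (r n) (r u) = 0.
  (* A vector of norm 0 pairs to 0 with everything. *)
  have := sf_CS sH sip ip_ge0 Hrn Hru; rewrite null// mul0r => h.
  by apply/eqP; rewrite -sqrf_eq0 eq_le h sqr_ge0.
rewrite add0r (Hpr _ _ _).2// big1// => i _.
have Hi := He _ (ltn_ord i); by rewrite (sip.1 (e i) (r u))// re// mulr0.
Qed.

End FiniteKernel.

Lemma kernel_vector {R : fieldType} (m n : nat) (A : 'M[R]_(m, n)) : (n < m)%N ->
  exists2 x : 'rV[R]_m, x != 0 & x *m A = 0.
Proof.
move=> nm; have : kermx A != 0.
  by rewrite -mxrank_eq0 mxrank_ker subn_eq0 -ltnNge (leq_ltn_trans (rank_leq_col A)).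
case/rowV0Pn => x /sub_kermxP xA x0; by exists x.
Qed.

(** * Bottom of the spectrum and spectral gap of the magnetic operator *)

Section Spectrum.
Context {R : realType} {G : metricGraph R}.
Local Notation mu := (gmeasure G).
Local Notation X := (gpoint G -> Rcomplex R).
Local Notation Re := complex.Re.
Local Notation Im := complex.Im.
Local Notation H1s := (@H1 R G : set X).
Local Notation sqs := (@sq R G : set X).
Implicit Types (u v w f g : X) (e : edge G) (x y : R) (p : gpoint G).
Hypotheses (conn : connected [set: gpoint G]) (cnt : countable [set: edge G]).
Variables (V M : gpoint G -> R).
Hypotheses (bM : bounded_coef M) (bV : sqint_plus_bounded V).
Local Notation a := (af V M).

Let opP := operatorP conn cnt bM bV.

Lemma scale_real (c : R) f u : (fun p => (f : X) p + (c%:C)%C * u p : R[i]) = (f : X) + c *: u.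
Proof. by apply/funext => p; rewrite -scaleRcE. Qed.

Lemma resolvent_setP (c : R) : resolvent_set V M (c%:C)%C -> resolvent_at sqs (@ip R G) H1s a c.
Proof.
move=> [ex [C hC]]; have C0 : 0 < `|C| + 1 by rewrite ltr_wpDl.
exists (`|C| + 1) => // f sf; have /Lp2P Lf := sf.
have [h hE] := ex f Lf; have := hC h f Lf hE.
move: hE; rewrite (scale_real c f h) => /opP[hh _ hv].
rewrite (norm_Lp2_sq sf) (norm_Lp2_sq (H1_sq hh)) lee_fin => hb.
exists h; split => //.
have {}hb : Num.sqrt (ip h h) <= (`|C| + 1) * Num.sqrt (ip f f).
  apply: (le_trans hb); rewrite ler_wpM2r ?sqrtr_ge0//; have := ler_norm C; lra.
move: hb; rewrite -(@ler_pXn2r _ 2) ?nnegrE ?sqrtr_ge0 ?mulr_ge0 ?sqrtr_ge0 ?(ltW C0)//.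
by rewrite exprMn !sqr_sqrtr ?ip_ge0.
Qed.

(** By the sup bound, an H1 function of L^2 norm 0 vanishes at every point, not only almost
    everywhere. *)
Lemma H1_ip_gt0 u : H1 u -> (exists p, u p != 0) -> 0 < ip u u.
Proof.
move=> hu [p up]; have [C C0 hC] := H1_sup conn cnt.
rewrite lt_def ip_ge0 andbT; apply/eqP => u0; have := hC u p hu.
rewrite u0 mul0r mulr0; apply/negP; rewrite -ltNge exprn_gt0//.
by rewrite lt_def normc_ge0 andbT; apply: contraNneq up => /Normc.eq0_normc ->.
Qed.

Lemma form_eigenspaceP (c : R) u : Defs.eigenspace V M c u <-> H1 u /\ forall v, H1 v -> a u v = c * ip u v.
Proof.
have E : (fun p => (c%:C)%C * u p : R[i]) = c *: u by apply/funext => p; rewrite -scaleRcE.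
have sz : H1 u -> forall v, H1 v -> ip (c *: u) v = c * ip u v.
  move=> hu v hv; have := sf_Zl (sq_subspace (G := G)) (ip_form (G := G)).
  by apply; exact: H1_sq.
rewrite /Defs.eigenspace /= E; split=> [/opP[hu _ hv]|[hu hv]].
  by split => // v Hv; rewrite hv// sz.
apply/opP; split => //; first by apply: lin_subspaceZ; [exact: sq_subspace|exact: H1_sq].
by move=> v Hv; rewrite hv// sz.
Qed.

(** The resolvent estimate for the right-hand side 0 would force the eigenfunction to vanish. *)
Lemma eigenfunction_spectrum (c : R) u : eigenfunction V M c u -> spectrum V M c.
Proof.
move=> [eu nz] [_ [C hC]]; have /form_eigenspaceP[hu _] := eu.
have s0 : sq (0 : X) by exact: (sq_subspace (G := G)).1.
have /Lp2P L0 := s0.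
have := hC u (0 : X) L0; rewrite (norm_Lp2_sq s0) (norm_Lp2_sq (H1_sq hu)).
have -> : ip (0 : X) 0 = 0 by rewrite (sf_0l (sq_subspace (G := G)) (ip_form (G := G))).
rewrite sqrtr0 mule0 lee_fin.
have -> : (fun p => (0 : X) p + (c%:C)%C * u p : R[i]) = (fun p => (c%:C)%C * u p).
  by apply/funext => p; rewrite add0r.
move=> /(_ eu); apply/negP; rewrite -ltNge sqrtr_gt0; exact: H1_ip_gt0.
Qed.

(** Let [m] be the largest lower bound of the form, which exists by coercivity and by the Rayleigh
    quotient of [u]. If [m < c], then [m] lies below the spectrum and [bottom_resolvent] raises
    it. *)
Lemma bottom_spectrum (c : R) u : c%:E = einf (spectrum V M) -> eigenfunction V M c u ->
  forall v, H1 v -> c * ip v v <= a v v.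
Proof.
move=> cE [/form_eigenspaceP[hu _] nz]; have u0 := H1_ip_gt0 hu nz.
have si := ip_form (G := G); have hs := H1_subspace (G := G).
have sH : H1s `<=` sqs by move=> ?; exact: H1_sq.
pose K : set R := [set m | forall v, H1 v -> m * ip v v <= a v v].
have [C C0 hC] := af_coercive conn cnt bM bV.
have KC : K (- C).
  by move=> v hv; have := (hC v hv).1; have : 0 <= dip v v := ip_ge0 _; lra.
have Ku : ubound K (a u u / ip u u) by move=> m /(_ u hu); rewrite ler_pdivlMr.
have sK : has_sup K by split; [exists (- C)|exists (a u u / ip u u)].
pose m := sup K.
have Km : K m.
  move=> v hv; have := ip_ge0 v; rewrite le_eqVlt => /predU1P[v0|v0].
    by rewrite -v0 mulr0; have := KC v hv; rewrite -v0 mulr0.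
  rewrite -ler_pdivlMr//; apply: ge_sup; first by exists (- C).
  by move=> k /(_ v hv); rewrite ler_pdivlMr.
have cm : c <= m.
  rewrite leNgt; apply/negP => mc.
  have /notP rm : ~ spectrum V M m.
    move=> sm; have : (einf (spectrum V M) <= m%:E)%E by apply: ereal_inf_lbound; exists m.
    by rewrite -cE lee_fin leNgt mc.
  have [d d0 hd] := bottom_resolvent (sq_subspace (G := G)) si (fun u _ => ip_ge0 u) hs sH
    (af_form conn cnt bM bV) Km (resolvent_setP rm).
  have : m + d <= m by apply: ub_le_sup; [exact: sK.2|exact: hd].
  lra.
move=> v hv; apply: le_trans (Km v hv); by rewrite ler_wpM2r ?ip_ge0.
Qed.

Definition shifted (c : R) u v : R := a u v - c * ip u v.

Lemma shifted_form (c : R) : sym_form H1s (shifted c).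
Proof.
apply: (@form_shift _ _ sqs _ (ip_form (G := G)) _ _ c _ (af_form conn cnt bM bV)).
by move=> ?; exact: H1_sq.
Qed.

(** The span of n functions over the complex numbers has real dimension at most 2n; a longer real
    family has a nontrivial real relation, which orthonormality excludes. *)
Lemma orthonormal_le (c : R) : finite_dim (Defs.eigenspace V M c) ->
  exists n0, forall k (e : nat -> X), orthonormal_ker (@ip R G) H1s (shifted c) k e -> (k <= n0)%N.
Proof.
move=> [n [bs hb]]; exists (n + n)%N => k e [eK eo].
have He i : (i < k)%N -> sq (e i) by move=> ik; have [/H1_sq] := eK i ik.
have /choice[cf hcf] : forall i : 'I_k, exists c : 'I_n -> R[i], forall p,
    e i p = \sum_(j < n) c j * bs j p.
  move=> i; apply: hb; apply/form_eigenspaceP; have [hi iv] := eK i (ltn_ord i).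
  by split => // v hv; apply/eqP; rewrite -subr_eq0; apply/eqP; exact: iv.
rewrite leqNgt; apply/negP => nk.
pose A : 'M[R]_(k, n + n) := row_mx (\matrix_(i, j) Re (cf i j)) (\matrix_(i, j) Im (cf i j)).
have [x x0 xA] := kernel_vector A nk.
have [x1 x2] : (forall j, \sum_i x 0 i * Re (cf i j) = 0) /\
    (forall j, \sum_i x 0 i * Im (cf i j) = 0).
  have E l : (x *m A) 0 l = 0 by rewrite xA mxE.
  split=> j; [have := E (lshift n j)|have := E (rshift n j)]; rewrite mxE => h; rewrite -[RHS]h.
    by apply: eq_bigr => i _; rewrite row_mxEl mxE.
  by apply: eq_bigr => i _; rewrite row_mxEr mxE.
have xe : \sum_(i < k) x 0 i *: e i = 0.
  apply/funext => p; rewrite fct_sumE.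
  transitivity (\sum_(i < k) \sum_(j < n) ((x 0 i)%:C)%C * (cf i j * bs j p) : R[i]).
    by apply: eq_bigr => i _; rewrite -mulr_sumr -hcf -scaleRcE.
  rewrite exchange_big big1//= => j _; under eq_bigr do rewrite mulrA; rewrite -mulr_suml.
  rewrite (_ : \sum_(i < k) _ = 0) ?mul0r//; apply/eqP; rewrite eq_complex !raddf_sum /=.
  apply/andP; split; apply/eqP; [rewrite -[RHS](x1 j)|rewrite -[RHS](x2 j)];
    by apply: eq_bigr => i _; case: (cf i j) => ? ? /=; ring.
case/eqP: x0; apply/rowP => l; rewrite mxE.
have [_] := ip_sum (sq_subspace (G := G)) (ip_form (G := G)) (x 0) He (He _ (ltn_ord l)).
rewrite xe (sf_0l (sq_subspace (G := G)) (ip_form (G := G))); last exact: He.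
rewrite (bigD1 l)//= eo// eqxx mulr1 big1 ?addr0 => [<-//|i /negP il].
by rewrite eo//; case: eqVneq => [E|_]; [case: il; apply/eqP/val_inj|rewrite mulr0].
Qed.

(** [c] is in the discrete spectrum, as otherwise the essential spectrum would reach down to it.
    Isolation provides the resolvent points above [c] for [spectral_gap], and the eigenspace, of
    finite dimension, is the kernel of the shifted form. *)
Lemma ground_state_gap (c : R) u : c%:E = einf (spectrum V M) -> eigenfunction V M c u ->
  (einf (spectrum V M) < einf (essential_spectrum V M))%E ->
  exists2 d : R, 0 < d & exists k (e : nat -> X), (forall i, (i < k)%N -> H1 (e i)) /\
    forall v, H1 v -> d * (ip v v - \sum_(i < k) ip (e i) v ^+ 2) <= shifted c v v.
Proof.
move=> cE eu lt; have sc := eigenfunction_spectrum eu.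
have [iso _ fd] : discrete_spectrum V M c.
  apply: contrapT => nd; have : (einf (essential_spectrum V M) <= c%:E)%E.
    by apply: ereal_inf_lbound; exists c.
  by rewrite cE leNgt lt.
have [n0 hn0] := orthonormal_le fd.
have sH : H1s `<=` sqs by move=> ?; exact: H1_sq.
have si := ip_form (G := G); have hs := H1_subspace (G := G); have ss := sq_subspace (G := G).
have sf := shifted_form c.
have [d [d0 hd]] : exists d : R, 0 < d /\ forall w : R, 0 < w -> w < 2 * d ->
    resolvent_at sqs (@ip R G) H1s (shifted c) w.
  have [_ [W /nbhs_ballP[eps eps0 hW] WE]] := iso.
  (* With [2 * d] the radius of the isolating ball, ]c, c + 2d[ contains no spectrum. *)
  exists (eps / 2); split; first by rewrite divr_gt0.
  move=> w w0; rewrite mulrC divfK// => we.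
  have /notP /resolvent_setP [C C0 hC] : ~ spectrum V M (c + w).
    move=> sw; have : [set c] (c + w).
      rewrite -WE; split => //; apply: hW; rewrite /ball /= opprD addrA subrr sub0r normrN.
      by rewrite gtr0_norm.
    by move=> /eqP; rewrite -subr_eq0 addrAC subrr add0r gt_eqF.
  exists C => // f sf'; have [h [hh hv hb]] := hC f sf'; exists h; split => // v Hv.
  have sh := H1_sq hh; have sv := H1_sq Hv.
  have sZ r : sq (r *: h) by exact: lin_subspaceZ.
  rewrite /shifted hv// scalerDl !(sf_Dl si)//; try exact: lin_subspaceD.
  by rewrite !(sf_Zl ss si)//; ring.
have b0 v : H1 v -> 0 <= shifted c v v.
  by move=> hv; rewrite /shifted subr_ge0; exact: bottom_spectrum cE eu v hv.
have d2 : d < 2 * d by rewrite ltr_pMl// ltr1n.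
have [S SP _] := solves_exists hd d0 d2.
have Sb := resolvent_bound ss si (fun u _ => ip_ge0 u) sH sf d0 hd SP.
have gap v := @spectral_gap R X sqs (@ip R G) ss si (fun u _ => ip_ge0 u) H1s (shifted c) d
  hs sH sf b0 d0 (@sq_complete R G) S SP Sb v.
have [|k [e [eK he]]] := @finite_kernel_gap R X sqs (@ip R G) ss si (fun u _ => ip_ge0 u) H1s
  (shifted c) (2 * d) n0 hs sH sf _ hn0.
  by move=> v hv hK; apply: gap => // n hn hb; exact: hK.
exists (2 * d); first by rewrite mulr_gt0.
by exists k, e; split => // i ik; case: (eK i ik).
Qed.

End Spectrum.

(** * Minimization *)

(** The restriction to [e <= 1] lets quadratic errors be bounded by linear ones. *)
Lemma ler_small {R : realType} (x y K : R) : 0 <= K ->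
  (forall e, 0 < e -> e <= 1 -> x <= y + K * e) -> x <= y.
Proof.
move=> K0 H; apply/ler_addgt0Pr => e e0; pose d := Num.min 1 (e / (K + 1)).
have K1 : 0 < K + 1 by rewrite ltr_wpDl.
have d0 : 0 < d by rewrite lt_min ltr01 divr_gt0.
have d1 : d <= 1 by rewrite ge_min lexx.
apply: (le_trans (H d d0 d1)); rewrite lerD2l.
apply: (@le_trans _ _ ((K + 1) * d)); first by rewrite ler_wpM2r ?(ltW d0)// lerDl.
by rewrite mulrC -ler_pdivlMr// ge_min lexx orbT.
Qed.

Section Minimization.
Context {R : realType} {X : lmodType R}.
Variables (D : set X) (ip b : X -> X -> R) (Phi psi : X -> R) (kappa C B : R).
Hypotheses (sD : lin_subspace D) (sip : sym_form D ip) (sb : sym_form D b).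
Hypotheses (ip_ge0 : forall u, D u -> 0 <= ip u u) (b_ge0 : forall u, D u -> 0 <= b u u).
Hypothesis kappa_gt0 : 0 < kappa.

Definition energy u := 2^-1 * b u u - kappa * Phi u.
Definition sphere : set X := [set u | D u /\ ip u u = 1].

Hypothesis Phi_scale : forall t u, D u -> 0 <= t -> t <= 1 -> Phi (t *: u) <= t ^+ 2 * Phi u.
Hypothesis Phi_null : forall u, D u -> ip u u = 0 -> Phi u <= 0.
Hypothesis energy_bounded : exists m, forall u, sphere u -> m <= energy u.
Hypothesis energy_neg : exists2 u, sphere u & energy u < 0.
Hypothesis b_bounded : forall u, sphere u -> energy u <= 0 -> b u u <= B.
Hypothesis Phi_mid : forall u v, sphere u -> sphere v -> energy u <= 0 -> energy v <= 0 ->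
  Phi u + Phi v <= 2 * Phi (2^-1 *: (u + v)) + 2 * C * psi (u - v).
Hypothesis Phi_cont : exists2 L, 0 < L & forall u v, sphere u -> sphere v -> energy u <= 0 ->
  Phi u - Phi v <= L * Num.sqrt (ip (u - v) (u - v)).
Hypothesis compactness : forall U : nat -> X, (forall n, sphere (U n)) ->
  (forall n, energy (U n) <= 0) ->
  exists F : set_system nat, [/\ ProperFilter F, (forall N, F [set n | (N <= n)%N]) &
    forall e, 0 < e -> exists2 A, F A & forall n m, A n -> A m ->
      kappa * C * psi (U n - U m) <= 16^-1 * b (U n - U m) (U n - U m) + e].
Hypothesis complete : forall (U : nat -> X) (F : set_system nat), (forall n, D (U n)) ->
  ProperFilter F -> (forall N, F [set n | (N <= n)%N]) ->
  (forall e, 0 < e -> exists2 A, F A & forall n m, A n -> A m ->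
      b (U n - U m) (U n - U m) + ip (U n - U m) (U n - U m) <= e) ->
  exists2 u, D u & forall e N, 0 < e -> exists2 n, (N <= n)%N &
    b (U n - u) (U n - u) + ip (U n - u) (U n - u) <= e.

Let sDB u v : D u -> D v -> D (u - v). Proof. exact: lin_subspaceB. Qed.
Let sDD u v : D u -> D v -> D (u + v). Proof. exact: lin_subspaceD. Qed.
Let sDZ c u : D u -> D (c *: u). Proof. exact: lin_subspaceZ. Qed.

Lemma parallelogram (a : X -> X -> R) u v : sym_form D a -> D u -> D v ->
  a (2^-1 *: (u + v)) (2^-1 *: (u + v)) = 2^-1 * a u u + 2^-1 * a v v - 4^-1 * a (u - v) (u - v).
Proof.
move=> sa Du Dv; have Duv := sDD Du Dv.
rewrite (sf_Zl sD sa)// ?(sf_Zr sD sa)//; last exact: sDZ.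
by rewrite (sf_sqrD sD sa)// (sf_sqrB sD sa)//; field.
Qed.

(** [Phi] shrinks at least quadratically under contractions, so the energy of [u] is at least the
    squared norm times the energy of the normalized vector. *)
Lemma energy_scale j u : (forall v, sphere v -> j <= energy v) -> D u -> ip u u <= 1 ->
  0 < ip u u -> ip u u * j <= energy u.
Proof.
move=> hj Du u1 u0; pose s := Num.sqrt (ip u u).
have s0 : 0 < s by rewrite sqrtr_gt0.
have s2 : s ^+ 2 = ip u u by rewrite sqr_sqrtr// ltW.
have s1 : s <= 1 by rewrite -(@ler_pXn2r _ 2) ?nnegrE ?(ltW s0)// s2 expr1n.
pose v := s^-1 *: u; have Dv : D v by exact: sDZ.
have uE : u = s *: v by rewrite /v scalerA mulfV ?scale1r// gt_eqF.
have v1 : ip v v = 1.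
  by rewrite (sf_Zl sD sip)// (sf_Zr sD sip)// -s2; field; rewrite gt_eqF.
have Ju := hj v (conj Dv v1).
apply: (@le_trans _ _ (ip u u * energy v)); first by rewrite ler_wpM2l// ltW.
rewrite /energy -s2 [X in _ <= 2^-1 * X - _](_ : b u u = s ^+ 2 * b v v); last first.
  by rewrite {1 2}uE (sf_Zl sD sb)// ?(sf_Zr sD sb)//; [ring|exact: sDZ].
have := Phi_scale Dv (ltW s0) s1; rewrite -uE.
by move=> /(ler_wpM2l (ltW kappa_gt0)); lra.
Qed.

(* For a midpoint of a minimizing sequence [U], [energy_scale] and [Phi_mid] bound
   [b w w / 8 + (- j) * ip w w / 4], [w = U n - U m], by [kappa * C * psi w] up to
   a vanishing error; as [j < 0], the sequence is Cauchy. *)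
Lemma minimizer_exists : exists2 u, sphere u & forall v, sphere v -> energy u <= energy v.
Proof.
have [m0 hm] := energy_bounded; have [u0 Su0 Ju0] := energy_neg; have [L L0 hL] := Phi_cont.
pose E : set R := [set energy u | u in sphere].
have iE : has_inf E.
  by split; [exists (energy u0), u0|exists m0 => _ [u Su <-]; exact: hm].
pose j := inf E; have jle v : sphere v -> j <= energy v.
  by move=> Sv; apply: ge_inf; [exact: iE.2|exists v].
have j0 : j < 0 by exact: le_lt_trans (jle _ Su0) Ju0.
have /choice[U hU] : forall n, exists u, [/\ sphere u, energy u <= 0 & energy u <= j + n.+1%:R^-1].
  (* The minimum with [- j] keeps the energies nonpositive, where the hypotheses on sublevels
     apply. *)
  move=> n; have e0 : 0 < Num.min (n.+1%:R^-1) (- j).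
    by rewrite lt_min oppr_gt0 j0 andbT invr_gt0.
  have [_ [u Su <-] ltu] := inf_adherent e0 iE; exists u; split => //.
    rewrite -(subrr j); apply: (le_trans (ltW ltu)); rewrite lerD2l ge_min lexx orbT //.
  by apply: (le_trans (ltW ltu)); rewrite lerD2l ge_min lexx.
have SU n : sphere (U n) by case: (hU n).
have DU n : D (U n) by case: (SU n).
have JU n : energy (U n) <= 0 by case: (hU n).
have JUj n : energy (U n) <= j + n.+1%:R^-1 by case: (hU n).
have [F [FF Foo comp]] := compactness SU JU.
have inv_small (e : R) : 0 < e -> exists N, forall n, (N <= n)%N -> n.+1%:R^-1 <= e :> R.
  move=> e0; exists (Num.bound e^-1) => n Nn.
  rewrite -[leRHS]invrK lef_pV2 ?posrE ?invr_gt0//.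
  apply: ltW; apply: (lt_trans (archi_boundP (ltW _))); rewrite ?invr_gt0// ltr_nat ltnS.
  exact: Nn.
have key n m : 8^-1 * b (U n - U m) (U n - U m) + 4^-1 * (- j) * ip (U n - U m) (U n - U m) <=
    2^-1 * (n.+1%:R^-1 + m.+1%:R^-1) + kappa * C * psi (U n - U m).
  have w0 := ip_ge0 (sDB (DU n) (DU m)).
  have Dmid : D (2^-1 *: (U n + U m)) by apply: sDZ; exact: sDD.
  have imid := parallelogram sip (DU n) (DU m).
  have bmid := parallelogram sb (DU n) (DU m).
  have [_ un1] := SU n; have [_ um1] := SU m; rewrite un1 um1 in imid.
  have b0 := b_ge0 Dmid.
  have Jmid : ip (2^-1 *: (U n + U m)) (2^-1 *: (U n + U m)) * j <= energy (2^-1 *: (U n + U m)).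
    (* A midpoint of norm 0 cannot be normalized; there [Phi_null] makes the energy nonnegative. *)
    have := ip_ge0 Dmid; rewrite le_eqVlt => /predU1P[z|z]; last first.
      by apply: energy_scale => //; lra.
    have Phi0 := Phi_null Dmid (esym z); rewrite -z mul0r /energy.
    by have := ler_wpM2l (ltW kappa_gt0) Phi0; lra.
  have := Phi_mid (SU n) (SU m) (JU n) (JU m) => /(ler_wpM2l (ltW kappa_gt0)).
  move: Jmid; rewrite /energy bmid imid; have := JUj n; have := JUj m; rewrite /energy.
  set w := ip _ _; set f := Phi (2^-1 *: _); set p := psi _; set x := b (_ - _) _; set g := Phi (U n); set h := Phi (U m).
  set r1 := m.+1%:R^-1; set r2 := n.+1%:R^-1; clearbody w f p x g h r1 r2.
  by move=> h1 h2 h3 h4; lra.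
(* [compactness] consumes 1/16 of the coefficient 1/8 of [b] in [key]; the 1/16 that remains and the
   coefficient of [ip] are both at least [c]. *)
pose c := Num.min 16^-1 (4^-1 * (- j)).
have c0 : 0 < c by rewrite lt_min invr_gt0 ltr0n /= mulr_gt0 ?oppr_gt0// invr_gt0.
have c1 : c <= 16^-1 by rewrite ge_min lexx.
have c2 : c <= 4^-1 * (- j) by rewrite ge_min lexx orbT.
clearbody c.
have [|u Du hu] := complete DU FF Foo.
  move=> e e0; have e1 : 0 < c * e / 2 by rewrite divr_gt0// mulr_gt0.
  have [A FA hA] := comp _ e1; have [N hN] := inv_small _ e1.
  exists (A `&` [set n | (N <= n)%N]); first exact: filterI.
  move=> n m [An /= Nn] [Am /= Nm]; rewrite -(ler_pM2l c0) mulrDr.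
  have w0 := ip_ge0 (sDB (DU n) (DU m)); have b0 := b_ge0 (sDB (DU n) (DU m)).
  have := key n m; have := hA n m An Am; have := hN n Nn; have := hN m Nm.
  have := ler_wpM2r w0 c2; have := ler_wpM2r b0 c1.
  set x := ip _ _; set y := b _ _; set p := psi _.
  by move: n.+1%:R^-1 m.+1%:R^-1 => r1 r2; clearbody x y p; lra.
have B0 : 0 <= B.
  by apply: le_trans (b_bounded Su0 (ltW Ju0)); apply: b_ge0; case: Su0.
(* Squares, so that Cauchy-Schwarz yields errors of order [e]. *)
have app e : 0 < e -> exists n, [/\ b (U n - u) (U n - u) <= e ^+ 2,
    ip (U n - u) (U n - u) <= e ^+ 2 & energy (U n) <= j + e].
  move=> e0; have [N hN] := inv_small _ e0; have e2 : 0 < e ^+ 2 by rewrite exprn_gt0.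
  have [n Nn] := hu _ N e2; exists n.
  have w0 := ip_ge0 (sDB (DU n) Du); have b0 := b_ge0 (sDB (DU n) Du).
  split; [lra|lra|].
  by apply: (le_trans (JUj n)); rewrite lerD2l hN.
have expand a n : sym_form D a ->
    a u u = a (U n) (U n) - 2 * a (U n) (U n - u) + a (U n - u) (U n - u).
  move=> sa; have Dw := sDB (DU n) Du; rewrite -(sf_sqrB sD sa)//.
  by rewrite opprB addrC subrK.
have abs_le (x y : R) : 0 <= y -> x ^+ 2 <= y ^+ 2 -> - y <= x <= y.
  by move=> y0 h; rewrite -ler_norml -(@ler_pXn2r _ 2) ?nnegrE// real_normK ?num_real.
have ipw n e : 0 <= e -> ip (U n - u) (U n - u) <= e ^+ 2 -> - e <= ip (U n) (U n - u) <= e.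
  move=> e0 h; apply: abs_le => //; have [_ un1] := SU n.
  have := sf_CS sD sip ip_ge0 (DU n) (sDB (DU n) Du); rewrite un1 mul1r => /le_trans; exact.
have u1 : ip u u = 1.
  apply/eqP; rewrite eq_le; apply/andP; split.
    apply: (@ler_small _ _ _ 3) => // e e0 e1; have [n [_ h _]] := app e e0.
    have /andP[h1 _] := ipw n e (ltW e0) h; rewrite (expand ip n sip); have [_ ->] := SU n.
    have : e ^+ 2 <= e by rewrite expr2 ler_piMl// ltW.
    lra.
  apply: (@ler_small _ _ _ 3) => // e e0 e1; have [n [_ h _]] := app e e0.
  have /andP[_ h1] := ipw n e (ltW e0) h; rewrite (expand ip n sip); have [_ ->] := SU n.
  have := ip_ge0 (sDB (DU n) Du); lra.
have Su : sphere u by [].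
exists u => // v Sv; apply: le_trans (jle v Sv).
(* The summands: 1 for the energy of [U n] above [j], [1 + B] for the cross term of [b], [2^-1] for
   its square term, [kappa * L] for the change of [Phi]. *)
apply: (@ler_small _ _ _ (1 + ((1 + B) + 2^-1 + kappa * L))).
  by rewrite !addr_ge0// mulr_ge0// ltW.
move=> e e0 e1; have [n [hb hi hJ]] := app e e0.
have e2 : e ^+ 2 <= e by rewrite expr2 ler_piMl// ltW.
have Be0 : 0 <= (1 + B) * e by rewrite mulr_ge0 ?addr_ge0// ltW.
have /andP[h1 _] : - ((1 + B) * e) <= b (U n) (U n - u) <= (1 + B) * e.
  apply: abs_le => //; apply: (le_trans (sf_CS sD sb b_ge0 (DU n) (sDB (DU n) Du))).
  rewrite exprMn; apply: ler_pM; [exact: b_ge0|exact: b_ge0 (sDB _ _)| |exact: hb].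
  apply: (le_trans (b_bounded (SU n) (JU n))); have := sqr_ge0 B; nra.
have := hL (U n) u (SU n) Su (JU n).
have : Num.sqrt (ip (U n - u) (U n - u)) <= e.
  rewrite -(@ler_pXn2r _ 2) ?nnegrE ?sqrtr_ge0 ?(ltW e0)// sqr_sqrtr//; exact: ip_ge0 (sDB _ _).
move=> /(ler_wpM2l (ltW L0)) h2 h3; have h4 := ler_wpM2l (ltW kappa_gt0) (le_trans h3 h2).
move: hJ; rewrite /energy (expand b n sb).
have := b_ge0 (sDB (DU n) Du); move: h4; rewrite !mulrDl !mulrDr; nra.
Qed.

End Minimization.

(** * The power nonlinearity *)

Section PowerInequalities.
Context {R : realType}.
Implicit Types (x y p q L : R).

Lemma powR_MVT p x y : 0 < x -> x < y ->
  exists2 c, x < c < y & y `^ p - x `^ p = p * c `^ (p - 1) * (y - x).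
Proof.
move=> x0 xy.
have [c|c|] := @MVT R (@powR R ^~ p) (fun c => p * c `^ (p - 1)) x y xy.
- by rewrite in_itv /= => /andP[xc _]; apply: is_derive1_powR; exact: lt_trans xc.
- apply: continuous_in_subspaceT => {}c; rewrite inE /= in_itv /= => /andP[xc _].
  have [dc _] := is_derive1_powR p (lt_le_trans x0 xc).
  by have /derivable1_diffP/differentiable_continuous := dc.
- by move=> d; rewrite in_itv /= => xdy E; exists d.
Qed.

Lemma powR_diff_le p x y : 1 < p -> 0 <= x -> x <= y ->
  y `^ p - x `^ p <= p * y `^ (p - 1) * (y - x).
Proof.
move=> p1 x0; rewrite le_eqVlt => /predU1P[->|xy]; first by rewrite !subrr mulr0.
have p0 : 0 < p := lt_trans ltr01 p1.
have y0 : 0 < y := le_lt_trans x0 xy.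
move: x0; rewrite le_eqVlt => /predU1P[<-|x0].
  rewrite powR0 ?gt_eqF// !subr0 -mulrA (mulrC _ y) mulr_powRB1 ?(ltW y0)//.
  by rewrite ler_peMl ?powR_ge0// ltW.
have [c /andP[xc cy] ->] := powR_MVT p x0 xy.
rewrite ler_wpM2r ?subr_ge0 ?(ltW xy)// ler_wpM2l ?(ltW p0)//.
rewrite ge0_ler_powR ?subr_ge0 ?nnegrE ?(ltW p1) ?(ltW cy) ?(ltW y0)//.
by rewrite ltW// (lt_trans x0).
Qed.

Lemma powR_diff_ge p x y : 1 < p -> 0 <= x -> x <= y ->
  p * x `^ (p - 1) * (y - x) <= y `^ p - x `^ p.
Proof.
move=> p1 x0; rewrite le_eqVlt => /predU1P[->|xy]; first by rewrite !subrr mulr0.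
have p0 : 0 < p := lt_trans ltr01 p1.
move: x0; rewrite le_eqVlt => /predU1P[<-|x0].
  rewrite !powR0 ?gt_eqF ?subr_gt0// mulr0 mul0r subr0 powR_ge0//.
have [c /andP[xc cy] ->] := powR_MVT p x0 xy.
rewrite ler_wpM2r ?subr_ge0 ?(ltW xy)// ler_wpM2l ?(ltW p0)//.
rewrite ge0_ler_powR ?subr_ge0 ?nnegrE ?(ltW p1) ?(ltW xc) ?(ltW x0)//.
by rewrite ltW// (lt_trans x0).
Qed.

Lemma powRB2 q x : 2 < q -> 0 <= x -> x `^ (q - 1) = x * x `^ (q - 2).
Proof.
move=> q2 x0; have q1 : 0 < q - 1 by lra.
by rewrite -(mulr_powRB1 x0 q1); congr (_ * _ `^ _); ring.
Qed.

Lemma powR_sqr q x : 2 < q -> 0 <= x -> x `^ q = x `^ (q - 2) * x ^+ 2.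
Proof.
move=> q2 x0; have q0 : 0 < q by lra.
by rewrite -(mulr_powRB1 x0 q0) powRB2// expr2; ring.
Qed.

Lemma powR_le_bound q x L : 2 < q -> 0 <= x -> x <= L -> x `^ (q - 2) <= L `^ (q - 2).
Proof.
move=> q2 x0 xL; rewrite ge0_ler_powR ?nnegrE//; first by rewrite subr_ge0 ltW.
exact: le_trans xL.
Qed.

(** [L] bounds [x] alone: for [y >= x] the left-hand side is nonpositive. *)
Lemma powR_tangent q x y L : 2 < q -> 0 <= x -> x <= L -> 0 <= y ->
  x `^ q - y `^ q <= q * L `^ (q - 2) * (x * `|x - y|).
Proof.
move=> q2 x0 xL y0; have L0 : 0 <= L := le_trans x0 xL.
have q0 : 0 < q by lra.
have [xy|yx] := leP x y.
  apply: (@le_trans _ _ 0); last by rewrite !mulr_ge0 ?powR_ge0// ltW.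
  by rewrite subr_le0 ge0_ler_powR ?nnegrE// ltW.
have q1 : 1 < q by lra.
rewrite ger0_norm ?subr_ge0 ?(ltW yx)//.
apply: (le_trans (powR_diff_le q1 y0 (ltW yx))).
rewrite (mulrA _ x) ler_wpM2r ?subr_ge0 ?(ltW yx)// -[leRHS]mulrA ler_wpM2l ?(ltW q0)//.
by rewrite powRB2// mulrC ler_wpM2r// powR_le_bound.
Qed.

(** By the tangent inequalities on both halves, the convexity defect is at most (y - x) / 2 times
    the increment of the derivative q t^(q-1) between [x] and [y], which is estimated the same
    way. *)
Lemma powR_midpoint q x y L : 2 < q -> 0 <= x -> x <= y -> y <= L ->
  x `^ q + y `^ q <= 2 * ((x + y) / 2) `^ q + q * (q - 1) / 2 * L `^ (q - 2) * (x - y) ^+ 2.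
Proof.
move=> q2 x0 xy yL; set m := (x + y) / 2.
have [q1 q1' q0] : [/\ 1 < q, 1 < q - 1 & 0 < q] by split; lra.
have [xm my] : x <= m /\ m <= y by split; rewrite /m; lra.
have h1 := powR_diff_le q1 (le_trans x0 xm) my.
have h2 := powR_diff_ge q1 x0 xm.
have h3 := powR_diff_le q1' x0 xy.
have h4 : y `^ (q - 1) - x `^ (q - 1) <= (q - 1) * L `^ (q - 2) * (y - x).
  apply: (le_trans h3); rewrite ler_wpM2r ?subr_ge0// ler_wpM2l ?subr_ge0 ?(ltW q1)//.
  have -> : q - 1 - 1 = q - 2 by ring.
  by rewrite powR_le_bound// (le_trans x0).
have qd : 0 <= q * ((y - x) / 2) by rewrite mulr_ge0 ?(ltW q0)// divr_ge0// subr_ge0.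
have := ler_wpM2l qd h4; move: h1 h2.
have -> : y - m = (y - x) / 2 by rewrite /m; field.
have -> : m - x = (y - x) / 2 by rewrite /m; field.
have -> : q * (q - 1) / 2 * L `^ (q - 2) * (x - y) ^+ 2 =
  q * ((y - x) / 2) * ((q - 1) * L `^ (q - 2) * (y - x)) by field.
lra.
Qed.

(** Two errors add up to q^2 / 2: q (q - 1) / 2 from the convexity defect of the moduli, and q / 2
    from replacing the mean [m] of the moduli by the modulus [w] of the mean, where m^2 - w^2 <= d^2
    / 4. *)
Lemma normc_midpoint q L (a b : R[i]) : 2 < q -> normc a <= L -> normc b <= L ->
  normc a `^ q + normc b `^ q <=
  2 * (normc ((2^-1)%:C%C * (a + b))) `^ q + 2 * (q ^+ 2 / 4 * L `^ (q - 2)) * normc (a - b) ^+ 2.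
Proof.
move=> q2; wlog ab : a b / normc a <= normc b.
  move=> H aL bL; have [ab|/ltW ba] := leP (normc a) (normc b); first exact: H.
  by rewrite addrC (addrC a) normc_distC H.
move=> aL bL; set x := normc a in ab aL *; set y := normc b in ab bL *.
have [x0 y0] : 0 <= x /\ 0 <= y by split; exact: normc_ge0.
set w := normc (_ * _); set d := normc (a - b); pose m := (x + y) / 2.
have w0 : 0 <= w by exact: normc_ge0.
have m0 : 0 <= m by rewrite divr_ge0// addr_ge0.
have mL : m <= L by rewrite /m; lra.
have q0 : 0 < q by lra.
have pL : 0 <= L `^ (q - 2) by exact: powR_ge0.
have w2 : w ^+ 2 = 2^-1 * x ^+ 2 + 2^-1 * y ^+ 2 - 4^-1 * d ^+ 2.
  by rewrite /w /x /y /d !normcE2; case: (a) (b) => [a1 a2] [b1 b2] /=; field.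
have xyd : (x - y) ^+ 2 <= d ^+ 2.
  by rewrite -(real_normK (num_real (x - y))) lerXn2r ?nnegrE ?normc_ge0// ler_normc_dist.
have mw : m ^+ 2 - w ^+ 2 <= 4^-1 * d ^+ 2.
  by rewrite w2 /m; have := sqr_ge0 (x - y); nra.
have h1 := powR_midpoint q2 x0 ab bL; rewrite -/m in h1.
have h2 : m `^ q - w `^ q <= q * L `^ (q - 2) * (4^-1 * d ^+ 2).
  have [mlew|wm] := leP m w.
    apply: (@le_trans _ _ 0); first by rewrite subr_le0 ge0_ler_powR ?nnegrE ?(ltW q0).
    by apply: mulr_ge0; apply: mulr_ge0; rewrite ?sqr_ge0 ?(ltW q0) ?invr_ge0.
  apply: (le_trans (powR_tangent q2 m0 mL w0)).
  rewrite ler_wpM2l ?mulr_ge0 ?(ltW q0)//; apply: le_trans mw.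
  rewrite ger0_norm ?subr_ge0 ?(ltW wm)//; have := ltW wm; nra.
have h3 : q * (q - 1) / 2 * L `^ (q - 2) * (x - y) ^+ 2 <= q * (q - 1) / 2 * L `^ (q - 2) * d ^+ 2.
  by rewrite ler_wpM2l// !mulr_ge0// ?subr_ge0; lra.
apply: (le_trans h1); apply: (le_trans (lerD (lexx _) h3)).
rewrite [leRHS](_ : _ = 2 * (w `^ q + q * L `^ (q - 2) * (4^-1 * d ^+ 2)) +
  q * (q - 1) / 2 * L `^ (q - 2) * d ^+ 2); last by field.
rewrite lerD2r ler_pM2l//; lra.
Qed.

(* The factor of [h] on the right is arbitrarily small for large [T]. *)
Lemma powR_sublinear (s h T : R) : 0 <= s -> s <= 1 -> 0 <= h -> 0 < T ->
  h `^ s <= T `^ s + T `^ (s - 1) * h.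
Proof.
move=> s0 s1 h0 T0.
have hT : h = T * (h / T) by field; rewrite gt_eqF.
have x0 : 0 <= h / T by rewrite divr_ge0// ltW.
have TE : T `^ (s - 1) * h = T `^ s * (h / T).
  have Tn : (s == 1) ==> (T != 0) by apply/implyP => _; rewrite gt_eqF.
  by rewrite (powRB Tn) powRr1 ?(ltW T0)// mulrAC -mulrA.
rewrite TE {1}hT powRM ?(ltW T0)// -{2}[T `^ s]mulr1 -mulrDr ler_wpM2l ?powR_ge0//.
have [x1|x1] := leP 1 (h / T).
  by apply: (le_trans (ler1_powR x1 s1)); rewrite lerDr.
apply: (@le_trans _ _ 1); last by rewrite lerDl.
have := @ge0_ler_powR _ _ s0 (h / T) 1; rewrite !nnegrE powR1; apply => //; exact: ltW.
Qed.

End PowerInequalities.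

Section Power.
Context {R : realType} {G : metricGraph R}.
Local Notation mu := (gmeasure G).
Local Notation X := (gpoint G -> Rcomplex R).
Local Notation Re := complex.Re.
Local Notation Im := complex.Im.
Implicit Types (u v w f g : X) (e : edge G) (x y : R) (p : gpoint G).
Hypotheses (conn : connected [set: gpoint G]) (cnt : countable [set: edge G]).
Variables (K : set (gpoint G)) (q : R).
Hypotheses (mK : measurable K) (q2 : 2 < q) (q6 : q < 6).

Definition Phi u : R := \int[mu]_(p in K) (normc (u p) `^ q).
Definition psi u : R := \int[mu]_(p in K) (normc (u p) ^+ 2).

Lemma normc_pow_measurable u : H1 u -> measurable_fun setT (fun p => normc (u p) `^ q).
Proof.
move=> hu; apply: (@measurableT_comp _ _ _ _ _ _ (@powR R ^~ q)).
  exact: measurable_powR.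
exact: measurable_normc (H1_sq hu).
Qed.

Lemma normc_pow_le u L : (forall p, normc (u p) <= L) -> forall p,
  normc (u p) `^ q <= L `^ (q - 2) * normc (u p) ^+ 2.
Proof.
move=> uL p; rewrite powR_sqr ?normc_ge0// ler_wpM2r ?sqr_ge0//.
by apply: powR_le_bound => //; exact: normc_ge0.
Qed.

Lemma psi_integrable u : sq u -> mu.-integrable K (EFin \o (fun p => normc (u p) ^+ 2)).
Proof.
by move=> su; apply: integrableS (sq_normc_integrable su).
Qed.

Lemma psi_le u : sq u -> psi u <= ip u u.
Proof.
move=> su; rewrite ip_normc -lee_fin /psi /Rintegral !fineK; last 2 first.
- exact/integrable_fin_num/sq_normc_integrable.
- exact/integrable_fin_num/psi_integrable.
apply: ge0_subset_integral => //.
- exact: measurable_int (sq_normc_integrable su).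
- by move=> p _; rewrite lee_fin sqr_ge0.
Qed.

Lemma Phi_integrable u : H1 u -> mu.-integrable K (EFin \o (fun p => normc (u p) `^ q)).
Proof.
move=> hu; have [L uL] := H1_bounded conn cnt hu.
apply: (@le_integrable_EFin _ _ _ _ K _ (fun p => L `^ (q - 2) * normc (u p) ^+ 2)) => //.
- by apply: measurable_funS (normc_pow_measurable hu).
- by move=> p _; rewrite ger0_norm ?powR_ge0// normc_pow_le.
- by apply: integrableZ_EFin => //; apply: psi_integrable; exact: H1_sq.
Qed.

Lemma Phi_ge0 u : 0 <= Phi u.
Proof. by apply: Rintegral_ge0 => p _; exact: powR_ge0. Qed.

Lemma Phi_le u L : H1 u -> (forall p, normc (u p) <= L) -> Phi u <= L `^ (q - 2) * ip u u.
Proof.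
move=> hu uL; have su := H1_sq hu; have iu := psi_integrable su.
apply: (@le_trans _ _ (L `^ (q - 2) * psi u)); last by rewrite ler_wpM2l ?powR_ge0// psi_le.
rewrite -RintegralZl//; apply: le_Rintegral => //; first exact: Phi_integrable.
  exact: integrableZ_EFin.
by move=> p _; exact: normc_pow_le.
Qed.

Lemma normcZ (t : R) (z : R[i]) : 0 <= t -> normc (t *: (z : Rcomplex R)) = t * normc z.
Proof.
move=> t0; rewrite scaleRcE Normc.normcM; congr (_ * _).
by rewrite /= expr0n /= addr0 sqrtr_sqr ger0_norm.
Qed.

Lemma Phi_scale t u : H1 u -> 0 <= t -> t <= 1 -> Phi (t *: u) <= t ^+ 2 * Phi u.
Proof.
move=> hu t0 t1; rewrite -RintegralZl//; last exact: Phi_integrable.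
apply: le_Rintegral => //.
- by apply: Phi_integrable; apply: lin_subspaceZ => //; exact: H1_subspace.
- by apply: integrableZ_EFin => //; exact: Phi_integrable.
move=> p _; rewrite normcZ// powRM ?normc_ge0// ler_wpM2r ?powR_ge0// -powR_mulrn//.
move: t0; rewrite le_eqVlt => /predU1P[<-|t0].
  by rewrite !powR0// gt_eqF// (lt_trans _ q2).
by rewrite ger_powR ?t0// ltW.
Qed.

Lemma H1_null u : H1 u -> ip u u = 0 -> forall p, u p = 0 :> R[i].
Proof.
move=> hu u0 p; apply/eqP; apply: contra_eqT u0 => up; rewrite gt_eqF//.
by apply: H1_ip_gt0 => //; exists p.
Qed.

Lemma Phi_null u : H1 u -> ip u u = 0 -> Phi u <= 0.
Proof.
move=> hu u0; rewrite le_eqVlt; apply/orP; left; apply/eqP.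
rewrite /Phi (_ : \int[mu]_(p in K) _ = \int[mu]_(p in K) (fun=> 0) p).
  by rewrite Rintegral_cst ?mul0r.
by apply: eq_Rintegral => p _; rewrite H1_null// Normc.normc0 powR0// gt_eqF// (lt_trans _ q2).
Qed.

Lemma Phi_mid u v L : H1 u -> H1 v -> (forall p, normc (u p) <= L) ->
  (forall p, normc (v p) <= L) ->
  Phi u + Phi v <= 2 * Phi (2^-1 *: (u + v)) + 2 * (q ^+ 2 / 4 * L `^ (q - 2)) * psi (u - v).
Proof.
move=> hu hv uL vL; have hs := H1_subspace (G := G).
have iu := Phi_integrable hu; have iv := Phi_integrable hv.
have hm : H1 (2^-1 *: (u + v)) by apply: lin_subspaceZ => //; exact: lin_subspaceD.
have iM := Phi_integrable hm.
have iw := psi_integrable (H1_sq (lin_subspaceB hs hu hv)).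
rewrite -!RintegralZl// -!RintegralD//; last 2 first.
- exact: integrableZ_EFin.
- exact: integrableZ_EFin.
apply: le_Rintegral => //; first exact: integrableD_EFin.
  by apply: integrableD_EFin => //; exact: integrableZ_EFin.
by move=> p _; have := normc_midpoint q2 (uL p) (vL p); rewrite -scaleRcE.
Qed.

(** The tangent inequality pointwise, then Cauchy-Schwarz. Only [u] is bounded by [L], because [v]
    will be the limit of the minimizing sequence, whose energy is not yet known to be
    nonpositive. *)
Lemma Phi_cont u v L : 0 <= L -> H1 u -> H1 v -> ip u u = 1 -> (forall p, normc (u p) <= L) ->
  Phi u - Phi v <= q * L `^ (q - 2) * Num.sqrt (ip (u - v) (u - v)).
Proof.
move=> L0 hu hv u1 uL; have hs := H1_subspace (G := G).
have huv := lin_subspaceB hs hu hv.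
have iu := Phi_integrable hu; have iv := Phi_integrable hv.
(* The moduli as functions in [X], to apply Cauchy-Schwarz for [ip] to them. *)
pose E w : X := fun p => (normc (w p))%:C%C.
have sE w : H1 w -> sq (E w).
  move=> hw; have sw := H1_sq hw; split; last exact: sqint_cst0.
  by split; [exact: measurable_normc|exact: sq_normc_integrable].
have prodE w w' p : Re (E w p) * Re (E w' p) + Im (E w p) * Im (E w' p) =
    normc (w p) * normc (w' p) by rewrite /E; move: (normc _) (normc _) => x y /=; ring.
have EE w : ip (E w) (E w) = ip w w.
  by rewrite [RHS]ip_normc; apply: eq_Rintegral => p _; rewrite expr2; exact: prodE.
have iE := ip_integrable (sE _ hu) (sE _ huv).
have c0 : 0 <= q * L `^ (q - 2) by rewrite mulr_ge0 ?powR_ge0// ltW// (lt_trans _ q2).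
apply: (@le_trans _ _ (q * L `^ (q - 2) * ip (E u) (E (u - v)))).
  apply: (@le_trans _ _ (\int[mu]_(p in K) (q * L `^ (q - 2) *
      (Re (E u p) * Re (E (u - v) p) + Im (E u p) * Im (E (u - v) p))))).
    rewrite -RintegralB//; apply: le_Rintegral => //.
    - exact: (integrableB mK iu iv).
    - by apply: integrableZ_EFin => //; apply: integrableS iE.
    move=> p _; rewrite [X in _ <= _ * X](prodE u (u - v)).
    apply: (le_trans (powR_tangent q2 (normc_ge0 _) (uL p) (normc_ge0 (v p)))).
    by rewrite ler_wpM2l// ler_wpM2l ?normc_ge0// ler_normc_dist.
  have iEK : mu.-integrable K (EFin \o (fun p => Re (E u p) * Re (E (u - v) p) + Im (E u p) * Im (E (u - v) p))).
    by apply: integrableS iE.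
  rewrite RintegralZl// ler_wpM2l// -lee_fin /ip /Rintegral !fineK; last 2 first.
  - exact: integrable_fin_num.
  - exact: integrable_fin_num.
  apply: ge0_subset_integral => //; first exact: measurable_int iE.
  by move=> p _; rewrite lee_fin [leRHS](prodE u (u - v)) mulr_ge0 ?normc_ge0.
rewrite ler_wpM2l//.
apply: (le_trans (ler_norm _)); rewrite -(@ler_pXn2r _ 2) ?nnegrE ?sqrtr_ge0//.
rewrite real_normK ?num_real// sqr_sqrtr ?ip_ge0//.
apply: (le_trans (sf_CS (sq_subspace (G := G)) (ip_form (G := G)) (fun u _ => ip_ge0 u) (sE _ hu) (sE _ huv))).
by rewrite !EE u1 mul1r.
Qed.

End Power.

(** * A priori bounds on energy sublevels *)

Section Energy.
Context {R : realType} {G : metricGraph R}.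
Local Notation mu := (gmeasure G).
Local Notation X := (gpoint G -> Rcomplex R).
Implicit Types (u v w f g : X) (e : edge G) (x y : R) (p : gpoint G).
Hypotheses (conn : connected [set: gpoint G]) (cnt : countable [set: edge G]).
Variables (K : set (gpoint G)) (q : R).
Hypotheses (mK : measurable K) (q2 : 2 < q) (q6 : q < 6).
Variables (b : X -> X -> R) (Cb : R).
Hypothesis b_coercive : forall u, H1 u -> 4^-1 * dip u u - Cb * ip u u <= b u u.

(** On the sphere the sup bound gives |u|_oo^(q-2) <= (C (1 + |u'|_2^2))^s with s = (q - 2) / 4 < 1,
    so coercivity absorbs the power term. The bound is uniform over the coefficients [k <= k1]. *)
Lemma sublevel_bound (k1 : R) : 0 < k1 -> exists2 B : R, 0 <= B & forall k u, 0 < k -> k <= k1 ->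
  H1 u -> ip u u = 1 -> energy b (Phi K q) k u <= 0 -> dip u u <= B /\ forall p, normc (u p) <= B.
Proof.
move=> k0; have [C C0 hC] := H1_sup conn cnt.
pose s := (q - 2) / 4; have [s0 s1] : 0 < s /\ s < 1 by move: q2 q6; rewrite /s; split; lra.
(* Half of [b] contains 1/8 of the Dirichlet form; this [eps] lets the power term take 1/16 of
   it. *)
pose eps := (k1 * C * 16)^-1.
have eps0 : 0 < eps by rewrite invr_gt0 !mulr_gt0.
pose T := eps `^ ((s - 1)^-1).
have T0 : 0 < T by exact: powR_gt0.
have TE : T `^ (s - 1) = eps.
  rewrite /T -powRrM mulVf ?powRr1 ?(ltW eps0)//; lra.
pose Bd := 16 * (2^-1 * Cb + k1 * T `^ s + 16^-1).
have pt_bound u p : H1 u -> ip u u = 1 -> normc (u p) ^+ 4 <= C * (1 + dip u u).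
  by move=> hu u1; have := hC u p hu; rewrite u1 mul1r.
have main k u : 0 < k -> k <= k1 -> H1 u -> ip u u = 1 ->
    energy b (Phi K q) k u <= 0 -> dip u u <= Bd.
  move=> kk0 kk1 hu u1; have d0 : 0 <= dip u u by exact: ip_ge0.
  pose h := C * (1 + dip u u).
  have h0 : 0 <= h by rewrite mulr_ge0 ?(ltW C0)// addr_ge0.
  have PhiB : Phi K q u <= h `^ s.
    have uL p : normc (u p) <= h `^ 4^-1.
      rewrite -(@ler_pXn2r _ 4) ?nnegrE ?normc_ge0 ?powR_ge0//.
      rewrite -[leRHS]powR_mulrn ?powR_ge0// -powRrM mulVf// powRr1//.
      exact: pt_bound.
    apply: (le_trans (Phi_le conn cnt mK q2 hu uL)); rewrite u1 mulr1 -powRrM.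
    by rewrite /s mulrC.
  have h1 := powR_sublinear (ltW s0) (ltW s1) h0 T0; rewrite TE in h1.
  rewrite /energy => E; have := b_coercive hu; rewrite u1 mulr1.
  have h2 : k * Phi K q u <= k1 * (T `^ s + eps * h).
    apply: ler_pM => //; [exact: ltW|exact: Phi_ge0|exact: le_trans PhiB h1].
  have h3 : k1 * (eps * h) = 16^-1 * (1 + dip u u).
    by rewrite /eps /h; field; rewrite !gt_eqF.
  by rewrite mulrDr h3 in h2; rewrite /Bd; lra.
exists (`|Bd| + 1 + C * (1 + `|Bd|)).
  by rewrite !addr_ge0// mulr_ge0 ?addr_ge0// ltW.
move=> k u kk0 kk1 hu u1 E; have dB : dip u u <= `|Bd|.
  exact: le_trans (main k u kk0 kk1 hu u1 E) (ler_norm _).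
have CB0 : 0 <= C * (1 + `|Bd|) by rewrite mulr_ge0 ?addr_ge0// ltW.
have B0 : 0 <= `|Bd| by [].
split; first lra.
move=> p; have := pt_bound u p hu u1; set x := normc _ => h.
have x0 : 0 <= x by exact: normc_ge0.
have hx : x ^+ 4 <= C * (1 + `|Bd|).
  by apply: (le_trans h); rewrite ler_pM2l// lerD2l.
have [x1|/ltW x1] := leP x 1; first lra.
have : x <= x ^+ 4 by rewrite ler_eXnr.
lra.
Qed.

End Energy.

(** * Compactness along ultrafilters *)

(* A bounded sequence has a limit along an ultrafilter; only the Cauchy
   property is needed. *)
Lemma ultra_cauchy {R : realType} (U : set_system nat) (f : nat -> R) (B e : R) :
  UltraFilter U -> (forall n, `|f n| <= B) -> 0 < e ->
  exists2 A, U A & forall n m, A n -> A m -> `|f n - f m| <= e.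
Proof.
move=> UU fB e0.
have H k : U [set n | - B <= f n <= - B + k%:R * e] ->
    exists2 A, U A & forall n m, A n -> A m -> `|f n - f m| <= e.
  elim: k => [|k IH] Uk.
    exists [set n | - B <= f n <= - B + 0%:R * e] => //.
    by move=> n m /=; rewrite mul0r addr0 => /andP[? ?] /andP[? ?]; rewrite ler_norml; apply/andP; split; lra.
  have [Uk'|Uk'] := in_ultra_setVsetC [set n | f n <= - B + k%:R * e] UU.
    apply: IH; apply: filterS2 Uk Uk' => n /= /andP[h1 _] h2; exact/andP.
  exists ([set n | - B <= f n <= - B + k.+1%:R * e] `&` ~` [set n | f n <= - B + k%:R * e]).
    exact: filterI.
  move=> n m [/= /andP[_ h1] /negP]; rewrite -ltNge => h2 [/= /andP[_ h3] /negP].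
  rewrite -ltNge => h4; rewrite -natr1 mulrDl mul1r in h1 h3.
  by rewrite ler_norml; apply/andP; split; lra.
apply: (H (Num.bound ((B + B) / e))); apply: filterS filterT => n _ /=.
have := fB n; rewrite ler_norml => /andP[-> h] /=; apply: (le_trans h).
rewrite -lerBlDl opprK -ler_pdivrMr//; apply/ltW/archi_boundP.
by rewrite divr_ge0 ?(ltW e0)//; have := le_trans (normr_ge0 _) (fB n); lra.
Qed.

(** * Bounded subgraphs have edges of finite length *)

Section Bounded.
Context {R : realType} {G : metricGraph R}.
Local Notation mu := (gmeasure G).
Local Notation lam := (@lebesgue_measure R).
Implicit Types (e : edge G) (x y : R) (p : gpoint G) (F : set (edge G)).

(* The coordinate of a ray, extended by 0, is 1-Lipschitz. *)
Lemma ray_dist e x : len G e = +oo%E -> 0 <= x -> (x%:E <= gdist (pt e 0) (pt e x))%E.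
Proof.
move=> el x0; pose phi p := if edge_of p == e then Defs.coord p else 0.
have on z : 0 <= z -> on_interval (e, z) by move=> z0; rewrite /on_interval /= z0 el leey.
have phiE z : 0 <= z -> phi (pt e z) = z.
  by move=> z0; rewrite /phi edge_of_pt eqxx /Defs.coord val_pt// on.
have vtx p v : at_vertex p v -> phi p = 0.
  rewrite /phi => -[[c0 _]|[cl _]]; first by rewrite c0; case: ifP.
  by case: eqVneq => // E; move: cl; rewrite E el.
have hopL p p' : (`|phi p - phi p'|%:E <= hop p p')%E.
  rewrite /hop; case: ifP => [/asboolP[v [h1 h2]]|_].
    by rewrite (vtx _ _ h1) (vtx _ _ h2) subrr normr0.
  case: ifP => [/eqP E|_]; last by rewrite leey.
  by rewrite /phi E lee_fin; case: ifP => // _; rewrite subrr normr0.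
have pathL s p : (`|phi p - phi (last p s)|%:E <= path_len p s)%E.
  elim: s p => [|p' s IH] p /=; first by rewrite subrr normr0.
  apply: (le_trans _ (leeD (hopL p p') (IH p'))); rewrite -EFinD lee_fin.
  by rewrite (_ : _ - _ = (phi p - phi p') + (phi p' - phi (last p' s))) ?ler_normD//; ring.
apply: le_ereal_inf_tmp => _ [s /= sx <-]; apply: le_trans (pathL s _).
by rewrite sx !phiE// sub0r normrN lee_fin ler_norm.
Qed.

(** A ray contains points arbitrarily far from its origin, by [ray_dist]. *)
Lemma gbounded_len F e : gbounded (subgraph F) -> F e -> (len G e < +oo)%E.
Proof.
move=> [r hr] Fe; rewrite ltey; apply/eqP => el.
have S x : subgraph F (pt e x) by rewrite /subgraph /= edge_of_pt.
have h : 0 <= `|r| + 1 by rewrite addr_ge0.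
have := le_trans (ray_dist el h) (hr _ _ (S 0) (S (`|r| + 1))).
rewrite lee_fin => h'; have := ler_norm r; lra.
Qed.

Lemma gmeasure_edge e (A : set (gpoint G)) : A `<=` subgraph [set e] -> mu A = lam (slice e A).
Proof.
move=> Ae; rewrite /gmeasure/=.
rewrite (@esum_mkcond _ _ setT) -(@esum_set1 _ _ e (fun e => lam (slice e A)))//.
rewrite [in RHS]esum_mkcond; apply: eq_esum => e' _; rewrite in_setT.
case: ifPn => // /negP nee'; rewrite (_ : slice e' A = set0) ?measure0//.
apply/seteqP; split => // x [p Ap px]; apply: nee'; rewrite inE /=.
by have := Ae _ Ap; rewrite /subgraph /= => <-; rewrite /edge_of px.
Qed.

Lemma measurable_subgraph F : measurable (subgraph F).
Proof.
move=> e; case: (pselect (F e)) => Fe.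
  rewrite (_ : slice e _ = slice e setT); first exact: measurable_sliceT.
  apply/seteqP; split => x [p _ px]; exists p => //.
  by rewrite /subgraph /= /edge_of px.
rewrite (_ : slice e _ = set0)//; apply/seteqP; split => // x [p].
by rewrite /subgraph /= /edge_of => Fp px; apply: Fe; rewrite px in Fp.
Qed.

Lemma gmeasure_subgraph_finite (s : seq (edge G)) : (forall e, e \in s -> (len G e < +oo)%E) ->
  (mu (subgraph [set` s]) < +oo)%E.
Proof.
elim: s => [|e s IH] hs.
  rewrite (_ : subgraph _ = set0) ?measure0 ?ltry//; apply/seteqP; split => // p.
apply: (@le_lt_trans _ _ (mu (subgraph [set e] `|` subgraph [set` s]))).
  apply: le_measure; rewrite ?inE; try exact: measurable_subgraph.
    by apply: measurableU; exact: measurable_subgraph.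
  by move=> p; rewrite /subgraph /= inE => /orP[/eqP|]; [left|right].
apply: (le_lt_trans (measureU2 _ _ _)); try exact: measurable_subgraph.
apply: lte_add_pinfty; last by apply: IH => e' e's; apply: hs; rewrite inE e's orbT.
suff : (mu (subgraph [set e]) < +oo)%E by [].
rewrite (gmeasure_edge (@subset_refl _ (subgraph [set e]))).
have := hs e; rewrite inE eqxx => /(_ isT); have := len_gt0 e.
case El : (len G e) => [l||] // l0 _.
apply: (@le_lt_trans _ _ (lam (`[0, l]%classic : set R))).
  apply: le_measure; rewrite ?inE; first exact: measurable_subgraph.
    exact: measurable_itv.
  move=> x [[a /= ha] _ /= ax]; move: ha; rewrite ax /on_interval /= El lee_fin in_itv /=.
  by [].
by rewrite lebesgue_measure_itv /=; case: ifP => _; rewrite ?ltry// -EFinB ltry.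
Qed.

End Bounded.

(** * Equicontinuity and completeness along filters on the naturals *)

Section Compactness.
Context {R : realType} {G : metricGraph R}.
Local Notation mu := (gmeasure G).
Local Notation X := (gpoint G -> Rcomplex R).
Local Notation Re := complex.Re.
Local Notation Im := complex.Im.
Implicit Types (u v w f g : X) (e : edge G) (x y : R) (p : gpoint G).

Lemma dip_sqrB_le u v : H1 u -> H1 v -> dip (u - v) (u - v) <= 2 * dip u u + 2 * dip v v.
Proof.
move=> hu hv; have hs := H1_subspace (G := G); have sd := dip_form (G := G).
have h0 : 0 <= dip (u + v) (u + v) := ip_ge0 _.
rewrite (sf_sqrB hs sd)//; rewrite (sf_sqrD hs sd)// in h0.
by move: (dip u u) (dip u v) (dip v v) h0 => x y t h0; lra.
Qed.

(* Without this [lra] unfolds the integrals when it compares atoms. *)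
Local Opaque ip wderiv.

Section Ultra.
Variables (U : set_system nat) (u : nat -> X) (B : R).
Hypotheses (UU : UltraFilter U) (hu : forall n, H1 (u n)).
Hypotheses (uB : forall n p, normc (u n p) <= B) (dB : forall n, dip (u n) (u n) <= B).

Lemma dip_sqrB_bound n m : dip (u n - u m) (u n - u m) <= 4 * B.
Proof.
apply: (le_trans (dip_sqrB_le (hu n) (hu m))); have := dB n; have := dB m.
by move: (dip (u n) _) (dip (u m) _) => x y; lra.
Qed.

Lemma ultra_point p (eps : R) : 0 < eps ->
  exists2 A, U A & forall n m, A n -> A m -> normc (u n p - u m p) <= eps.
Proof.
move=> eps0; have e2 : 0 < eps / 2 by rewrite divr_gt0.
have [A1 UA1 h1] := ultra_cauchy UU (fun n => le_trans (Re_le_normc (u n p)) (uB n p)) e2.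
have [A2 UA2 h2] := ultra_cauchy UU (fun n => le_trans (Im_le_normc (u n p)) (uB n p)) e2.
exists (A1 `&` A2); first exact: filterI.
move=> n m [n1 n2] [m1 m2]; apply: (le_trans (normc_le_ReIm _)); rewrite !raddfB.
by have := h1 n m n1 m1; have := h2 n m n2 m2; lra.
Qed.

(** An Arzela-Ascoli argument: the Cauchy property at one point in each of finitely many short
    intervals spreads to the edge through the common Hoelder bound. *)
Lemma ultra_edge e (eps : R) : (len G e < +oo)%E -> 0 < eps ->
  exists2 A, U A & forall n m, A n -> A m -> forall p, edge_of p = e ->
    normc (u n p - u m p) <= eps.
Proof.
case El : (len G e) => [l||] // _ eps0; last by have := len_gt0 e; rewrite El.
have hs := H1_subspace (G := G).
have B0 : 0 <= B := le_trans (normc_ge0 _) (uB 0%N point).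
(* [s] brings the derivative term of [H1_hoelder] below eps/6, and [d] the distance term. With eps/6
   at the chosen point this makes eps/2; the other half pays for the passage to endpoints. *)
pose s := 48 * B / eps + 1; have s0 : 0 < s by rewrite ltr_wpDl// divr_ge0 ?(ltW eps0)// mulr_ge0.
have sB : s^-1 * (2 * (4 * B)) <= eps / 6.
  rewrite mulrC ler_pdivrMr// /s mulrDr mulr1 [X in X + _](_ : _ = 8 * B); last first.
    by field; rewrite gt_eqF.
  by lra.
pose d := eps / (6 * s); have d0 : 0 < d by rewrite divr_gt0// mulr_gt0.
have sd : s * d = eps / 6 by rewrite /d; field; rewrite gt_eqF.
have chain k : exists2 A, U A & forall n m, A n -> A m -> forall x, open_edge e x ->
    x <= k%:R * d -> normc (u n (pt e x) - u m (pt e x)) <= eps / 2.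
  elim: k => [|k [A UA hA]].
    exists setT; first exact: filterT.
    by move=> n m _ _ x [x0 _]; rewrite mul0r leNgt x0.
  (* If the new interval contains no point of the open edge, there is nothing to add. *)
  case: (pselect (exists2 x0, open_edge e x0 & k%:R * d < x0 <= k.+1%:R * d)); last first.
    move=> no; exists A => // n m An Am x ex xk; apply: hA => //.
    by rewrite leNgt; apply/negP => kx; apply: no; exists x => //; rewrite kx.
  move=> [x0 ex0 /andP[kx0 x0k]].
  have e6 : 0 < eps / 6 by rewrite divr_gt0.
  have [A' UA' hA'] := ultra_point (pt e x0) e6.
  exists (A `&` A'); first exact: filterI.
  move=> n m [An A'n] [Am A'm] x ex xk; have [xk'|kx] := leP x (k%:R * d); first exact: hA.
  have hw := lin_subspaceB hs (hu n) (hu m).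
  have := H1_hoelder hw ex0 ex s0.
  have : s^-1 * (2 * ip (wderiv (u n - u m)) (wderiv (u n - u m))) <= eps / 6.
    apply: le_trans sB; rewrite ler_wpM2l ?invr_ge0 ?(ltW s0)// ler_pM2l//.
    exact: dip_sqrB_bound.
  have : s * `|x - x0| <= eps / 6.
    rewrite -sd ler_pM2l//; rewrite -natr1 mulrDl mul1r in x0k xk.
    by rewrite ler_norml; apply/andP; split; lra.
  have h1 : normc ((u n - u m) (pt e x0)) <= eps / 6 := hA' n m A'n A'm.
  have := le_normcD ((u n - u m) (pt e x) - (u n - u m) (pt e x0)) ((u n - u m) (pt e x0)).
  rewrite subrK => h2 h3 h4 h5.
  suff : normc ((u n - u m) (pt e x)) <= eps / 2 by [].
  move: h1 h2 h3 h4 h5; set y1 := normc _; set y2 := normc _; set y3 := normc _.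
  by move: (s * _) (s^-1 * _) => z1 z2; clearbody y1 y2 y3; lra.
(* Enough steps of length [d] to exhaust the edge. *)
have [A UA hA] := chain (Num.bound (l / d)).
exists A => // n m An Am p pe.
have hw := lin_subspaceB hs (hu n) (hu m); have /H1E[cw _ _ _] := hw.
have ep : on_interval (e, Defs.coord p) by rewrite -pe; case: p {pe} => -[].
have e2 : 0 < eps / 2 by rewrite divr_gt0.
have [dd dd0 hd] := continuous_pt cw ep e2.
have [y ey yd] := open_edge_dense ep dd0.
have := hd y (open_edge_on ey) yd; rewrite -{1}pe ptK => h1.
have yl : y <= (Num.bound (l / d))%:R * d.
  case: ey => _; rewrite El lte_fin => yl; apply: (le_trans (ltW yl)).
  rewrite -ler_pdivrMr//; apply/ltW/archi_boundP; rewrite divr_ge0 ?(ltW d0)//.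
  by have := len_gt0 e; rewrite El lte_fin => /ltW.
have h2 : normc ((u n - u m) (pt e y)) <= eps / 2 := hA n m An Am y ey yl.
have := le_normcD ((u n - u m) p - (u n - u m) (pt e y)) ((u n - u m) (pt e y)).
rewrite subrK => h3; suff : normc ((u n - u m) p) <= eps by [].
move: h1 h2 h3; set y1 := normc _; set y2 := normc _; set y3 := normc _.
by clearbody y1 y2 y3; lra.
Qed.

Lemma ultra_edges (s : seq (edge G)) (eps : R) : (forall e, e \in s -> (len G e < +oo)%E) ->
  0 < eps -> exists2 A, U A & forall n m, A n -> A m -> forall p, edge_of p \in s ->
    normc (u n p - u m p) <= eps.
Proof.
move=> + eps0; elim: s => [|e s IH] hs; first by exists setT => //; exact: filterT.
have [|A UA hA] := IH; first by move=> e' e's; apply: hs; rewrite inE e's orbT.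
have [|A' UA' hA'] := @ultra_edge e eps _ eps0; first by apply: hs; rewrite inE eqxx.
exists (A `&` A'); first exact: filterI.
by move=> n m [? ?] [? ?] p; rewrite inE => /orP[/eqP|]; [exact: hA'|exact: hA].
Qed.

Lemma ultra_psi (F : set (edge G)) (eps : R) : finite_set F ->
  (forall e, F e -> (len G e < +oo)%E) -> 0 < eps ->
  exists2 A, U A & forall n m, A n -> A m -> psi (subgraph F) (u n - u m) <= eps.
Proof.
move=> /finite_seqP[s Fs] hF eps0; rewrite Fs.
have hs e : e \in s -> (len G e < +oo)%E by move=> es; apply: hF; rewrite Fs.
have mK := measurable_subgraph (G := G) [set` s].
have muK := gmeasure_subgraph_finite hs.
pose k := fine (mu (subgraph [set` s])); have k0 : 0 <= k by exact: fine_ge0.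
pose d := Num.sqrt (eps / (k + 1)).
have d0 : 0 < d by rewrite sqrtr_gt0 divr_gt0// ltr_wpDl.
have [A UA hA] := ultra_edges hs d0.
exists A => // n m An Am.
have hw : H1 (u n - u m) := lin_subspaceB (H1_subspace (G := G)) (hu n) (hu m).
have iw := psi_integrable mK (H1_sq hw).
apply: (@le_trans _ _ (d ^+ 2 * k)); last first.
  have k1 : 0 < k + 1 by rewrite ltr_wpDl.
  rewrite sqr_sqrtr ?divr_ge0 ?(ltW eps0) ?(ltW k1)//.
  by rewrite -mulrA ler_piMr ?(ltW eps0)// mulrC ler_pdivrMr// mul1r lerDl.
rewrite -lee_fin /psi /Rintegral fineK; last exact: integrable_fin_num.
rewrite EFinM /k fineK; last by rewrite ge0_fin_numE.
rewrite -integral_cst//; apply: ge0_le_integral => //.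
- by move=> p _; rewrite lee_fin sqr_ge0.
- exact: measurable_int iw.
move=> p Kp; rewrite lee_fin lerXn2r ?nnegrE ?normc_ge0 ?(ltW d0)//.
exact: hA.
Qed.

End Ultra.

Section Complete.
Hypotheses (conn : connected [set: gpoint G]) (cnt : countable [set: edge G]).
Variables (b : X -> X -> R) (Cb : R).
Hypotheses (Cb0 : 0 <= Cb) (b_ge0 : forall u, H1 u -> 0 <= b u u).
Hypothesis b_bounds : forall u, H1 u ->
  4^-1 * dip u u - Cb * ip u u <= b u u /\ b u u <= 3 * dip u u + Cb * ip u u.

Lemma complete_filter (U : nat -> X) (F : set_system nat) : (forall n, H1 (U n)) ->
  ProperFilter F -> (forall N, F [set n | (N <= n)%N]) ->
  (forall e : R, 0 < e -> exists2 A, F A & forall n m, A n -> A m ->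
      b (U n - U m) (U n - U m) + ip (U n - U m) (U n - U m) <= e) ->
  exists2 u, H1 u & forall (e : R) (N : nat), 0 < e -> exists2 n, (N <= n)%N &
    b (U n - u) (U n - u) + ip (U n - u) (U n - u) <= e.
Proof.
move=> hU FF Foo H; have hs := H1_subspace (G := G); have Cb0' := Cb0.
(* The lower bound on [b] gives dip <= 4 b + 4 Cb ip, hence [h1 <= c * (b + ip)]. *)
pose c := 4 * Cb + 5; have c0 : 0 < c by rewrite /c; lra.
have hB n m : H1 (U n - U m) by exact: lin_subspaceB.
have [|s [sn hs']] := @proper_filter_subseq R F
    (fun n m => c * (b (U n - U m) (U n - U m) + ip (U n - U m) (U n - U m))) FF Foo.
  move=> e e0; have ec : 0 < e / c by rewrite divr_gt0.
  have [A FA hA] := H _ ec; exists A => // n m An Am.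
  by rewrite mulrC -ler_pdivlMr//; exact: hA.
have h1_le w : H1 w -> h1 w w <= c * (b w w + ip w w).
  move=> hw; have [h _] := b_bounds hw; have := b_ge0 hw; have := ip_ge0 w.
  have : 0 <= Cb * b w w by rewrite mulr_ge0// b_ge0.
  by rewrite /h1 /c; lra.
have [n|n m nm|u [hu hl]] := @H1_complete R G (fun n => U (s n)) conn cnt.
- exact: hU.
- exact: le_trans (h1_le _ (hB _ _)) (hs' n m nm).
exists u => // e N e0.
(* [b + ip] is at most [(4 + Cb) * h1]; the factor 4 comes from [H1_complete]. *)
pose K := (4 + Cb) * 4; have K0 : 0 < K by rewrite /K; lra.
have [n Nn hn] : exists2 n, (N <= n)%N & K * 8^-1 ^+ n.+1 <= e.
  have : (K * 8^-1) * 8^-1 ^+ n @[n --> \oo] --> (K * 8^-1) * 0.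
    apply: cvgM; first exact: cvg_cst.
    by apply: cvg_expr; rewrite ger0_norm// invf_lt1// ltr1n.
  rewrite mulr0 => /cvgr_le /(_ e e0) [N' _ hN'].
  exists (maxn N N'); first exact: leq_maxl.
  by have := hN' (maxn N N') (leq_maxr _ _); rewrite /= -mulrA -exprS.
exists (s n); first exact: leq_trans Nn (sn n).
have hw : H1 (U (s n) - u) by exact: lin_subspaceB.
apply: le_trans hn; have [_ h] := b_bounds hw; have h' := hl n; rewrite /h1 in h'.
apply: (@le_trans _ _ ((4 + Cb) * (ip (U (s n) - u) (U (s n) - u) + dip (U (s n) - u) (U (s n) - u)))).
  have : 0 <= Cb * dip (U (s n) - u) (U (s n) - u) by rewrite mulr_ge0// ip_ge0.
  by have := ip_ge0 (U (s n) - u); have : 0 <= dip (U (s n) - u) (U (s n) - u) := ip_ge0 _; lra.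
by rewrite /K -mulrA ler_pM2l//; lra.
Qed.

End Complete.

End Compactness.

(** * Existence of minimizers *)

Section Minimizers.
Context {R : realType} {G : metricGraph R}.
Local Notation mu := (gmeasure G).
Local Notation X := (gpoint G -> Rcomplex R).
Local Notation H1s := (@H1 R G : set X).
Implicit Types (u v w f g : X) (e : edge G) (x y : R) (p : gpoint G).
Hypotheses (conn : connected [set: gpoint G]) (cnt : countable [set: edge G]).
Variables (F : set (edge G)) (q : R) (V M : gpoint G -> R).
Hypotheses (q2 : 2 < q) (q6 : q < 6).
Hypotheses (bM : bounded_coef M) (bV : sqint_plus_bounded V).
Local Notation K := (subgraph F).
Variables (c : R) (u0 : X).
Hypotheses (cE : c%:E = einf (spectrum V M)) (eu0 : eigenfunction V M c u0).
Hypothesis u0K : exists2 p, K p & u0 p != 0.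

Local Notation b := (shifted V M c).
Local Notation J k := (energy b (Phi K q) k).
Local Notation S := (sphere H1s (@ip R G)).

Let mK : measurable K := measurable_subgraph F.
Let hs := H1_subspace (G := G).
Let sb : sym_form H1s b := shifted_form conn cnt bM bV c.
Let b_ge0 v : H1 v -> 0 <= b v v.
Proof.
move=> hv; rewrite /shifted subr_ge0.
exact: (bottom_spectrum conn cnt bM bV cE eu0).
Qed.

Lemma sphereE u : S u <-> admissible u.
Proof. by rewrite /sphere /admissible -ip_normc. Qed.

(** Shifting the form by [c] changes the energy on the sphere by the constant c / 2, so both have
    the same minimizers. *)
Lemma NLS_energyE m u : H1 u ->
  NLS_energy V M K q m u = J (m / q) u + 2^-1 * (c * ip u u).
Proof.
move=> hu; rewrite /NLS_energy /energy /shifted /af.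
rewrite (_ : \int[mu]_p _ = ip (momentum M u) (momentum M u) + vf V u u).
  by rewrite /Phi; ring.
rewrite -RintegralD//; last 2 first.
- by apply: ip_integrable; exact: momentum_sq.
- exact: vf_integrable.
by apply: eq_Rintegral => p _; rewrite !normcE2; ring.
Qed.

Lemma minimizer_of_energy m u : S u -> (forall v, S v -> J (m / q) u <= J (m / q) v) ->
  NLS_minimizer V M K q m u.
Proof.
move=> Su hu; split; first exact/sphereE.
have E v : S v -> NLS_energy V M K q m v = J (m / q) v + 2^-1 * c.
  by move=> [hv v1]; rewrite NLS_energyE// v1 mulr1.
apply/eqP; rewrite eq_le; apply/andP; split.
  apply: le_ereal_inf_tmp => _ [_ [v /sphereE Sv <-] <-].
  by rewrite lee_fin (E _ Su) (E _ Sv) lerD2r hu.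
by apply: ereal_inf_lbound; exists (NLS_energy V M K q m u) => //; exists u => //; exact/sphereE.
Qed.

(** With [p] a subgraph contains its whole edge. So even if [p] is a vertex, there is an interval of
    interior points in [K], near [p], where the modulus is at least half of that at [p]. *)
Lemma Phi_ground_gt0 : 0 < Phi K q u0.
Proof.
have [p Kp up] := u0K; have [/(form_eigenspaceP conn cnt bM bV)[hu _] _] := eu0.
have /H1E[cu _ _ _] := hu.
have np : 0 < normc (u0 p).
  by rewrite lt_def normc_ge0 andbT; apply: contraNneq up => /Normc.eq0_normc ->.
set e := edge_of p; have ep : on_interval (e, Defs.coord p) by rewrite /e; case: p {Kp up np e} => -[].
have h2 : 0 < normc (u0 p) / 2 by rewrite divr_gt0.
have [d d0 hd] := continuous_pt cu ep h2.
have [x ex xd] := open_edge_dense ep d0.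
have [dd dd0 hdd] : exists2 dd : R, 0 < dd & forall y, `|x - y| < dd ->
    open_edge e y /\ `|Defs.coord p - y| < d.
  have /nbhs_ballP[d1 d10 hd1] := near_open_edge ex.
  exists (Num.min d1 (d - `|Defs.coord p - x|)).
    by rewrite lt_min d10 subr_gt0.
  move=> y; rewrite lt_min => /andP[y1 y2]; split; first exact: hd1.
  by have := ler_distD x (Defs.coord p) y; lra.
pose I : set R := `]x - dd / 2, x + dd / 2[%classic.
have IE y : I y -> open_edge e y /\ normc (u0 p) / 2 <= normc (u0 (pt e y)).
  rewrite /I /= in_itv /= => /andP[y1 y2].
  have [|ey yd] := hdd y; first by rewrite ltr_norml; apply/andP; split; lra.
  split => //; have := hd y (open_edge_on ey) yd; rewrite ptK => h.
  have := ler_normc_dist (u0 p) (u0 (pt e y)); have := ler_norm (normc (u0 p) - normc (u0 (pt e y))).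
  lra.
pose A := [set r | edge_of r = e /\ I (Defs.coord r)].
have Ae : A `<=` subgraph [set e] by move=> r [].
have sA : slice e A = I.
  apply/seteqP; split => y; first by move=> [r [_ Ir] ry]; move: Ir; rewrite /Defs.coord ry.
  move=> Iy; have [ey _] := IE y Iy; exists (pt e y).
    by split; rewrite ?edge_of_pt// /Defs.coord val_pt//; exact: open_edge_on.
  by rewrite val_pt//; exact: open_edge_on.
have muA : mu A = dd%:E.
  rewrite (gmeasure_edge Ae) sA /I lebesgue_measure_itv /= lte_fin.
  by rewrite (_ : _ < _ = true) -?EFinB; [congr EFin; field|apply/idP; lra].
have mA : measurable A.
  move=> e'; case: (pselect (e' = e)) => [->|ne]; first by rewrite sA; exact: measurable_itv.
  rewrite (_ : slice e' A = set0)//; apply/seteqP; split => // y [r [re _] ry].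
  by apply: ne; rewrite -re /edge_of ry.
have AK : A `<=` K by move=> r [re _]; rewrite /subgraph /= re; exact: Kp.
have iP := Phi_integrable conn cnt mK q2 hu.
apply: (@lt_le_trans _ _ ((normc (u0 p) / 2) `^ q * dd)).
  by rewrite mulr_gt0// powR_gt0.
rewrite -lee_fin /Phi /Rintegral fineK; last exact: integrable_fin_num.
rewrite EFinM -muA -integral_cst//.
apply: (@le_trans _ _ (\int[mu]_(r in A) (normc (u0 r) `^ q)%:E)%E).
  apply: ge0_le_integral => //.
  - by move=> r _; rewrite lee_fin powR_ge0.
  - exact: measurable_funS (measurable_int _ iP).
  move=> r [re Ir]; rewrite lee_fin; have [_] := IE _ Ir; rewrite -re ptK => h.
  rewrite ge0_ler_powR ?nnegrE ?normc_ge0 ?(ltW h2)//.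
  by apply/ltW; apply: lt_trans q2.
apply: ge0_subset_integral => //; first exact: measurable_int iP.
by move=> r _; rewrite lee_fin powR_ge0.
Qed.

Lemma psi_ge0 u : 0 <= psi K u.
Proof. by apply: Rintegral_ge0 => p _; exact: sqr_ge0. Qed.

Lemma Phi_scaleE s u : H1 u -> 0 < s -> Phi K q (s *: u) = s `^ q * Phi K q u.
Proof.
move=> hu s0; rewrite /Phi -RintegralZl//; last exact: Phi_integrable.
by apply: eq_Rintegral => p _; rewrite normcZ ?(ltW s0)// powRM ?normc_ge0 ?(ltW s0).
Qed.

Local Opaque ip wderiv Phi psi.

(** [L] depends on [k1] but not on [k], so a smallness condition on the coefficient may refer to
    [L]. What is left as a premise is the only point where bounded subgraphs and small coefficients
    are treated differently. *)
Lemma minimizer_from_compactness (k1 : R) : 0 < k1 -> exists2 L : R, 0 <= L &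
  forall k, 0 < k -> k <= k1 ->
  (forall U : nat -> X, (forall n, S (U n)) -> (forall n, dip (U n) (U n) <= L) ->
    (forall n p, normc (U n p) <= L) ->
    exists Fl : set_system nat, [/\ ProperFilter Fl, (forall N, Fl [set n | (N <= n)%N]) &
    forall e : R, 0 < e -> exists2 A, Fl A & forall n m, A n -> A m ->
      k * (q ^+ 2 / 4 * L `^ (q - 2)) * psi K (U n - U m) <=
      16^-1 * b (U n - U m) (U n - U m) + e]) ->
  exists2 u, S u & forall v, S v -> J k u <= J k v.
Proof.
move=> k10; have [C C0 hC] := af_coercive conn cnt bM bV.
have bnd u : H1 u -> 4^-1 * dip u u - (C + `|c|) * ip u u <= b u u /\
    b u u <= 3 * dip u u + (C + `|c|) * ip u u.
  move=> hu; have [h1 h2] := hC u hu; rewrite /shifted.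
  have i0 := ip_ge0 u; have := ler_wpM2r i0 (ler_norm c); have := ler_wpM2r i0 (ler_norm (- c)).
  by rewrite normrN; split; lra.
have CC : 0 <= C + `|c| by rewrite addr_ge0// ltW.
have bc u (hu : H1 u) := (bnd u hu).1.
have [L L0 hL] := sublevel_bound conn cnt mK q2 q6 bc k10.
exists L => // k k0 kk1 comp.
have [/(form_eigenspaceP conn cnt bM bV)[hu0 au0] nz] := eu0.
have ip0 := H1_ip_gt0 conn cnt hu0 nz.
have sub u : S u -> J k u <= 0 -> dip u u <= L /\ forall p, normc (u p) <= L.
  by move=> [hu u1] Ju; exact: hL k u k0 kk1 hu u1 Ju.
apply: (@minimizer_exists R X H1s (@ip R G) b (Phi K q) (psi K) k
  (q ^+ 2 / 4 * L `^ (q - 2)) (3 * L + (C + `|c|)) hs).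
- by split; [move=> *; apply: (ip_form (G := G)).1; exact: H1_sq|
             move=> *; apply: (ip_form (G := G)).2; exact: H1_sq].
- exact: sb.
- by move=> u _; exact: ip_ge0.
- exact: b_ge0.
- exact: k0.
- by move=> t u hu t0 t1; exact: Phi_scale.
- by move=> u hu; exact: Phi_null.
- exists (Num.min 0 (- (k * L `^ (q - 2)))) => u Su; have [hu u1] := Su.
  have [Ju|Ju] := leP (J k u) 0; last by rewrite ge_min (ltW Ju).
  have [_ uL] := sub u Su Ju; rewrite ge_min; apply/orP; right.
  have := Phi_le conn cnt mK q2 hu uL; rewrite u1 mulr1 => /(ler_wpM2l (ltW k0)).
  by rewrite /energy; have := b_ge0 hu; lra.
(* On the normalized ground state [b] vanishes and only the power term remains. *)
- pose s := (Num.sqrt (ip u0 u0))^-1.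
  have s0 : 0 < s by rewrite invr_gt0 sqrtr_gt0.
  have s2 : s * (s * ip u0 u0) = 1.
    by rewrite mulrA -expr2 exprVn sqr_sqrtr ?(ltW ip0)// mulVf// gt_eqF.
  have ss := sq_subspace (G := G); have si := ip_form (G := G); have su0 := H1_sq hu0.
  have hsu : H1 (s *: u0) by exact: lin_subspaceZ.
  exists (s *: u0); first by split => //; rewrite (sf_Zl ss si)// ?(sf_Zr ss si)//; exact: lin_subspaceZ.
  rewrite /energy (sf_Zl hs sb)// (sf_Zr hs sb)//.
  have -> : b u0 u0 = 0 by rewrite /shifted au0// subrr.
  rewrite !mulr0 sub0r oppr_lt0 mulr_gt0//.
  rewrite Phi_scaleE// mulr_gt0 ?powR_gt0//; exact: Phi_ground_gt0.
- move=> u Su Ju; have [hu u1] := Su; have [hd _] := sub u Su Ju.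
  by have [_ h] := bnd u hu; rewrite u1 mulr1 in h; lra.
- move=> u v Su Sv Ju Jv; have [_ uL] := sub u Su Ju; have [_ vL] := sub v Sv Jv.
  by apply: Phi_mid => //; [case: Su|case: Sv].
- exists (q * L `^ (q - 2) + 1).
    by rewrite ltr_wpDl// mulr_ge0 ?powR_ge0// ltW// (lt_trans _ q2).
  move=> u v Su Sv Ju; have [hu u1] := Su; have [hv v1] := Sv; have [_ uL] := sub u Su Ju.
  apply: (le_trans (Phi_cont conn cnt mK q2 L0 hu hv u1 uL)).
  by rewrite ler_wpM2r ?sqrtr_ge0// lerDl.
- move=> U SU JU; apply: comp => // n; first exact: (sub _ (SU n) (JU n)).1.
  by move=> p; exact: (sub _ (SU n) (JU n)).2.
- exact: (complete_filter conn cnt CC b_ge0 bnd).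
Qed.

Lemma nat_ultra : exists2 U : set_system nat, UltraFilter U & forall N, U [set n | (N <= n)%N].
Proof.
have [U [UU hU]] := @ultraFilterLemma nat \oo _; exists U => // N.
by apply: hU; exists N.
Qed.

Let q0 : 0 < q. Proof. by apply: lt_trans q2. Qed.

(** Local finiteness leaves finitely many edges and boundedness makes them finite in length, so
    [ultra_psi] bounds the whole left-hand side by the error term. *)
Lemma minimizer_bounded m : locally_finite G -> gbounded K -> 0 < m ->
  exists u, NLS_minimizer V M K q m u.
Proof.
move=> [_ lf] bK m0; have k0 : 0 < m / q by rewrite divr_gt0.
have finF : finite_set F.
  have := lf _ bK; congr finite_set; apply/seteqP; split => [_ [p Kp <-]//|e Fe].
  by exists (pt e 0); rewrite /subgraph /= ?edge_of_pt.
have [L L0 H] := minimizer_from_compactness k0.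
have [|u Su hu] := H _ k0 (lexx _); last by exists u; exact: minimizer_of_energy.
move=> U SU dU nU; have [W UW hW] := nat_ultra.
have hU n : H1 (U n) by case: (SU n).
exists W; split=> [||eps eps0]; [exact: ultra_proper|exact: hW|].
set C := m / q * _; have C0 : 0 < C + 1.
  by rewrite ltr_wpDl// !mulr_ge0 ?powR_ge0 ?sqr_ge0 ?invr_ge0 ?(ltW m0) ?(ltW q0).
have eC : 0 < eps / (C + 1) by rewrite divr_gt0.
have [A WA hA] := ultra_psi UW hU nU dU finF (fun e Fe => gbounded_len bK Fe) eC.
exists A => // n m' An Am; have hw := lin_subspaceB hs (hU n) (hU m').
have p0 := psi_ge0 (U n - U m').
have := b_ge0 hw; have := hA n m' An Am; rewrite ler_pdivlMr// -/C.
move: p0; set P := psi _ _; set bw := b _ _; move: C P bw {hA C0 eC} => C P bw.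
by move=> h1 h2 h3; lra.
Qed.

(** With w a difference of two members, k C psi(w) <= (d/16) |w|^2, and [gap] bounds this by 1/16 of
    b(w, w) + d times the sum of the squared coefficients of w. *)
Lemma minimizer_small : (einf (spectrum V M) < einf (essential_spectrum V M))%E ->
  exists2 m0 : R, 0 < m0 & forall m, 0 < m -> m < m0 -> exists u, NLS_minimizer V M K q m u.
Proof.
move=> lt; have [d d0 [n0 [e [he gap]]]] := ground_state_gap conn cnt bM bV cE eu0 lt.
have [L L0 H] := minimizer_from_compactness ltr01.
pose C := q ^+ 2 / 4 * L `^ (q - 2).
have C0 : 0 <= C by rewrite !mulr_ge0 ?powR_ge0 ?invr_ge0 ?(ltW q0).
(* 1 is the range of coefficients for which [L] was obtained; the quotient gives [kC]. *)
pose k1 := Num.min 1 (d / (16 * (C + 1))).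
have C1 : 0 < C + 1 by rewrite ltr_wpDl.
have k10 : 0 < k1 by rewrite lt_min ltr01 divr_gt0// mulr_gt0.
exists (q * k1); first by rewrite mulr_gt0.
move=> m m0 mk; have k0 : 0 < m / q by rewrite divr_gt0.
have kk : m / q <= k1 by rewrite ler_pdivrMr// mulrC ltW.
have kk1 : m / q <= 1 by apply: le_trans kk _; rewrite ge_min lexx.
have kC : 16 * (m / q * C) <= d.
  have : m / q <= d / (16 * (C + 1)) by apply: le_trans kk _; rewrite ge_min lexx orbT.
  by rewrite ler_pdivlMr ?mulr_gt0//; lra.
have [|u Su hu] := H _ k0 kk1; last by exists u; exact: minimizer_of_energy.
move=> U SU dU nU; have [W UW hW] := nat_ultra.
have hU n : H1 (U n) by case: (SU n).
have ss := sq_subspace (G := G); have si := ip_form (G := G).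
exists W; split=> [||eps eps0]; [exact: ultra_proper|exact: hW|].
have coef (k : nat) : (k <= n0)%N -> forall eta : R, 0 < eta -> exists2 A, W A &
    forall n m', A n -> A m' -> \sum_(i < k) ip (e i) (U n - U m') ^+ 2 <= eta.
  elim: k => [|k IH] kn eta eta0.
    by exists setT => [|n m' _ _]; [exact: filterT|rewrite big_ord0 ltW].
  have eta2 : 0 < eta / 2 by rewrite divr_gt0.
  have [A WA hA] := IH (ltnW kn) _ eta2.
  have hk := he k kn; have s0 : 0 < Num.sqrt (eta / 2) by rewrite sqrtr_gt0.
  (* By Cauchy-Schwarz the square is at most [ip (e k) (e k)], and t <= (t + 1)^2 for t >= 0. *)
  have bd n : `|ip (e k) (U n)| <= ip (e k) (e k) + 1.
    have [_ Un1] := SU n.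
    have := sf_CS ss si (fun u _ => ip_ge0 u) (H1_sq hk) (H1_sq (hU n)).
    rewrite Un1 mulr1 => h; have i0 := ip_ge0 (e k).
    rewrite -(@ler_pXn2r _ 2) ?nnegrE ?addr_ge0// real_normK ?num_real//.
    by apply: (le_trans h); have := sqr_ge0 (ip (e k) (e k)); nra.
  have [A' WA' hA'] := ultra_cauchy UW bd s0.
  exists (A `&` A'); first exact: filterI.
  move=> n m' [An A'n] [Am A'm]; rewrite big_ord_recr /=.
  have E : ip (e k) (U n - U m') = ip (e k) (U n) - ip (e k) (U m').
    by apply: (sf_Br ss si); exact: H1_sq.
  have h1 := hA n m' An Am; have := hA' n m' A'n A'm; rewrite -E.
  rewrite -(@ler_pXn2r _ 2) ?nnegrE ?sqrtr_ge0// real_normK ?num_real// sqr_sqrtr ?(ltW eta2)//.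
  by move=> h2; lra.
(* Chosen so that d/16 times the sum of squares is at most [eps]. *)
have et0 : 0 < eps * 16 / d by rewrite divr_gt0// mulr_gt0.
have [A WA hA] := coef n0 (leqnn _) _ et0.
exists A => // n m' An Am; have hw := lin_subspaceB hs (hU n) (hU m').
have h1 := psi_le mK (H1_sq hw); have h2 := gap _ hw; have h3 := hA n m' An Am.
rewrite ler_pdivlMr// in h3; rewrite -/C.
have p0 := psi_ge0 (U n - U m').
have h4 := ler_wpM2r p0 kC; have h5 := ler_wpM2l (ltW d0) h1.
move: h2 h3 h4 h5; set P := psi _ _; set I := ip _ _; set Sg := \sum_(i < n0) _.
by set bw := b _ _; set kc := m / q * C; clearbody P I Sg bw kc; lra.
Qed.

End Minimizers.

Theorem theorem1p6 (R : realType) (G : metricGraph R) (F : set (edge G))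
    (q : R) (V M : gpoint G -> R) :
  connected [set: gpoint G] ->
  ~ compact [set: gpoint G] ->
  locally_finite G ->
  connected (subgraph F) ->
  2 < q -> q < 6 ->
  sum_space (Lp 2%:E) (Lp +oo%E) (real_fun V) ->
  sum_space (@H1 R G) (W1 +oo%E) (real_fun M) ->
  (exists u, ground_state V M u /\ exists2 x, subgraph F x & u x != 0) ->
  ((einf (spectrum V M) < einf (essential_spectrum V M))%E ->
     exists2 mu0 : R, 0 < mu0 & forall mu, 0 < mu -> mu < mu0 ->
       exists u, NLS_minimizer V M (subgraph F) q mu u) /\
  (gbounded (subgraph F) ->
     forall mu, 0 < mu -> exists u, NLS_minimizer V M (subgraph F) q mu u).
Proof.
move=> conn _ lf _ q2 q6 /sqint_plus_boundedP bV sM [u [[c cE eu] uK]].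
have cnt := lf.1; have bM := bounded_coefP conn cnt sM.
split=> [lt|bK m m0].
  exact: (minimizer_small conn cnt q2 q6 bM bV cE eu uK lt).
exact: (minimizer_bounded conn cnt q2 q6 bM bV cE eu uK lf bK m0).
Qed.
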